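(* Let $\Gamma=\Gamma_5$ be the Fermat curve $x^6+y^6+z^6=0$ in characteristic $5$, with automorphism group $\mathrm{PGU}_3(\mathbb{F}_{25})$, and let $\mathcal{D}$ be the set of connected components of the graph $G$ on the set $\mathcal{Q}$ of non-singular conics totally tangent to $\Gamma$. For each element $D$ of $\mathcal{D}$, the action of $\mathrm{stab}(D)$ on the triangular graph $D\cong T(7)$ identifies $\mathrm{stab}(D)$ with the alternating subgroup $\mathfrak{A}_7$ of $\mathrm{Aut}(T(7))\cong\mathfrak{S}_7$; that is, the homomorphism $\mathrm{stab}(D)\to\mathrm{Aut}(D)\cong\mathfrak{S}_7$ given by the action is injective with image $\mathfrak{A}_7$.
   Context: Work over an algebraically closed field $k$ of characteristic $5$. $\Gamma=\Gamma_5\subset\mathbb{P}^2$ is the curve $x^6+y^6+z^6=0$; its automorphism group $\{g\in\mathrm{PGL}_3(k)\mid g(\Gamma)=\Gamma\}$ is $\mathrm{PGU}_3(\mathbb{F}_{25})$, of order $378000$. $\mathcal{P}$ denotes the set of Weierstrass points of $\Gamma$; equivalently, the set of $\mathbb{F}_{25}$-rational points of $\Gamma_5$; $|\mathcal{P}|=126$. A line of $\mathbb{P}^2$ is a special secant line of $\Gamma$ if it passes through two distinct points of $\mathcal{P}$. A non-singular conic $Q\subset\mathbb{P}^2$ is totally tangent to $\Gamma$ if $Q$ meets $\Gamma$ at six distinct points, each with intersection multiplicity $2$. $\mathcal{Q}$ denotes the set of all such conics; one has $|\mathcal{Q}|=3150$ and $Q\cap\Gamma\subset\mathcal{P}$ for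 $Q\in\mathcal{Q}$. For $Q\in\mathcal{Q}$, $\mathcal{S}(Q)$ is the set of the $15$ special secant lines of $\Gamma$ passing through two distinct points of $Q\cap\Gamma$. $G$ is the graph with vertex set $\mathcal{Q}$ in which distinct $Q,Q'$ are adjacent if and only if $|Q\cap Q'|=4$ and $|\mathcal{S}(Q)\cap\mathcal{S}(Q')|=3$. $\mathcal{D}$ is the set of connected components of $G$ (there are $150$ of them); each $D\in\mathcal{D}$, as a graph, is isomorphic to the triangular graph $T(7)$. The triangular graph $T(m)$ has as vertices the unordered pairs of distinct elements of $\{1,\dots,m\}$, two distinct pairs being adjacent if and only if they have non-empty intersection; $\mathrm{Aut}(T(7))\cong\mathfrak{S}_7$, the symmetric group acting on $\{1,\dots,7\}$. $\mathrm{PGU}_3(\mathbb{F}_{25})$ acts on $\mathcal{Q}$ and hence on $\mathcal{D}$; $\mathrm{stab}(D)$ denotes the stabilizer subgroup of $D$ in $\mathrm{PGU}_3(\mathbb{F}_{25})$. *)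

(* Defs.v *)
From HB Require Import structures.
From Stdlib Require Import Relations.
From mathcomp Require Import all_boot all_order all_algebra all_fingroup.
From mathcomp Require Import all_solvable.
From mathcomp Require Import boolp classical_sets functions cardinality.
From mathcomp Require Import mpoly.

Set Implicit Arguments.
Unset Strict Implicit.
Unset Printing Implicit Defensive.

Import GRing.Theory.

Local Notation repr := generic_quotient.repr.

Local Open Scope quotient_scope.
Local Open Scope card_scope.
Local Open Scope classical_set_scope.
Local Open Scope ring_scope.

Section Plane.
Variable k : closedFieldType.

(* Points and lines of P^2 are the subspaces of k^3 of dimension 1 and 2. *)
Definition ppoint := {V : {vspace 'rV[k]_3} | \dim V == 1%N}.
HB.instance Definition _ := SubChoice.on ppoint.
Definition pline := {V : {vspace 'rV[k]_3} | \dim V == 2%N}.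
HB.instance Definition _ := SubChoice.on pline.

Definition on_line (p : ppoint) (l : pline) : Prop := (val p <= val l)%VS.

(* Only used for homogeneous f, of any degree including 0. *)
Definition zero_locus (f : {mpoly k[3]}) : set ppoint :=
  [set p : ppoint | forall v : 'rV[k]_3, v \in val p -> f.@[v 0] = 0].

Definition GL3 := {A : 'M[k]_3 | A \in unitmx}.
HB.instance Definition _ := SubChoice.on GL3.

Lemma GL3_inj (A B : GL3) : val A = val B -> A = B.
Proof. exact: val_inj. Qed.

Definition GL3_one : GL3 := @Sub _ _ GL3 1%:M (unitmx1 k 3).

Lemma GL3_mul_subproof (A B : GL3) : val A *m val B \in unitmx.
Proof. by rewrite unitmx_mul (valP A) (valP B). Qed.
Definition GL3_mul (A B : GL3) : GL3 := @Sub _ _ GL3 _ (GL3_mul_subproof A B).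

Lemma GL3_inv_subproof (A : GL3) : invmx (val A) \in unitmx.
Proof. by rewrite unitmx_inv (valP A). Qed.
Definition GL3_inv (A : GL3) : GL3 := @Sub _ _ GL3 _ (GL3_inv_subproof A).

Definition proportional (A B : GL3) : bool :=
  `[< exists2 c : k, c != 0 & val B = c *: val A >].

Lemma proportional_refl : reflexive proportional.
Proof. by move=> A; apply/asboolP; exists 1; rewrite ?oner_eq0 ?scale1r. Qed.

Lemma proportional_sym : ssrbool.symmetric proportional.
Proof.
suff H A B : proportional A B -> proportional B A.
  by move=> A B; apply/idP/idP; apply: H.
move=> /asboolP[c c0 e]; apply/asboolP; exists c^-1; first by rewrite invr_eq0.
by rewrite e scalerA mulVf // scale1r.
Qed.

Lemma proportional_trans : transitive proportional.
Proof.
move=> B A C /asboolP[c c0 eB] /asboolP[d d0 eC]; apply/asboolP.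
by exists (d * c); rewrite ?mulf_neq0 // eC eB scalerA.
Qed.

Canonical proportional_equiv :=
  EquivRel proportional proportional_refl proportional_sym proportional_trans.

Definition PGL3 := {eq_quot proportional}.
HB.instance Definition _ := EqQuotient.on PGL3.
HB.instance Definition _ := Choice.on PGL3.

Lemma pi_PGL3P (A B : GL3) :
  \pi_PGL3 A = \pi_PGL3 B <-> exists2 c : k, c != 0 & val B = c *: val A.
Proof.
by split=> [/eqmodP/asboolP//|H]; apply/eqmodP/asboolP.
Qed.

Lemma repr_PGL3 (A : GL3) :
  exists2 c : k, c != 0 & val (repr (\pi_PGL3 A)) = c *: val A.
Proof. by apply/pi_PGL3P; rewrite reprK. Qed.

Definition PGL3_one : PGL3 := \pi_PGL3 GL3_one.
Definition PGL3_mul (g h : PGL3) : PGL3 := \pi_PGL3 (GL3_mul (repr g) (repr h)).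
Definition PGL3_inv (g : PGL3) : PGL3 := \pi_PGL3 (GL3_inv (repr g)).

Lemma PGL3_mulE (A B : GL3) :
  PGL3_mul (\pi_PGL3 A) (\pi_PGL3 B) = \pi_PGL3 (GL3_mul A B).
Proof.
have [c c0 eA] := repr_PGL3 A; have [d d0 eB] := repr_PGL3 B.
apply/esym/pi_PGL3P; exists (d * c); rewrite ?mulf_neq0 //=.
by rewrite [sval (repr (\pi A))]eA [sval (repr (\pi B))]eB -scalemxAl
  -scalemxAr scalerA mulrC.
Qed.

Lemma PGL3_mulA : associative PGL3_mul.
Proof.
move=> g h u; rewrite -[g]reprK -[h]reprK -[u]reprK.
move: (repr g) (repr h) (repr u) => A B C; rewrite (PGL3_mulE B C) (PGL3_mulE A B) !PGL3_mulE.
by congr (\pi_PGL3 _); apply: GL3_inj; rewrite /= mulmxA.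
Qed.

Lemma PGL3_mul1 : left_id PGL3_one PGL3_mul.
Proof.
move=> g; rewrite -[g]reprK; move: (repr g) => A; rewrite PGL3_mulE.
by congr (\pi_PGL3 _); apply: GL3_inj; rewrite /= mul1mx.
Qed.

Lemma PGL3_1mul : right_id PGL3_one PGL3_mul.
Proof.
move=> g; rewrite -[g]reprK; move: (repr g) => A; rewrite PGL3_mulE.
by congr (\pi_PGL3 _); apply: GL3_inj; rewrite /= mulmx1.
Qed.

Lemma PGL3_mulV : left_inverse PGL3_one PGL3_inv PGL3_mul.
Proof.
move=> g; rewrite -{2}[g]reprK PGL3_mulE.
by congr (\pi_PGL3 _); apply: GL3_inj; rewrite /= mulVmx // (valP (repr g)).
Qed.

Lemma PGL3_mulVr : right_inverse PGL3_one PGL3_inv PGL3_mul.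
Proof.
move=> g; rewrite -{1}[g]reprK PGL3_mulE.
by congr (\pi_PGL3 _); apply: GL3_inj; rewrite /= mulmxV // (valP (repr g)).
Qed.

HB.instance Definition _ := isGroup.Build PGL3
  PGL3_mulA PGL3_mul1 PGL3_1mul PGL3_mulV PGL3_mulVr.

(* PGL_3(k) acts on row vectors by v |-> v *m A, hence from the right, in
   agreement with the product of permutations in MathComp, where
   (s * t) x = t (s x). *)
Lemma GL3_act_subproof (p : ppoint) (A : GL3) :
  \dim (linfun (mulmxr (val A)) @: val p)%VS == 1%N.
Proof.
rewrite limg_dim_eq ?(eqP (valP p)) //.
suff -> : lker (linfun (mulmxr (val A) : 'rV[k]_3 -> 'rV[k]_3)) = 0%VS.
  exact: capv0.
apply/eqP/lker0P => u v; rewrite !lfunE /= => e.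
by rewrite -(mulmxK (valP A) u) [u *m _]e mulmxK // (valP A).
Qed.
Definition GL3_act (p : ppoint) (A : GL3) : ppoint :=
  @Sub _ _ ppoint _ (GL3_act_subproof p A).

Definition pt_act (p : ppoint) (g : PGL3) : ppoint := GL3_act p (repr g).

Lemma pt_actE (p : ppoint) (A : GL3) : pt_act p (\pi_PGL3 A) = GL3_act p A.
Proof.
have [c c0 e] := repr_PGL3 A.
apply: val_inj; rewrite /= [sval _]e.
have eL : linfun (mulmxr (c *: val A) : 'rV[k]_3 -> 'rV[k]_3)
    = c *: linfun (mulmxr (val A)).
  by apply/lfunP=> v; rewrite scale_lfunE !lfunE /= scalemxAr.
rewrite eL; apply/eqP; rewrite eqEsubv; apply/andP; split.
  apply/subvP=> _ /memv_imgP[v vp ->].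
  by rewrite scale_lfunE memvZ // memv_img.
apply/subvP=> _ /memv_imgP[v vp ->]; apply/memv_imgP.
by exists (c^-1 *: v); rewrite ?memvZ // scale_lfunE linearZ scalerA mulfV ?scale1r.
Qed.

Lemma pt_actM (p : ppoint) (g h : PGL3) :
  pt_act p (g * h)%g = pt_act (pt_act p g) h.
Proof.
rewrite -[g]reprK -[h]reprK; move: (repr g) (repr h) => A B.
rewrite [(_ * _)%g]PGL3_mulE !pt_actE; apply: val_inj => /=.
rewrite -limg_comp; congr (_ @: _)%VS; apply/lfunP=> v.
by rewrite comp_lfunE !lfunE /= mulmxA.
Qed.

Definition set_act (X : set ppoint) (g : PGL3) : set ppoint :=
  [set pt_act p g | p in X].

Local Notation "x %:F" := (tofrac x).

(* The local ring O_p of P^2 at p, as a subring of k(x, y, z). *)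
Definition local_ring (p : ppoint) : set {fraction {mpoly k[3]}} :=
  [set u | exists d (a b : {mpoly k[3]}),
    [/\ a \is d.-homog, b \is d.-homog, ~ zero_locus b p & u = a%:F / b%:F]].

(* The ideal of O_p generated by the local equations f / l ^ deg f and
   g / l ^ deg g of two nonzero forms, for a linear form l with l(p) != 0; it
   does not depend on l. The degree of a form f is (msize f).-1. *)
Definition local_ideal (p : ppoint) (f g : {mpoly k[3]}) :
    set {fraction {mpoly k[3]}} :=
  [set w | exists (l : {mpoly k[3]}) u v,
    [/\ l \is 1.-homog, ~ zero_locus l p, local_ring p u, local_ring p v &
     w = u * (f%:F / l%:F ^+ (msize f).-1)
       + v * (g%:F / l%:F ^+ (msize g).-1)]].

(* dim_k O_p / (f, g) = n: the classes of e_0, ..., e_(n-1) form a basis. *)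
Definition intersection_multiplicity
    (p : ppoint) (f g : {mpoly k[3]}) (n : nat) : Prop :=
  exists e : 'I_n -> {fraction {mpoly k[3]}},
    (forall i, local_ring p (e i)) /\
    forall u, local_ring p u -> exists! c : 'rV[k]_n,
      local_ideal p f g (u - \sum_(i < n) ((c 0 i)%:MP)%:F * e i).

Definition fermat : {mpoly k[3]} := \sum_(i < 3) 'X_i ^+ 6.
Definition Gamma : set ppoint := zero_locus fermat.

(* PGU_3(F_25), as the automorphism group of Gamma. *)
Definition PGU : set PGL3 := [set g | set_act Gamma g = Gamma].

(* F_25 is the set of roots of X^25 - X in k (of characteristic 5). *)
Definition rational_points : set ppoint :=
  [set p : ppoint | Gamma p /\ exists v : 'rV[k]_3, [/\ v \in val p, v != 0 &
    forall i, v 0 i ^+ 25 = v 0 i]].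

Definition special_secant (l : pline) : Prop :=
  exists p p', [/\ rational_points p, rational_points p', p <> p',
    on_line p l & on_line p' l].

Definition nonsingular (f : {mpoly k[3]}) : Prop :=
  forall p, zero_locus f p -> exists i, ~ zero_locus f^`M(i) p.

(* A non-singular conic is identified with its set of points, which determines
   its equation q up to a scalar. *)
Definition totally_tangent_conics : set (set ppoint) :=
  [set Q | exists q : {mpoly k[3]},
    [/\ q \is 2.-homog, nonsingular q, Q = zero_locus q,
        Q `&` Gamma #= `I_6 &
        forall p, (Q `&` Gamma) p -> intersection_multiplicity p q fermat 2]].

Definition secants (Q : set ppoint) : set pline :=
  [set l : pline | special_secant l /\
    exists p p', [/\ (Q `&` Gamma) p, (Q `&` Gamma) p', p <> p',
      on_line p l & on_line p' l]].

Definition adjacent (Q Q' : set ppoint) : Prop :=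
  [/\ totally_tangent_conics Q, totally_tangent_conics Q', Q <> Q',
      Q `&` Q' #= `I_4 & secants Q `&` secants Q' #= `I_3].

Definition conic_components : set (set (set ppoint)) :=
  [set D | exists2 Q, totally_tangent_conics Q &
    D = [set Q' | clos_refl_trans _ adjacent Q Q']].

Definition stab (D : set (set ppoint)) : set PGL3 :=
  [set g | PGU g /\ [set set_act Q g | Q in D] = D].

End Plane.

Arguments on_line {k}.
Arguments Gamma {k}.

Definition pairs (m : nat) := {e : {set 'I_m} | #|e| == 2%N}.
HB.instance Definition _ m := SubFinite.on (pairs m).

Definition tri_adjacent m (a b : pairs m) : Prop :=
  a <> b /\ val a :&: val b != finset.set0.

Lemma pair_act_subproof m (e : pairs m) (s : 'S_m) :
  #|[set s i | i in val e]%SET| == 2%N.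
Proof. by rewrite card_imset ?(valP e) //; apply: perm_inj. Qed.
Definition pair_act m (e : pairs m) (s : 'S_m) : pairs m :=
  @Sub _ _ (pairs m) _ (pair_act_subproof e s).

Definition triangular_iso (k : closedFieldType) m
    (phi : pairs m -> set (ppoint k)) (D : set (set (ppoint k))) : Prop :=
  [/\ injective phi, range phi = D &
      forall a b, tri_adjacent a b <-> adjacent (phi a) (phi b)].

(* Main.v *)
(* Write [bar v] for the entrywise fifth power, so that Gamma is v (bar v)^T = 0 and
   PGU is the group of the unitary matrices A (bar A)^T = 1. For a conic x B x^T = 0,
   contact of order 2 at v means that bar v is proportional to v B; since six points
   determine a conic, B (bar B) is then a scalar, which may be taken to be 1. Three
   contact points form a frame in which B is real (over F_5), and diagonalising it
   there exhibits the conic as the image of Q0 : x^2 + y^2 + z^2 = 0 under an element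
   of PGU. The stabiliser of Q0 consists of the real orthogonal matrices.

   The secants common to Q0 and an adjacent conic B are three eigenvectors of B which
   form a real orthonormal frame, in which B is diag (1, z, z^2) up to a scalar, with
   z a primitive cube root of unity. Hence all neighbours of Q0 are known, and the
   component of Q0 is found to consist of 21 explicit conics over F_25, labelled by the
   pairs in {0, ..., 6}. The 3-cycles (0 1 b) generate A_7 and are induced by explicit
   unitary matrices. Finally, an element of PGU fixing the conics {0, 1}, ..., {0, 4}
   is trivial: the action is therefore faithful, and no odd permutation is induced,
   for otherwise the transposition (5 6) would be induced too. *)

From HB Require Import structures.
Require Import Defs.
From mathcomp Require Import all_boot all_order all_algebra all_fingroup.
From mathcomp Require Import all_solvable.
From mathcomp Require Import boolp classical_sets functions cardinality.
From mathcomp Require Import mpoly ring.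

Set Implicit Arguments.
Unset Strict Implicit.
Unset Printing Implicit Defensive.

Import GRing.Theory.

Local Notation repr := generic_quotient.repr.

(** * Points, conics and projectivities *)

(** Only two facts about intersection multiplicities are needed: they are invariant under linear
    substitutions, and multiplicity 2 excludes transversality. Total tangency of Q0 is never
    computed in a local ring: a component contains some totally tangent conic, an element of PGU
    carries it to Q0, and tangency is transported along. Likewise adjacency is verified by hand for
    {0, 1} and {0, 2} alone, since A_7 is transitive on the ordered edges of T(7), and exhaustive
    search is confined to the 240 real orthogonal matrices. An arbitrary identification with T(7)
    differs from the constructed one by a permutation, and conjugation by it preserves parity.

    The rescalings by roots have one origin: a factor [t] becomes [t ^+ 5] under bar. Relations
    quadratic in a matrix and its conjugate are therefore normalised by sixth roots, and relations
    between a vector and its conjugate by fourth roots. *)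

Lemma card_seqP (T : choiceType) (X : set T) (n : nat) : (X #= `I_n)%card <->
  exists s : seq T, [/\ uniq s, size s = n & forall x, X x <-> x \in s].
Proof.
split.
  elim: n X => [|n IHn] X.
    rewrite II0 card_eq0 => /eqP ->.
    by exists [::]; split.
  move=> /eq_cardSP[x Xx /IHn[s [us ss hs]]].
  exists (x :: s); split=> /= [||y].
  - by rewrite us andbT; apply/negP => /hs[_]; apply.
  - by rewrite ss.
  rewrite inE; split=> [Xy|/predU1P[->//|/hs[]//]].
  have [//|yx /=] := eqVneq y x; apply/hs; split=> //=; exact/eqP.
case=> s; elim: s n X => [|x s IHs] n X [/= us <- hs].
  rewrite II0 card_eq0; apply/eqP/seteqP; split=> y //; by move/hs.
move: us => /andP[xs us]; apply/eq_cardSP; exists x; first by apply/hs; rewrite mem_head.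
apply: IHs; split=> // y; split=> [[/hs]|ys].
  by rewrite inE => /predU1P[].
split; first by apply/hs; rewrite inE ys orbT.
by move=> e; move: xs; rewrite -e ys.
Qed.

Section Points.
Local Open Scope card_scope.
Local Open Scope quotient_scope.
Local Open Scope ring_scope.
Local Open Scope classical_set_scope.
Variable k : closedFieldType.
Implicit Types (u v : 'rV[k]_3) (A B : 'M[k]_3) (p : ppoint k) (g : PGL3 k).

Lemma dim_const1 : \dim <[const_mx 1 : 'rV[k]_3]>%VS == 1%N.
Proof.
rewrite dim_vline; suff -> : const_mx 1 != 0 :> 'rV[k]_3 by [].
by apply/eqP => /rowP/(_ 0); rewrite !mxE => /eqP; rewrite oner_eq0.
Qed.

(** The zero vector is sent to [1 : 1 : 1], so that [pt] is total and [pt_scale] holds for every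
    [v]. *)
Definition pt v : ppoint k :=
  insubd (Sub <[const_mx 1]>%VS dim_const1 : ppoint k) <[v]>%VS.

Lemma val_pt v : v != 0 -> val (pt v) = <[v]>%VS.
Proof. by move=> v0; rewrite val_insubd dim_vline v0. Qed.

Lemma ptP p : exists2 v, v != 0 & p = pt v.
Proof.
have /eqP pd := valP p.
have p0 : (val p != 0)%VS by rewrite -dimv_eq0 pd.
exists (vpick (val p)); first by rewrite vpick0.
apply: val_inj; rewrite val_pt ?vpick0 //; apply/eqP.
rewrite eq_sym eqEdim pd dim_vline vpick0 p0 andbT.
by rewrite -memvE memv_pick.
Qed.

Lemma pt_scale (c : k) v : c != 0 -> pt (c *: v) = pt v.
Proof.
move=> c0; have [-> | v0] := eqVneq v 0; first by rewrite scaler0.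
apply: val_inj; rewrite !val_pt ?scaler_eq0 ?negb_or ?c0 //; apply/eqP.
rewrite eqEdim !dim_vline scaler_eq0 negb_or c0 v0 andbT.
by rewrite -memvE memvZ ?memv_line.
Qed.

Lemma pt_eqP u v : u != 0 -> v != 0 -> pt u = pt v ->
  exists2 c, c != 0 & u = c *: v.
Proof.
move=> u0 v0 /(congr1 val); rewrite !val_pt // => e.
have /vlineP[c ec] : u \in <[v]>%VS by rewrite -e memv_line.
by exists c => //; apply: contraNneq u0 => c0; rewrite ec c0 scale0r.
Qed.

Definition bil B u v : k := (u *m B *m v^T) 0 0.

Lemma bilE B u v : bil B u v = \sum_i \sum_j u 0 i * B i j * v 0 j.
Proof.
rewrite /bil mxE exchange_big /=; apply: eq_bigr => j _.
by rewrite !mxE big_distrl.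
Qed.

Lemma bilDl B u1 u2 v : bil B (u1 + u2) v = bil B u1 v + bil B u2 v.
Proof. by rewrite /bil !mulmxDl mxE. Qed.
Lemma bilDr B u v1 v2 : bil B u (v1 + v2) = bil B u v1 + bil B u v2.
Proof. by rewrite /bil linearD !mulmxDr mxE. Qed.
Lemma bilZl B c u v : bil B (c *: u) v = c * bil B u v.
Proof. by rewrite /bil -!scalemxAl mxE. Qed.
Lemma bilZr B c u v : bil B u (c *: v) = c * bil B u v.
Proof. by rewrite /bil linearZ /= -!scalemxAr mxE. Qed.
Lemma bilZ B c u v : bil (c *: B) u v = c * bil B u v.
Proof. by rewrite /bil -!scalemxAr -scalemxAl mxE. Qed.
Lemma bil_sym B u v : B^T = B -> bil B u v = bil B v u.
Proof.
move=> sB; rewrite !bilE exchange_big /=; apply: eq_bigr => i _.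
apply: eq_bigr => j _; have -> : B j i = B i j by rewrite -{1}sB mxE.
by rewrite mulrC [u 0 j * _]mulrC mulrA.
Qed.
Lemma bil_conj B A u v : bil (A *m B *m A^T) u v = bil B (u *m A) (v *m A).
Proof. by rewrite /bil trmx_mul !mulmxA. Qed.

Definition conic B : set (ppoint k) :=
  [set p : ppoint k | forall v, v \in val p -> bil B v v = 0].

Lemma conic_pt B v : v != 0 -> conic B (pt v) <-> bil B v v = 0.
Proof.
move=> v0; rewrite /conic /= val_pt //; split=> [|e u /vlineP[c ->]].
  by apply; rewrite memv_line.
by rewrite bilZl bilZr e !mulr0.
Qed.

Lemma conic_scale c B : c != 0 -> conic (c *: B) = conic B.
Proof.
move=> c0; apply/seteqP; split=> p /= H v /H.
  by rewrite bilZ => /eqP; rewrite mulf_eq0 (negPf c0) => /eqP.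
by rewrite bilZ => ->; rewrite mulr0.
Qed.

Lemma zero_locus_pt d (f : {mpoly k[3]}) v : f \is d.-homog -> v != 0 ->
  zero_locus f (pt v) <-> f.@[v 0] = 0.
Proof.
move=> hf v0; rewrite /zero_locus /= val_pt //; split=> [|e u /vlineP[c ->]].
  by apply; rewrite memv_line.
transitivity (c ^+ d * f.@[v 0]); last by rewrite e mulr0.
rewrite !mevalE mulr_sumr; apply: eq_big_seq => m mf.
rewrite (eq_bigr (fun i => c ^+ m i * v 0 i ^+ m i)); last first.
  by move=> i _; rewrite mxE exprMn.
rewrite big_split /= prodrXr -mdegE (dhomog_mf hf mf) /=.
by rewrite mulrCA.
Qed.

Lemma meval_fermat v : (fermat k).@[v 0] = \sum_i v 0 i ^+ 6.
Proof.
by rewrite /fermat rmorph_sum /=; apply: eq_bigr => i _; rewrite rmorphXn /= mevalXU.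
Qed.

Lemma fermat_homog : fermat k \is 6.-homog.
Proof.
apply: rpred_sum => i _.
have hX : ('X_i : {mpoly k[3]}) \is 1.-homog by rewrite dhomogX /= mdeg1.
exact: (dhomogMn 6 hX).
Qed.

Lemma Gamma_pt v : v != 0 -> Gamma (pt v) <-> \sum_i v 0 i ^+ 6 = 0.
Proof. by move=> v0; rewrite -meval_fermat; apply: zero_locus_pt fermat_homog v0. Qed.

(** Total in [A]: a singular matrix gives the identity class. *)
Definition pgl A : PGL3 k := \pi_(PGL3 k) (insubd (GL3_one k) A).

Lemma val_GL3_insubd A : A \in unitmx -> val (insubd (GL3_one k) A) = A.
Proof. by move=> Au; rewrite val_insubd Au. Qed.

Lemma pglP g : exists2 A, A \in unitmx & g = pgl A.
Proof.
exists (val (repr g)); first exact: (valP (repr g)).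
by rewrite /pgl valKd reprK.
Qed.

Lemma pgl_scale c A : c != 0 -> A \in unitmx -> pgl (c *: A) = pgl A.
Proof.
move=> c0 Au; have cAu : c *: A \in unitmx by rewrite unitmxZ // unitfE.
apply/pi_PGL3P; exists c^-1; first by rewrite invr_eq0.
by rewrite !val_GL3_insubd // scalerA mulVf ?scale1r.
Qed.

Lemma pglM A B : A \in unitmx -> B \in unitmx ->
  (pgl A * pgl B)%g = pgl (A *m B).
Proof.
move=> Au Bu; rewrite [LHS]PGL3_mulE; congr (\pi_(PGL3 k) _).
by apply: GL3_inj; rewrite !val_GL3_insubd ?unitmx_mul ?Au //= !val_GL3_insubd.
Qed.

Lemma pgl1 : pgl 1%:M = 1%g.
Proof.
by congr (\pi_(PGL3 k) _); apply: GL3_inj; rewrite val_GL3_insubd // unitmx1.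
Qed.

Lemma pt_act_pgl v A : v != 0 -> A \in unitmx -> pt_act (pt v) (pgl A) = pt (v *m A).
Proof.
move=> v0 Au; rewrite /pgl pt_actE; apply: val_inj => /=.
rewrite [sval (insubd _ _)](val_GL3_insubd Au) [sval (pt v)](val_pt v0) limg_line.
rewrite lfunE /= val_pt //; apply: contraNneq v0 => e.
by rewrite -(mulmxK Au v) e mul0mx.
Qed.

Lemma mulmx_neq0 v A : A \in unitmx -> v != 0 -> v *m A != 0.
Proof.
by move=> Au; apply: contraNneq => e; rewrite -(mulmxK Au v) e mul0mx.
Qed.

Lemma pt_act1 p : pt_act p 1%g = p.
Proof.
have [v v0 ->] := ptP p.
by rewrite -pgl1 pt_act_pgl ?unitmx1 // mulmx1.
Qed.

Lemma pt_actK g : cancel (fun p => pt_act p g) (fun p => pt_act p g^-1%g).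
Proof. by move=> p; rewrite -pt_actM mulgV pt_act1. Qed.

Lemma pt_act_inj g : injective (fun p => pt_act p g).
Proof. exact: can_inj (pt_actK g). Qed.

Lemma set_act1 (X : set (ppoint k)) : set_act X 1%g = X.
Proof.
apply/seteqP; split=> [_ [p Xp <-]|p Xp]; first by rewrite pt_act1.
by exists p; rewrite ?pt_act1.
Qed.

Lemma set_actM (X : set (ppoint k)) (g h : PGL3 k) :
  set_act X (g * h)%g = set_act (set_act X g) h.
Proof.
apply/seteqP; split=> [_ [p Xp <-]|_ [_ [p Xp <-] <-]].
  by rewrite pt_actM; do 2 eexists => //.
by exists p => //; rewrite pt_actM.
Qed.

Lemma set_actK (X : set (ppoint k)) g : set_act (set_act X g) g^-1%g = X.
Proof. by rewrite -set_actM mulgV set_act1. Qed.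

Lemma set_actVK (X : set (ppoint k)) g : set_act (set_act X g^-1%g) g = X.
Proof. by rewrite -set_actM mulVg set_act1. Qed.

Lemma set_act_inj g : injective (fun X : set (ppoint k) => set_act X g).
Proof. by move=> X Y /(congr1 (fun Z => set_act Z g^-1%g)); rewrite !set_actK. Qed.

Lemma set_actI (X Y : set (ppoint k)) g :
  set_act (X `&` Y) g = set_act X g `&` set_act Y g.
Proof.
apply/seteqP; split=> [_ [p [Xp Yp] <-]|]; first by split; exists p.
by move=> _ [[p Xp <-] [q Yq /pt_act_inj e]]; exists p => //; split; rewrite // -e.
Qed.

Lemma card_set_act (X : set (ppoint k)) g (n : nat) : X #= `I_n -> set_act X g #= `I_n.
Proof.
move=> Xn; apply: card_eq_trans Xn; apply: inj_card_eq => x y _ _; exact: pt_act_inj.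
Qed.

(** Points move by [v *m A], so equations are pulled back: [v] satisfies [A *m B *m A^T] exactly
    when [v *m A] satisfies [B]. *)
Lemma conic_act A B : A \in unitmx ->
  set_act (conic (A *m B *m A^T)) (pgl A) = conic B.
Proof.
move=> Au; apply/seteqP; split=> [_ [p + <-]|p].
  have [v v0 ->] := ptP p; rewrite conic_pt // pt_act_pgl // conic_pt ?mulmx_neq0 //.
  by rewrite bil_conj.
have [v v0 ->] := ptP p; rewrite conic_pt // => e.
exists (pt (v *m invmx A)); last first.
  by rewrite pt_act_pgl ?mulmx_neq0 ?unitmx_inv // mulmxKV.
by rewrite /= conic_pt ?mulmx_neq0 ?unitmx_inv // bil_conj !mulmxKV.
Qed.

End Points.

(** * Intersection multiplicities *)

Section Fractions.
Local Open Scope ring_scope.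
Local Open Scope quotient_scope.
Variable R : idomainType.
Implicit Types a b c d : R.
Local Notation "x %:F" := (tofrac x).

Lemma tofrac_divD a b c d : b != 0 -> d != 0 ->
  a%:F / b%:F + c%:F / d%:F = (a * d + c * b)%:F / (b * d)%:F.
Proof. by move=> b0 d0; rewrite addf_div ?tofrac_eq0 // tofracD !tofracM. Qed.

Lemma tofrac_divM a b c d : a%:F / b%:F * (c%:F / d%:F) = (a * c)%:F / (b * d)%:F.
Proof. by rewrite mulf_div !tofracM. Qed.

Lemma tofrac_divV a b : (a%:F / b%:F)^-1 = b%:F / a%:F.
Proof. exact: invf_div. Qed.

Lemma tofrac_div_eq a b c d : b != 0 -> d != 0 ->
  (a%:F / b%:F == c%:F / d%:F) = (a * d == c * b).
Proof. by move=> b0 d0; rewrite eqr_div ?tofrac_eq0 // -!tofracM tofrac_eq. Qed.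

Lemma tofrac_div1 a : a%:F = a%:F / 1%:F.
Proof. by rewrite tofrac1 divr1. Qed.

Lemma tofrac_repr (u : {fraction R}) :
  (frac (repr u)).2 != 0 /\ u = (frac (repr u)).1%:F / (frac (repr u)).2%:F.
Proof.
split; first exact: denom_ratioP.
rewrite -{1}[u]reprK; move: (repr u) => x.
unlock tofrac; rewrite -[X in _ * X]FracField.pi_inv -[RHS]FracField.pi_mul.
rewrite /FracField.mulf /FracField.invf !numden_Ratio ?oner_neq0 ?denom_ratioP //.
by rewrite mulr1 mul1r FracField.Ratio_numden.
Qed.

Lemma tofracE (u : {fraction R}) : exists a b, b != 0 /\ u = a%:F / b%:F.
Proof. by have := tofrac_repr u; do 2 eexists; eassumption. Qed.

End Fractions.

(** * Germs at a point and their values *)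

Section LocalRing.
Local Open Scope ring_scope.
Local Open Scope classical_set_scope.
Variable k : closedFieldType.
Implicit Types (v : 'rV[k]_3) (a b f g : {mpoly k[3]}) (u w : {fraction {mpoly k[3]}}).
Local Notation "x %:F" := (tofrac x).

Lemma msize_dhomog d f : f != 0 -> f \is d.-homog -> (msize f).-1 = d.
Proof.
by move=> f0 hf; exact: (dhomog_uniq f0 (dhomog_msize hf) hf).
Qed.

(** Evaluation from the local ring to its residue field, as a relation because only regular
    fractions have a value. Equal degrees make the value independent of the scaling of [v]. *)
Definition value_at v u (c : k) : Prop :=
  exists d a b, [/\ a \is d.-homog, b \is d.-homog, b.@[v 0] != 0,
    u = a%:F / b%:F & c = a.@[v 0] / b.@[v 0]].

Lemma meval_neq0 v b : b.@[v 0] != 0 -> b != 0.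
Proof. by apply: contraNneq => ->; rewrite meval0. Qed.

Lemma local_ringP v u : v != 0 -> local_ring (pt v) u <-> exists c, value_at v u c.
Proof.
move=> v0; split=> [[d [a [b [ha hb bv ->]]]]|[c [d [a [b [ha hb bv -> _]]]]]].
  exists (a.@[v 0] / b.@[v 0]), d, a, b; split=> //.
  by apply/eqP => e; apply: bv; apply/(zero_locus_pt hb v0).
by exists d, a, b; split=> //; move/(zero_locus_pt hb v0)/eqP; apply/negP.
Qed.

Lemma value_at_uniq v u c1 c2 : value_at v u c1 -> value_at v u c2 -> c1 = c2.
Proof.
move=> [d [a [b [_ _ bv -> ->]]]] [d' [a' [b' [_ _ bv' /eqP e ->]]]].
move: e; rewrite tofrac_div_eq ?(meval_neq0 bv) ?(meval_neq0 bv') // => /eqP e.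
by apply/eqP; rewrite eqr_div // -!mevalM e.
Qed.

Lemma value_atD v u1 u2 c1 c2 :
  value_at v u1 c1 -> value_at v u2 c2 -> value_at v (u1 + u2) (c1 + c2).
Proof.
move=> [d [a [b [ha hb bv -> ->]]]] [d' [a' [b' [ha' hb' bv' -> ->]]]].
exists (d + d')%N, (a * b' + a' * b), (b * b'); split.
- by apply: rpredD; [exact: dhomogM | rewrite mulrC; exact: dhomogM].
- exact: dhomogM.
- by rewrite mevalM mulf_neq0.
- by rewrite tofrac_divD ?(meval_neq0 bv) ?(meval_neq0 bv').
by rewrite addf_div // mevalD !mevalM.
Qed.

Lemma value_atM v u1 u2 c1 c2 :
  value_at v u1 c1 -> value_at v u2 c2 -> value_at v (u1 * u2) (c1 * c2).
Proof.
move=> [d [a [b [ha hb bv -> ->]]]] [d' [a' [b' [ha' hb' bv' -> ->]]]].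
exists (d + d')%N, (a * a'), (b * b'); split.
- exact: dhomogM.
- exact: dhomogM.
- by rewrite mevalM mulf_neq0.
- by rewrite tofrac_divM.
by rewrite mulf_div !mevalM.
Qed.

Lemma value_atV v u c : c != 0 -> value_at v u c -> value_at v u^-1 c^-1.
Proof.
move=> c0 [d [a [b [ha hb bv -> ec]]]]; exists d, b, a; split=> //.
- by move: c0; rewrite ec mulf_eq0 negb_or => /andP[].
- by rewrite tofrac_divV.
by rewrite ec invf_div.
Qed.

Lemma value_atC v (c : k) : value_at v (c%:MP)%:F c.
Proof.
exists 0%N, c%:MP, 1; split.
- by rewrite -[c%:MP]mulr1 mul_mpolyC rpredZ // dhomog1.
- exact: dhomog1.
- by rewrite meval1 oner_eq0.
- by rewrite tofrac1 divr1.
by rewrite mevalC meval1 divr1.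
Qed.

Lemma value_atN v u c : value_at v u c -> value_at v (- u) (- c).
Proof.
move=> H; rewrite -mulN1r -[- c]mulN1r; apply: value_atM H.
by rewrite -tofrac1 -tofracN -mpolyC1 -mpolyCN; apply: value_atC.
Qed.

Lemma value_at0 v : value_at v 0 0.
Proof. by rewrite -tofrac0 -mpolyC0; apply: value_atC. Qed.

Lemma value_at_sum v n (F : 'I_n -> {fraction {mpoly k[3]}}) (c : 'I_n -> k) :
  (forall i, value_at v (F i) (c i)) -> value_at v (\sum_i F i) (\sum_i c i).
Proof.
move=> H; apply: (big_ind2 (value_at v)) => //; first exact: value_at0.
by move=> x1 x2 y1 y2; apply: value_atD.
Qed.

Section Transversal.
Variables (v : 'rV[k]_3) (i : 'I_3) (vi0 : v 0 i != 0).
Definition affine_form : {mpoly k[3]} := (v 0 i)^-1 *: 'X_i.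
Local Notation l := affine_form.

Lemma line_homog : l \is 1.-homog.
Proof. by rewrite rpredZ // dhomogX /= mdeg1. Qed.
Lemma line_meval : l.@[v 0] = 1.
Proof. by rewrite mevalZ mevalXU mulVf. Qed.
Lemma line_neq0 : l%:F != 0.
Proof. by rewrite tofrac_eq0; apply: (@meval_neq0 v); rewrite line_meval oner_eq0. Qed.
Lemma linex_homog d : l ^+ d \is d.-homog.
Proof. by rewrite -[d in d.-homog]mul1n; apply: dhomogMn line_homog. Qed.

(** The affine coordinate [X_j / l] minus its value at [v]. The two with [j] different from [i]
    generate the maximal ideal of the local ring. *)
Definition loc_coord (j : 'I_3) : {fraction {mpoly k[3]}} := ('X_j - v 0 j *: l)%:F / l%:F.

Lemma loc_coord_at j : value_at v (loc_coord j) 0.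
Proof.
exists 1%N, ('X_j - v 0 j *: l), l; split=> //.
- by rewrite rpredB ?rpredZ ?line_homog // dhomogX /= mdeg1.
- exact: line_homog.
- by rewrite line_meval oner_eq0.
by rewrite mevalB mevalZ mevalXU line_meval mulr1 subrr mul0r.
Qed.

Lemma loc_coord_self : loc_coord i = 0.
Proof. by rewrite /loc_coord /affine_form scalerA mulfV // scale1r subrr tofrac0 mul0r. Qed.

Lemma loc_coordE j : ('X_j)%:F / l%:F = ((v 0 j)%:MP)%:F + loc_coord j.
Proof.
rewrite /loc_coord tofracB mulrBl -mul_mpolyC tofracM mulfK ?line_neq0 //.
by rewrite addrC subrK.
Qed.

Variables (I : set {fraction {mpoly k[3]}}).
Hypotheses (I0 : I 0) (ID : forall x y, I x -> I y -> I (x + y)).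
Hypothesis IM : forall x y c, value_at v x c -> I y -> I (x * y).
Hypothesis Icoord : forall j, I (loc_coord j).

(** [I] stands for an ideal of the local ring. Being congruent to one's value modulo [I] is stable
    under sums and products, so it is enough to know it for the variables, where it says that [I]
    contains the local coordinates. *)
Lemma ideal_max_form a d : a \is d.-homog ->
  I (a%:F / l%:F ^+ d - ((a.@[v 0])%:MP)%:F).
Proof.
move=> ha.
have powl m : value_at v (l%:F ^+ m / l%:F ^+ m) 1.
  by rewrite divff ?expf_neq0 ?line_neq0 // -tofrac1 -mpolyC1; apply: value_atC.
(* The degree is carried along because it fixes the power of [l] in the denominator. *)
pose good d (a : {mpoly k[3]}) := a \is d.-homog /\
  I (a%:F / l%:F ^+ d - ((a.@[v 0])%:MP)%:F).
have gM d1 d2 a1 a2 : good d1 a1 -> good d2 a2 -> good (d1 + d2)%N (a1 * a2).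
  move=> [h1 g1] [h2 g2]; split; first exact: dhomogM.
  rewrite mevalM mpolyCM !tofracM exprD -mulf_div.
  set x := _ / _ in g1 *; set y := _ / _ in g2 *.
  set x0 := (_%:MP)%:F in g1 *; set y0 := (_%:MP)%:F in g2 *.
  have -> : x * y - x0 * y0 = y * (x - x0) + x0 * (y - y0).
    by ring.
  apply: ID; apply: IM; try exact: value_atC; last exact: g2.
  - exists d2, a2, (l ^+ d2); split; rewrite ?linex_homog //.
    + by rewrite rmorphXn /= line_meval expr1n oner_eq0.
    + by rewrite tofracXn.
  exact: g1.
have g1 : good 0%N 1.
  split; first exact: dhomog1.
  by rewrite tofrac1 expr0 divr1 meval1 mpolyC1 tofrac1 subrr.
have gX j : good 1%N 'X_j.
  split; first by rewrite dhomogX /= mdeg1.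
  by rewrite expr1 loc_coordE mevalXU addrC addKr.
have gXn j n : good n ('X_j ^+ n).
  elim: n => [|n IH]; first by rewrite expr0.
  by rewrite exprS -add1n; apply: gM.
have gm m : good (mdeg m) 'X_[m].
  rewrite mpolyXE_id mdegE.
  apply: (big_ind2 (fun d a => good d a)) => // x1 x2 y1 y2; exact: gM.
have gZ d1 c a1 : good d1 a1 -> good d1 (c *: a1).
  move=> [h1 g1']; split; first by rewrite rpredZ.
  rewrite mevalZ mpolyCM -mul_mpolyC !tofracM -mulrA -mulrBr.
  by apply: IM g1'; apply: value_atC.
rewrite [a]mpolyE.
suff : good d (\sum_(m <- msupp a) a@_m *: 'X_[m]) by case.
apply: (big_ind (good d)).
- by split; rewrite ?rpred0 // tofrac0 mul0r meval0 mpolyC0 tofrac0 subr0.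
- move=> x y [hx gx] [hy gy]; split; first exact: rpredD.
  by rewrite mevalD mpolyCD !tofracD mulrDl opprD addrACA; apply: ID.
move=> m _; have [mm|mm] := boolP (m \in msupp a).
  by apply: gZ; rewrite -(dhomog_mf ha mm); apply: gm.
rewrite (memN_msupp_eq0 mm) scale0r.
by split; rewrite ?rpred0 // tofrac0 mul0r meval0 mpolyC0 tofrac0 subr0.
Qed.

(** The numerator of [u - c] is a form that vanishes at [v]; hence [I] contains the maximal
    ideal. *)
Lemma ideal_max u c : value_at v u c -> I (u - (c%:MP)%:F).
Proof.
move=> [d [a [b [ha hb bv -> ->]]]].
set c' : k := _ / _.
have hab : a - c' *: b \is d.-homog by rewrite rpredB ?rpredZ.
have := ideal_max_form hab.
rewrite mevalB mevalZ divfK // subrr mpolyC0 tofrac0 subr0 => H.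
have -> : a%:F / b%:F - ((c')%:MP)%:F
    = (l ^+ d)%:F / b%:F * ((a - c' *: b)%:F / l%:F ^+ d).
  rewrite tofracXn [RHS]mulrC mulrA divfK ?expf_neq0 ?line_neq0 //.
  by rewrite tofracB -mul_mpolyC tofracM mulrBl mulfK ?tofrac_eq0 ?(meval_neq0 bv).
apply: IM H; exists d, (l ^+ d), b; split=> //; exact: linex_homog.
Qed.

End Transversal.

Lemma big_ord3 (V : nmodType) (F : 'I_3 -> V) : \sum_i F i = F 0 + F 1 + F 2%:R.
Proof.
rewrite !big_ord_recr big_ord0 /= add0r.
by congr (F _ + F _ + F _); apply: val_inj.
Qed.

(* Summing from an arbitrary index singles out the affine chart of that index. *)
Lemma big_ord3_shift (V : nmodType) (F : 'I_3 -> V) i :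
  \sum_j F j = F i + F (i + 1) + F (i + 2%:R).
Proof.
rewrite (reindex_inj (addrI i)) big_ord3 addr0 //.
Qed.

(* If the 2 x 2 minor of the linear parts were nonzero, then f and g would generate
   the maximal ideal of the local ring and the multiplicity would be 1. *)
Lemma transversal_mult v f g d e (i : 'I_3) (al be : 'I_3 -> {fraction {mpoly k[3]}})
    (a b : 'I_3 -> k) (l := affine_form v i) :
  v != 0 -> v 0 i != 0 -> f != 0 -> g != 0 -> f \is d.-homog -> g \is e.-homog ->
  (forall j, value_at v (al j) (a j)) -> (forall j, value_at v (be j) (b j)) ->
  f%:F / l%:F ^+ d = \sum_j loc_coord v i j * al j ->
  g%:F / l%:F ^+ e = \sum_j loc_coord v i j * be j ->
  intersection_multiplicity (pt v) f g 2 ->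
  a (i + 1) * b (i + 2%:R) = a (i + 2%:R) * b (i + 1).
Proof.
move=> v0 vi0 f0 g0 hf hg hal hbe ef eg [E [hE H]].
apply/eqP/negPn/negP => Dn0.
(* Each element of [local_ideal] comes with its own linear form; fixing [l] makes closure under sums
   immediate. *)
pose I : set {fraction {mpoly k[3]}} := [set w | exists u1 c1 u2 c2,
  [/\ value_at v u1 c1, value_at v u2 c2 &
      w = u1 * (f%:F / l%:F ^+ d) + u2 * (g%:F / l%:F ^+ e)]].
have ID x y : I x -> I y -> I (x + y).
  move=> [u1 [c1 [u2 [c2 [h1 h2 ->]]]]] [u1' [c1' [u2' [c2' [h1' h2' ->]]]]].
  exists (u1 + u1'), (c1 + c1'), (u2 + u2'), (c2 + c2'); split; try exact: value_atD.
  by rewrite !mulrDl addrACA.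
have IM x y c : value_at v x c -> I y -> I (x * y).
  move=> hx [u1 [c1 [u2 [c2 [h1 h2 ->]]]]].
  exists (x * u1), (c * c1), (x * u2), (c * c2); split; try exact: value_atM.
  by rewrite mulrDr !mulrA.
have I0 : I 0.
  exists 0, 0, 0, 0; split; try exact: value_at0.
  by rewrite !mul0r addr0.
pose D := al (i + 1) * be (i + 2%:R) - al (i + 2%:R) * be (i + 1).
have hD : value_at v D (a (i + 1) * b (i + 2%:R) - a (i + 2%:R) * b (i + 1)).
  by apply: value_atD; [|apply: value_atN]; apply: value_atM.
(* The minor is a unit of the local ring, and Cramer's rule then puts the local coordinates into
   [I]. *)
have [D0 hDV] : D != 0 /\ exists c, value_at v D^-1 c.
  split; last by eexists; apply: value_atV hD; rewrite subr_eq0.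
  apply: contraNneq Dn0 => e0; rewrite -subr_eq0; apply/eqP.
  by apply: (value_at_uniq hD); rewrite e0; apply: value_at0.
have Icoord j : I (loc_coord v i j).
  have [cD hD'] := hDV.
  have ij : [|| j == i, j == i + 1 | j == i + 2%:R].
    by case: i {vi0 l ef eg Dn0 D hD hDV D0 I ID IM I0 hD'} => -[|[|[|//]]] ?;
       case: j => -[|[|[|//]]].
  case/or3P: ij => /eqP->.
  - by rewrite loc_coord_self.
  - rewrite -(mulKf D0 (loc_coord v i (i + 1))); apply: IM hD' _.
    exists (be (i + 2%:R)), (b (i + 2%:R)), (- al (i + 2%:R)), (- a (i + 2%:R)); split=> //.
      exact: value_atN.
    rewrite ef eg !(big_ord3_shift _ i) loc_coord_self // /D; ring.
  rewrite -(mulKf D0 (loc_coord v i (i + 2%:R))); apply: IM hD' _.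
  exists (- be (i + 1)), (- b (i + 1)), (al (i + 1)), (a (i + 1)); split=> //.
    exact: value_atN.
  rewrite ef eg !(big_ord3_shift _ i) loc_coord_self // /D; ring.
have Imax := ideal_max vi0 I0 ID IM Icoord.
have I_local w : I w -> local_ideal (pt v) f g w.
  move=> [u1 [c1 [u2 [c2 [h1 h2 ->]]]]]; exists l, u1, u2; split.
  - exact: line_homog.
  - move/(zero_locus_pt (line_homog v i) v0)/eqP.
    by rewrite line_meval // oner_eq0.
  - by apply/local_ringP => //; exists c1.
  - by apply/local_ringP => //; exists c2.
  by rewrite (msize_dhomog f0 hf) (msize_dhomog g0 hg).
have value_E n : exists c, value_at v (E n) c by apply/local_ringP.
have [c0 hc0] := value_E 0; have [c1 hc1] := value_E 1.
have zero_in : local_ring (pt v) 0.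
  by apply/local_ringP => //; exists 0; apply: value_at0.
have [x0 [_ x0_uniq]] := H 0 zero_in.
have uniq0 (c : 'rV[k]_2) : I (0 - \sum_(n < 2) ((c 0 n)%:MP)%:F * E n) -> c = 0.
  move=> Ic; rewrite -(x0_uniq c); last exact: I_local.
  apply: x0_uniq; apply: I_local; rewrite big1 ?subr0 // => n _.
  by rewrite mxE mpolyC0 tofrac0 mul0r.
have sub_value x c : value_at v x c -> c = 0 -> I x.
  move=> hx c_0; have := Imax _ _ hx.
  by rewrite c_0 mpolyC0 tofrac0 subr0.
(* The combination [c1 * E 0 - c0 * E 1] vanishes at the point, so it lies in [I] and its
   coefficients must be 0. Then [c0 = 0] puts [E 0] itself into [I], although its coefficient is
   1. *)
pose c : 'rV[k]_2 := \row_n (if n == 0 then c1 else - c0).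
have /uniq0/rowP ec : I (0 - \sum_(n < 2) ((c 0 n)%:MP)%:F * E n).
  apply: (sub_value _ (0 - \sum_(n < 2) c 0 n * (if n == 0 then c0 else c1))).
    apply: value_atD; first exact: value_at0.
    apply/value_atN/value_at_sum => n; apply: value_atM; first exact: value_atC.
    have [->//|n0] := eqVneq n 0; suff -> : n = 1 by [].
    by apply: val_inj; case: n n0 => -[|[|]].
  by rewrite !big_ord_recr big_ord0 /= !mxE /=; ring.
have c00 : c0 = 0 by move: (ec 1); rewrite !mxE /= => /eqP; rewrite oppr_eq0 => /eqP.
have /uniq0/rowP/(_ 0) : I (0 - \sum_(n < 2) (((delta_mx 0 0 : 'rV[k]_2) 0 n)%:MP)%:F * E n).
  apply: (sub_value _ (- c0)); last by rewrite c00 oppr0.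
  rewrite !big_ord_recr big_ord0 /= !mxE /= mpolyC0 tofrac0 mul0r addr0 !add0r.
  rewrite mpolyC1 tofrac1 mul1r; apply: value_atN.
  by move: hc0; congr (value_at v (E _) _); apply: val_inj.
by rewrite !mxE /= => /eqP; rewrite oner_eq0.
Qed.

End LocalRing.

(** * Quadratic forms and the Fermat form *)

Section Forms.
Local Open Scope ring_scope.
Local Open Scope classical_set_scope.
Variable k : closedFieldType.
Hypothesis k_char5 : 5%N \in [pchar k].
Implicit Types (u v : 'rV[k]_3) (A B : 'M[k]_3) (q : {mpoly k[3]}).
Local Notation "x %:F" := (tofrac x).

Lemma natr_char5 n : n%:R = (n %% 5)%:R :> k.
Proof.
by rewrite {1}(divn_eq n 5) natrD natrM (pcharf0 k_char5) mulr0 add0r.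
Qed.

Lemma natr_neq0 n : (n %% 5 != 0)%N -> n%:R != 0 :> k.
Proof. by rewrite -(dvdn_pcharf k_char5). Qed.

Definition bar m n (A : 'M[k]_(m, n)) := map_mx (pFrobenius_aut k_char5) A.

Lemma barE m n (A : 'M[k]_(m, n)) i j : bar A i j = A i j ^+ 5.
Proof. by rewrite mxE pFrobenius_autE. Qed.
Lemma barM m n p (A : 'M[k]_(m, n)) (B : 'M[k]_(n, p)) : bar (A *m B) = bar A *m bar B.
Proof. exact: map_mxM. Qed.
Lemma barZ m n c (A : 'M[k]_(m, n)) : bar (c *: A) = c ^+ 5 *: bar A.
Proof. by apply/matrixP => i j; rewrite barE !mxE exprMn pFrobenius_autE. Qed.
Lemma bar_tr m n (A : 'M[k]_(m, n)) : bar A^T = (bar A)^T.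
Proof. by rewrite /bar map_trmx. Qed.
Lemma bar1 n : bar (1%:M : 'M[k]_n) = 1%:M.
Proof. exact: map_mx1. Qed.
Lemma bar_unit n (A : 'M[k]_n) : (bar A \in unitmx) = (A \in unitmx).
Proof. exact: map_unitmx. Qed.
Lemma bar_inv n (A : 'M[k]_n) : bar (invmx A) = invmx (bar A).
Proof. exact: map_invmx. Qed.
Lemma det_bar n (A : 'M[k]_n) : \det (bar A) = \det A ^+ 5.
Proof. by rewrite /bar det_map_mx /= pFrobenius_autE. Qed.
Lemma bar_eq0 m n (A : 'M[k]_(m, n)) : (bar A == 0) = (A == 0).
Proof. exact: map_mx_eq0. Qed.

Lemma fermat_form v : \sum_i v 0 i ^+ 6 = (v *m (bar v)^T) 0 0.
Proof. by rewrite mxE; apply: eq_bigr => i _; rewrite mxE barE exprS. Qed.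

Lemma Gamma_bar v : v != 0 -> Gamma (pt v) <-> (v *m (bar v)^T) 0 0 = 0.
Proof. by move=> v0; rewrite -fermat_form; apply: Gamma_pt. Qed.

Definition quad_poly B : {mpoly k[3]} := \sum_i \sum_j B i j *: ('X_i * 'X_j).

Lemma quad_poly_homog B : quad_poly B \is 2.-homog.
Proof.
apply: rpred_sum => i _; apply: rpred_sum => j _; rewrite rpredZ //.
by rewrite (@dhomogM _ _ _ 1 _ 1) // dhomogX /= mdeg1.
Qed.

Lemma meval_quad_poly B v : (quad_poly B).@[v 0] = bil B v v.
Proof.
rewrite bilE rmorph_sum /=; apply: eq_bigr => i _.
rewrite rmorph_sum /=; apply: eq_bigr => j _.
by rewrite mevalZ mevalM !mevalXU mulrCA mulrA.
Qed.

Lemma zero_locus_quad_poly B : zero_locus (quad_poly B) = conic B.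
Proof.
apply/seteqP; split=> p /=; have [v v0 ->] := ptP p;
  by rewrite conic_pt // -meval_quad_poly; case: (zero_locus_pt (quad_poly_homog B) v0) => ? ?.
Qed.

Lemma quad_polyD A B : quad_poly (A + B) = quad_poly A + quad_poly B.
Proof.
rewrite -big_split; apply: eq_bigr => i _; rewrite -big_split; apply: eq_bigr => j _.
by rewrite mxE scalerDl.
Qed.

Lemma quad_polyZ c B : quad_poly (c *: B) = c *: quad_poly B.
Proof.
rewrite scaler_sumr; apply: eq_bigr => i _; rewrite scaler_sumr.
by apply: eq_bigr => j _; rewrite mxE scalerA.
Qed.

Lemma quad_poly_delta i j : quad_poly (delta_mx i j) = 'X_i * 'X_j.
Proof.
rewrite /quad_poly (bigD1 i) //= (bigD1 j) //= !mxE !eqxx scale1r.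
rewrite !big1 ?addr0 // => [i' ni|j' nj].
  by rewrite big1 // => j' _; rewrite mxE (negPf ni) scale0r.
by rewrite mxE eqxx (negPf nj) scale0r.
Qed.

Lemma two_neq0 : 2%:R != 0 :> k.
Proof. exact: natr_neq0. Qed.

(** The coefficient of a monomial [X_i X_j] is shared equally between the entries (i, j) and (j, i),
    which requires dividing by 2. *)
Lemma quad_polyP q : q \is 2.-homog -> exists2 B, B^T = B & q = quad_poly B.
Proof.
move=> hq; rewrite [q]mpolyE.
pose good (q : {mpoly k[3]}) := exists2 B, B^T = B & q = quad_poly B.
have g0 : good 0 by exists 0; rewrite ?trmx0 // /quad_poly big1 // => i _;
  rewrite big1 // => j _; rewrite mxE scale0r.
apply: (big_ind good) => // [x y [A sA ->] [B sB ->]|m _].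
  by exists (A + B); rewrite ?quad_polyD // linearD /= sA sB.
have [mm|mm] := boolP (m \in msupp q); last by rewrite (memN_msupp_eq0 mm) scale0r.
have [i [j ->]] : exists i j, 'X_[m] = 'X_i * 'X_j :> {mpoly k[3]}.
  have mm2 := dhomog_mf hq mm; rewrite /= in mm2.
  have [i mi] : exists i, (m i != 0)%N.
    apply/existsP; apply: contraPT mm2 => /existsPn m0.
    by rewrite mdegE big1 // => i _; apply/eqP; move: (m0 i); rewrite negbK.
  have eU : (m = (m - U_(i)) + U_(i))%MM by rewrite submK // lep1mP.
  have : mdeg (m - U_(i))%MM = 1%N.
    by apply: (@addIn 1); rewrite /= -[RHS]mm2 [in RHS]eU mdegD mdeg1.
  move/eqP; rewrite mdeg_eq1 => /existsP[j /eqP ej].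
  by exists j, i; rewrite eU ej mpolyXD.
exists ((q@_m / 2%:R) *: (delta_mx i j + delta_mx j i)).
  by rewrite linearZ linearD /= !trmx_delta addrC.
rewrite quad_polyZ quad_polyD !quad_poly_delta ['X_j * _]mulrC -mulr2n -scaler_nat.
by rewrite scalerA divfK ?two_neq0.
Qed.

Lemma mderivXU (i j : 'I_3) : ('X_j : {mpoly k[3]})^`M(i) = ((j == i)%:R)%:MP.
Proof.
rewrite mderivX mnm1E; have [->|_] := eqVneq j i; last by rewrite scale0r mpolyC0.
have -> : (U_(i) - U_(i) = 0)%MM by apply/mnmP => l; rewrite mnmBE subnn mnm0E.
by rewrite scale1r mpolyX0 mpolyC1.
Qed.

Lemma quad_poly_deriv B v i : B^T = B ->
  ((quad_poly B)^`M(i)).@[v 0] = 2%:R * (v *m B) 0 i.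
Proof.
move=> sB; rewrite /quad_poly (raddf_sum (mderiv i)) (rmorph_sum (meval _)) /=.
transitivity (\sum_i0 \sum_j B i0 j * ((i0 == i)%:R * v 0 j + v 0 i0 * (j == i)%:R)).
  apply: eq_bigr => i0 _; rewrite (raddf_sum (mderiv i)) (rmorph_sum (meval _)) /=.
  apply: eq_bigr => j _.
  by rewrite linearZ /= mevalZ mderivM mevalD !mevalM !mevalXU !mderivXU !mevalC.
transitivity (\sum_j B i j * v 0 j + \sum_i0 v 0 i0 * B i0 i).
  have e1 i0 : \sum_j B i0 j * ((i0 == i)%:R * v 0 j + v 0 i0 * (j == i)%:R)
      = (i0 == i)%:R * (\sum_j B i0 j * v 0 j) + v 0 i0 * B i0 i.
    rewrite (eq_bigr (fun j => (i0 == i)%:R * (B i0 j * v 0 j)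
      + v 0 i0 * (B i0 j * (j == i)%:R))); last by move=> j _; ring.
    rewrite big_split /= mulr_sumr -[X in _ + X]mulr_sumr.
    congr (_ + _ * _); rewrite (bigD1 i) //= eqxx mulr1 big1 ?addr0 //.
    by move=> j /negPf->; rewrite mulr0.
  rewrite (eq_bigr _ (fun i0 _ => e1 i0)) big_split /= (bigD1 i) //= eqxx mul1r.
  by rewrite [X in _ + X + _]big1 ?addr0 // => i0 /negPf->; rewrite mul0r.
rewrite mxE (_ : \sum_j B i j * v 0 j = \sum_j v 0 j * B j i); last first.
  by apply: eq_bigr => j _; rewrite mulrC -{1}sB mxE.
by rewrite -mulr2n mulr_natl.
Qed.

(** The gradient at [v] is [2 v B], so singular points come from the kernel of [B], and a kernel
    vector always lies on the conic. *)
Lemma nonsingular_quad_poly B : B^T = B ->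
  nonsingular (quad_poly B) <-> B \in unitmx.
Proof.
move=> sB.
have hd i : (quad_poly B)^`M(i) \is 1.-homog.
  have hX a b : ('X_a * 'X_b : {mpoly k[3]})^`M(i) \is 1.-homog.
    rewrite mderivM !mderivXU [_ * _%:MP]mulrC !mul_mpolyC.
    by rewrite rpredD // rpredZ // dhomogX /= mdeg1.
  rewrite /quad_poly (raddf_sum (mderiv i)) /=; apply: rpred_sum => i0 _.
  rewrite (raddf_sum (mderiv i)) /=; apply: rpred_sum => j _.
  by rewrite /= linearZ /= rpredZ.
split=> [ns|Bu p]; last first.
  have [v v0 ->] := ptP p => _.
  have /rV0Pn[i vBi] := mulmx_neq0 Bu v0; exists i => /(zero_locus_pt (hd i) v0)/eqP.
  by rewrite quad_poly_deriv // mulf_eq0 (negPf two_neq0) (negPf vBi).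
apply/negPn/negP => Bn.
have /det0P[v v0 vB] : \det B == 0 by move: Bn; rewrite unitmxE unitfE negbK.
case: (ns (pt v)) => [|i].
  by rewrite zero_locus_quad_poly conic_pt // /bil vB mul0mx mxE.
by apply; apply/(zero_locus_pt (hd i) v0); rewrite quad_poly_deriv // vB mxE mulr0.
Qed.

Lemma quad_poly_neq0 B : B \in unitmx -> B^T = B -> quad_poly B != 0.
Proof.
move=> Bu sB; apply/eqP => q0; have [v v0 _] := ptP (pt (0 : 'rV[k]_3)).
have /rV0Pn[i] := mulmx_neq0 Bu v0; apply/negP; rewrite negbK.
have := quad_poly_deriv v i sB; rewrite q0 mderiv0 meval0 => /esym/eqP.
by rewrite mulf_eq0 (negPf two_neq0).
Qed.

Lemma fermat_neq0 : fermat k != 0.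
Proof.
suff : (fermat k).@[(delta_mx 0 0 : 'rV[k]_3) 0] != 0.
  by apply: contraNneq => ->; rewrite meval0.
rewrite meval_fermat big_ord3 !mxE !eqxx /= expr1n !expr0n /= !addr0 oner_eq0 //.
Qed.

End Forms.

(** * Linear parts at a contact point *)

Section Tangency.
Local Open Scope ring_scope.
Local Open Scope classical_set_scope.
Variable k : closedFieldType.
Hypothesis k_char5 : 5%N \in [pchar k].
Implicit Types (u v : 'rV[k]_3) (A B : 'M[k]_3) (q : {mpoly k[3]}).
Local Notation "x %:F" := (tofrac x).
Local Notation bar := (bar k_char5).

Lemma minors_proportional n (u v : 'rV[k]_n) : u != 0 -> v != 0 ->
  (forall i j, u 0 i * v 0 j = u 0 j * v 0 i) -> exists2 c, c != 0 & u = c *: v.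
Proof.
move=> u0 /rV0Pn[i vi0] H.
have e : u = (u 0 i / v 0 i) *: v.
  by apply/rowP => j; rewrite !mxE mulrAC H mulfK.
exists (u 0 i / v 0 i) => //.
by apply: contraNneq u0 => c0; rewrite e c0 scale0r.
Qed.

(** The plane orthogonal to [v] is parametrised by the two coordinates other than [i], since
    [v 0 i != 0]; a single minor therefore decides proportionality. *)
Lemma orthogonal_proportional (v a b : 'rV[k]_3) (i : 'I_3) :
  v 0 i != 0 -> a != 0 -> b != 0 ->
  \sum_j v 0 j * a 0 j = 0 -> \sum_j v 0 j * b 0 j = 0 ->
  a 0 (i + 1) * b 0 (i + 2%:R) = a 0 (i + 2%:R) * b 0 (i + 1) ->
  exists2 c, c != 0 & a = c *: b.
Proof.
move=> vi0 a0 b0; rewrite !(big_ord3_shift _ i).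
set v1 := v 0 (i + 1); set v2 := v 0 (i + 2%:R).
set a1 := a 0 (i + 1); set a2 := a 0 (i + 2%:R).
set b1 := b 0 (i + 1); set b2 := b 0 (i + 2%:R) => ha hb h12.
have h1 : a 0 i * b1 = a1 * b 0 i.
  apply: (mulfI vi0); apply/eqP; rewrite -subr_eq0; apply/eqP.
  transitivity (v2 * (a1 * b2 - a2 * b1) + b1 * (v 0 i * a 0 i + v1 * a1 + v2 * a2)
      - a1 * (v 0 i * b 0 i + v1 * b1 + v2 * b2)); first by ring.
  by rewrite ha hb h12; ring.
have h2 : a 0 i * b2 = a2 * b 0 i.
  apply: (mulfI vi0); apply/eqP; rewrite -subr_eq0; apply/eqP.
  transitivity (- v1 * (a1 * b2 - a2 * b1) + b2 * (v 0 i * a 0 i + v1 * a1 + v2 * a2)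
      - a2 * (v 0 i * b 0 i + v1 * b1 + v2 * b2)); first by ring.
  by rewrite ha hb h12; ring.
have ij (j : 'I_3) : [|| j == i, j == i + 1 | j == i + 2%:R].
  by case: (i) => -[|[|[|//]]] ?; case: j => -[|[|[|//]]].
apply: minors_proportional => // s t.
by case/or3P: (ij s) => /eqP->; case/or3P: (ij t) => /eqP->;
  rewrite -?/a1 -?/a2 -?/b1 -?/b2.
Qed.

Section Taylor.
Variables (v : 'rV[k]_3) (i : 'I_3) (vi0 : v 0 i != 0).
Local Notation l := (affine_form v i).
Local Notation C c := ((c%:MP : {mpoly k[3]})%:F).
Local Notation xi := (loc_coord v i).

Lemma coord_at j : value_at v (('X_j)%:F / l%:F) (v 0 j).
Proof.
rewrite loc_coordE // -[X in value_at _ _ X]addr0; apply: value_atD.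
  exact: value_atC.
exact: loc_coord_at.
Qed.

(** An exact expansion, with coefficients in the local ring. For a symmetric [B] the coefficient of
    [xi j] has the value [2 (v B)_j] at [v]. *)
Lemma taylor_quad_poly B : bil B v v = 0 ->
  (quad_poly B)%:F / l%:F ^+ 2
  = \sum_j xi j * (C ((v *m B) 0 j) + \sum_i0 C (B j i0) * (('X_i0)%:F / l%:F)).
Proof.
move=> Bv.
transitivity (\sum_s \sum_t C (B s t) * (('X_s)%:F / l%:F) * (('X_t)%:F / l%:F)).
  rewrite rmorph_sum mulr_suml; apply: eq_bigr => s _.
  rewrite rmorph_sum mulr_suml; apply: eq_bigr => t _.
  by rewrite /= -mul_mpolyC !tofracM expr2 invfM; ring.
transitivity (\sum_s \sum_t C (B s t) * C (v 0 s) * (('X_t)%:F / l%:F) +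
    \sum_s xi s * \sum_t C (B s t) * (('X_t)%:F / l%:F)).
  rewrite -big_split; apply: eq_bigr => s _ /=; rewrite mulr_sumr -big_split.
  apply: eq_bigr => t _ /=; rewrite [X in _ * X * _]loc_coordE //; ring.
under [RHS]eq_bigr do rewrite mulrDr.
rewrite big_split /=; congr (_ + _).
transitivity (\sum_t C ((v *m B) 0 t) * (('X_t)%:F / l%:F)).
  rewrite exchange_big; apply: eq_bigr => t _; rewrite -mulr_suml; congr (_ * _).
  rewrite mxE !rmorph_sum; apply: eq_bigr => s _.
  by rewrite /= mpolyCM tofracM mulrC.
transitivity (\sum_t (C ((v *m B) 0 t) * C (v 0 t) + C ((v *m B) 0 t) * xi t)).
  by apply: eq_bigr => t _; rewrite loc_coordE // mulrDr.
rewrite big_split /=.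
have -> : \sum_t C ((v *m B) 0 t) * C (v 0 t) = 0.
  transitivity (C (bil B v v)); last by rewrite Bv mpolyC0 tofrac0.
  rewrite /bil mxE !rmorph_sum; apply: eq_bigr => t _.
  by rewrite /= [v^T _ _]mxE mpolyCM tofracM.
by rewrite add0r; apply: eq_bigr => t _; rewrite mulrC.
Qed.

Lemma frac_char5 : 5%N \in [pchar {fraction {mpoly k[3]}}].
Proof.
rewrite !inE /=; have -> : 5%:R = C 5%:R by rewrite mpolyC_nat tofracMn.
by rewrite (pcharf0 k_char5) mpolyC0 tofrac0 eqxx.
Qed.

(** For [x = v + xi] Frobenius gives [x ^+ 5 = v ^+ 5 + xi ^+ 5], whence [x ^+ 6 = v ^+ 6 + v ^+ 5 *
    xi + xi ^+ 5 * x]. The factor [xi ^+ 4] vanishes at the point, so the linear part is [bar v]. *)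
Lemma taylor_fermat : \sum_j v 0 j ^+ 6 = 0 ->
  (fermat k)%:F / l%:F ^+ 6
  = \sum_j xi j * (C (v 0 j ^+ 5) + xi j ^+ 4 * (('X_j)%:F / l%:F)).
Proof.
move=> v6.
transitivity (\sum_j (('X_j)%:F / l%:F) ^+ 6).
  rewrite rmorph_sum mulr_suml; apply: eq_bigr => j _.
  by rewrite rmorphXn expr_div_n.
transitivity (\sum_j (C (v 0 j ^+ 6) +
    xi j * (C (v 0 j ^+ 5) + xi j ^+ 4 * (('X_j)%:F / l%:F)))).
  apply: eq_bigr => j _; rewrite exprSr {1}loc_coordE //.
  rewrite -(pFrobenius_autE frac_char5) rmorphD /= !pFrobenius_autE.
  have CX n c : C (c ^+ n) = C c ^+ n by rewrite -tofracXn -rmorphXn.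
  by rewrite !CX loc_coordE //; ring.
rewrite big_split /=.
have -> : \sum_j C (v 0 j ^+ 6) = 0.
  by rewrite -!rmorph_sum /= v6 mpolyC0 tofrac0.
by rewrite add0r.
Qed.

End Taylor.

(** The linear parts of the two equations are [2 v B] and [bar v]. Multiplicity 2 kills a minor, and
    both vectors are orthogonal to [v] because the point lies on both curves. *)
Lemma mult2_tangent B v : B^T = B -> B \in unitmx -> v != 0 ->
  conic B (pt v) -> Gamma (pt v) ->
  intersection_multiplicity (pt v) (quad_poly B) (fermat k) 2 ->
  exists2 c, c != 0 & bar v = c *: (v *m B).
Proof.
move=> sB Bu v0 /(conic_pt _ v0) Bv /(Gamma_pt v0) v6 mult2.
have /rV0Pn[i vi0] := v0.
have bv0 : bar v != 0 by rewrite bar_eq0.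
have vB0 := mulmx_neq0 Bu v0.
have := transversal_mult v0 vi0 (quad_poly_neq0 k_char5 Bu sB) (fermat_neq0 k)
  (quad_poly_homog B) (fermat_homog k) _ _ (taylor_quad_poly vi0 Bv)
  (taylor_fermat vi0 v6) mult2.
move=> /(_ (fun j => 2%:R * (v *m B) 0 j) (fun j => bar v 0 j)).
move=> H.
have {H}h : 2%:R * (v *m B) 0 (i + 1) * bar v 0 (i + 2%:R)
    = 2%:R * (v *m B) 0 (i + 2%:R) * bar v 0 (i + 1).
  apply: H => j.
  - rewrite mulr_natl mulr2n; apply: value_atD; first exact: value_atC.
    have -> : (v *m B) 0 j = \sum_i0 B j i0 * v 0 i0.
      by rewrite mxE; apply: eq_bigr => i0 _; rewrite mulrC -[in LHS]sB mxE.
    apply: value_at_sum => i0; apply: value_atM; first exact: value_atC.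
    exact: coord_at.
  - rewrite barE -[X in value_at _ _ X]addr0; apply: value_atD; first exact: value_atC.
    rewrite -[0](mul0r (v 0 j)); apply: value_atM; last exact: coord_at.
    have -> : 0 = 0 ^+ 4 :> k by rewrite expr0n.
    have h := loc_coord_at vi0 j.
    by rewrite !exprS !expr0; do 3 (apply: value_atM => //); rewrite !mulr1.
move: h; rewrite -!mulrA => /(mulfI (two_neq0 k_char5)) h.
apply: (orthogonal_proportional vi0 bv0 vB0).
- by rewrite -[RHS]v6; apply: eq_bigr => j _; rewrite barE exprS.
- rewrite -[RHS]Bv /bil mxE; apply: eq_bigr => j _.
  by rewrite [v^T _ _]mxE mulrC.
by rewrite mulrC -h mulrC.
Qed.

End Tangency.

(** * Linear substitutions and invariance of the multiplicity *)

Section Substitution.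
Local Open Scope ring_scope.
Local Open Scope classical_set_scope.
Variable k : closedFieldType.
Implicit Types (v : 'rV[k]_3) (A B : 'M[k]_3) (f g q a b : {mpoly k[3]}).
Local Notation "x %:F" := (tofrac x).

Definition subst A f : {mpoly k[3]} := f \mPo [tuple \sum_j A j i *: 'X_j | i < 3].

HB.instance Definition _ A := GRing.RMorphism.copy (subst A)
  (comp_mpoly [tuple \sum_j A j i *: 'X_j | i < 3]).

Lemma substC A c : subst A c%:MP = c%:MP.
Proof. exact: comp_mpolyC. Qed.

Lemma substX A i : subst A 'X_i = \sum_j A j i *: 'X_j.
Proof. by rewrite /subst comp_mpolyXU -tnth_nth tnth_mktuple. Qed.

Lemma substZ A c f : subst A (c *: f) = c *: subst A f.
Proof. exact: comp_mpolyZ. Qed.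

Lemma meval_subst A f v : (subst A f).@[v 0] = f.@[(v *m A) 0].
Proof.
rewrite comp_mpoly_meval; apply: meval_eq => i; rewrite tnth_mktuple.
rewrite rmorph_sum mxE; apply: eq_bigr => j _.
by rewrite /= mevalZ mevalXU mulrC.
Qed.

Lemma mpoly_rmorph_eq (S : comNzRingType) (F G : {rmorphism {mpoly k[3]} -> S}) :
  (forall c, F c%:MP = G c%:MP) -> (forall i, F 'X_i = G 'X_i) -> F =1 G.
Proof.
move=> hC hX f; rewrite [f]mpolyE !rmorph_sum; apply: eq_bigr => m _.
rewrite -mul_mpolyC !rmorphM hC; congr (_ * _).
rewrite mpolyXE_id !rmorph_prod; apply: eq_bigr => i _.
by rewrite !rmorphXn hX.
Qed.

Lemma substM A B f : subst A (subst B f) = subst (A *m B) f.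
Proof.
apply: (@mpoly_rmorph_eq _ (subst A \o subst B) (subst (A *m B))) => [c|i] /=.
  by rewrite !substC.
rewrite !substX rmorph_sum; under eq_bigr do rewrite /= substZ substX scaler_sumr.
rewrite exchange_big; apply: eq_bigr => j _; rewrite mxE scaler_suml.
by apply: eq_bigr => l _; rewrite scalerA mulrC.
Qed.

Lemma subst1 f : subst 1%:M f = f.
Proof.
apply: (@mpoly_rmorph_eq _ (subst 1%:M) idfun) => [c|i] /=; first exact: substC.
rewrite substX (bigD1 i) //= mxE eqxx scale1r big1 ?addr0 // => j ji.
by rewrite mxE (negPf ji) scale0r.
Qed.

Lemma substK A f : A \in unitmx -> subst (invmx A) (subst A f) = f.
Proof. by move=> Au; rewrite substM mulVmx // subst1. Qed.

Lemma subst_eq0 A f : A \in unitmx -> (subst A f == 0) = (f == 0).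
Proof.
move=> Au; apply/eqP/eqP => [e|->]; last exact: rmorph0.
by rewrite -(substK f Au) e rmorph0.
Qed.

Lemma subst_homog A f d : f \is d.-homog -> subst A f \is d.-homog.
Proof.
move=> hf; rewrite [f]mpolyE rmorph_sum; apply: rpred_sum => m _.
have [mm|mm] := boolP (m \in msupp f); last first.
  by rewrite (memN_msupp_eq0 mm) scale0r rmorph0 rpred0.
rewrite /= substZ rpredZ // -(dhomog_mf hf mm) /= mpolyXE_id rmorph_prod mdegE.
apply: (big_ind2 (fun d (g : {mpoly k[3]}) => g \is d.-homog)).
- exact: dhomog1.
- by move=> d1 g1 d2 g2; apply: dhomogM.
move=> i _; have hX : subst A 'X_i \is 1.-homog.
  by rewrite substX; apply: rpred_sum => j _; rewrite rpredZ // dhomogX /= mdeg1.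
by have := dhomogMn (m i) hX; rewrite mul1n rmorphXn.
Qed.

(** Computed on the chosen representative; for an invertible [A] any other numerator and denominator
    give the same result, by [subst_frac_div]. *)
Definition subst_frac A (u : {fraction {mpoly k[3]}}) : {fraction {mpoly k[3]}} :=
  (subst A (frac (repr u)).1)%:F / (subst A (frac (repr u)).2)%:F.

Lemma subst_frac_div A a b : A \in unitmx -> b != 0 ->
  subst_frac A (a%:F / b%:F) = (subst A a)%:F / (subst A b)%:F.
Proof.
move=> Au b0; rewrite /subst_frac; set u := a%:F / b%:F.
have := tofrac_repr u; move: (frac _).1 (frac _).2 => x y [y0].
move/eqP; rewrite tofrac_div_eq // => /eqP e.
by apply/eqP; rewrite tofrac_div_eq ?subst_eq0 // -!rmorphM e.
Qed.

Lemma subst_fracD A (u v : {fraction {mpoly k[3]}}) : A \in unitmx ->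
  subst_frac A (u + v) = subst_frac A u + subst_frac A v.
Proof.
move=> Au; have [a [b [b0 ->]]] := tofracE u; have [c [d [d0 ->]]] := tofracE v.
rewrite tofrac_divD // !subst_frac_div ?mulf_neq0 // tofrac_divD ?subst_eq0 //.
by rewrite rmorphD !rmorphM.
Qed.

Lemma subst_fracM A (u v : {fraction {mpoly k[3]}}) : A \in unitmx ->
  subst_frac A (u * v) = subst_frac A u * subst_frac A v.
Proof.
move=> Au; have [a [b [b0 ->]]] := tofracE u; have [c [d [d0 ->]]] := tofracE v.
by rewrite tofrac_divM // !subst_frac_div ?mulf_neq0 // tofrac_divM // !rmorphM.
Qed.

Lemma subst_frac_tofrac A a : A \in unitmx -> subst_frac A a%:F = (subst A a)%:F.
Proof.
by move=> Au; rewrite tofrac_div1 subst_frac_div ?oner_neq0 // rmorph1 -tofrac_div1.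
Qed.

Lemma subst_fracN A u : A \in unitmx -> subst_frac A (- u) = - subst_frac A u.
Proof.
move=> Au; rewrite -mulN1r -tofrac1 -tofracN subst_fracM // subst_frac_tofrac //.
by rewrite rmorphN rmorph1 tofracN tofrac1 mulN1r.
Qed.

Lemma subst_frac_sum A n (F : 'I_n -> _) : A \in unitmx ->
  subst_frac A (\sum_i F i) = \sum_i subst_frac A (F i).
Proof.
move=> Au; apply: (big_morph (subst_frac A)) => [u v|]; first exact: subst_fracD.
by rewrite -tofrac0 subst_frac_tofrac // rmorph0.
Qed.

Lemma subst_fracK A u : A \in unitmx -> subst_frac (invmx A) (subst_frac A u) = u.
Proof.
move=> Au; have [a [b [b0 ->]]] := tofracE u.
by rewrite (subst_frac_div _ Au b0) subst_frac_div ?unitmx_inv ?subst_eq0 // !substK.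
Qed.

Lemma value_at_subst A (u : {fraction {mpoly k[3]}}) v c : A \in unitmx ->
  value_at (v *m A) u c -> value_at v (subst_frac A u) c.
Proof.
move=> Au [d [a [b [ha hb bv -> ->]]]].
exists d, (subst A a), (subst A b); split; rewrite ?subst_homog ?meval_subst //.
by rewrite subst_frac_div // (meval_neq0 bv).
Qed.

Lemma local_ring_subst A (u : {fraction {mpoly k[3]}}) v : A \in unitmx -> v != 0 ->
  local_ring (pt (v *m A)) u -> local_ring (pt v) (subst_frac A u).
Proof.
move=> Au v0 /(local_ringP _ (mulmx_neq0 Au v0))[c h].
by apply/local_ringP => //; exists c; apply: value_at_subst.
Qed.

Lemma local_ideal_subst A f g d e w v : A \in unitmx -> v != 0 ->
  f != 0 -> f \is d.-homog -> g != 0 -> g \is e.-homog ->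
  local_ideal (pt (v *m A)) f g w ->
  local_ideal (pt v) (subst A f) (subst A g) (subst_frac A w).
Proof.
move=> Au v0 f0 hf g0 hg [l [x [y [hl lv hx hy ->]]]].
have l0 : l != 0.
  apply: contra_notN lv => /eqP -> z _; exact: meval0.
exists (subst A l), (subst_frac A x), (subst_frac A y); split.
- exact: subst_homog.
- move/(zero_locus_pt (subst_homog A hl) v0); rewrite meval_subst => e0.
  by apply: lv; apply/(zero_locus_pt hl (mulmx_neq0 Au v0)).
- exact: local_ring_subst.
- exact: local_ring_subst.
rewrite (msize_dhomog f0 hf) (msize_dhomog g0 hg).
rewrite (msize_dhomog _ (subst_homog A hf)) ?subst_eq0 //.
rewrite (msize_dhomog _ (subst_homog A hg)) ?subst_eq0 //.
rewrite subst_fracD // !(subst_fracM _ _ Au).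
have hdiv h n : subst_frac A (h%:F / l%:F ^+ n) = (subst A h)%:F / (subst A l)%:F ^+ n.
  by rewrite -!tofracXn subst_frac_div ?expf_neq0 // rmorphXn.
by congr (_ * _ + _ * _); rewrite -hdiv subst_fracM.
Qed.

(** The substitution is an isomorphism of local rings over [k] that matches the two ideals, so it
    carries a basis of one quotient to a basis of the other. Uniqueness of coordinates is pulled
    back by [invmx A]. *)
Lemma mult_subst A f g d e v n : A \in unitmx -> v != 0 ->
  f != 0 -> f \is d.-homog -> g != 0 -> g \is e.-homog ->
  intersection_multiplicity (pt (v *m A)) f g n ->
  intersection_multiplicity (pt v) (subst A f) (subst A g) n.
Proof.
move=> Au v0 f0 hf g0 hg [E [hE H]].
have Au' : invmx A \in unitmx by rewrite unitmx_inv.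
have vA0 := mulmx_neq0 Au v0.
exists (fun i => subst_frac A (E i)); split=> [i|u hu].
  exact: local_ring_subst.
have hsub B x (c : 'rV[k]_n) (E' : 'I_n -> _) : B \in unitmx ->
    subst_frac B (x - \sum_(i < n) ((c 0 i)%:MP)%:F * E' i)
    = subst_frac B x - \sum_(i < n) ((c 0 i)%:MP)%:F * subst_frac B (E' i).
  move=> Bu; rewrite subst_fracD // subst_fracN // subst_frac_sum //.
  by congr (_ - _); apply: eq_bigr => i _; rewrite subst_fracM // subst_frac_tofrac // substC.
have [|c [hc c_uniq]] := H (subst_frac (invmx A) u).
  by apply: local_ring_subst => //; rewrite mulmxK.
exists c; split=> [|c'].
  have := local_ideal_subst Au v0 f0 hf g0 hg hc.
  by have := subst_fracK u Au'; rewrite invmxK hsub // => ->.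
move=> hc'; apply: c_uniq.
have := @local_ideal_subst (invmx A) _ _ d e _ (v *m A) Au' vA0
  _ (subst_homog A hf) _ (subst_homog A hg).
rewrite mulmxK // !subst_eq0 // => /(_ _ f0 g0 hc').
rewrite !substK // hsub //.
by under eq_bigr do rewrite subst_fracK //.
Qed.

End Substitution.

(** * The unitary group *)

Section Unitary.
Local Open Scope ring_scope.
Local Open Scope card_scope.
Local Open Scope classical_set_scope.
Variable k : closedFieldType.
Hypothesis k_char5 : 5%N \in [pchar k].
Implicit Types (u v : 'rV[k]_3) (A B : 'M[k]_3) (g : PGL3 k).
Local Notation bar := (bar k_char5).

Lemma nth_root (c : k) n : (0 < n)%N -> exists t, t ^+ n = c.
Proof.
move=> n0; have /closed_rootP[t] : size ('X^n - c%:P : {poly k})%R != 1%N.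
  by rewrite size_XnsubC // eqSS -lt0n.
by rewrite rootE !hornerE subr_eq0 => /eqP; exists t.
Qed.

Lemma nth_root_neq0 (c : k) n : c != 0 -> (0 < n)%N -> exists2 t, t != 0 & t ^+ n = c.
Proof.
move=> c0 n0; have [t tc] := nth_root c n0; exists t => //.
by apply: contraNneq c0 => t0; rewrite -tc t0 expr0n eqn0Ngt n0.
Qed.

Definition unitary A := A *m (bar A)^T = 1%:M.

Lemma unitary_unit A : unitary A -> A \in unitmx.
Proof. by case/mulmx1_unit. Qed.

Lemma unitary_invE A : unitary A -> invmx A = (bar A)^T.
Proof.
by move=> uA; rewrite -[RHS]mul1mx -(mulVmx (unitary_unit uA)) -mulmxA uA mulmx1.
Qed.

Lemma unitaryV A : unitary A -> (bar A)^T *m A = 1%:M.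
Proof. by move=> uA; rewrite -unitary_invE // mulVmx // unitary_unit. Qed.

Lemma unitary_inv A : unitary A -> unitary (invmx A).
Proof.
move=> uA; have Au := unitary_unit uA.
rewrite /unitary bar_inv {1}(unitary_invE uA) -trmx_mul mulVmx ?trmx1 //.
by rewrite bar_unit.
Qed.

Lemma Gamma_unitary A p : unitary A -> Gamma p -> Gamma (pt_act p (pgl A)).
Proof.
move=> uA; have [v v0 ->] := ptP p; have Au := unitary_unit uA.
rewrite pt_act_pgl // !(Gamma_bar k_char5) ?mulmx_neq0 // => e.
by rewrite barM trmx_mul mulmxA -(mulmxA v) uA mulmx1.
Qed.

Lemma pgl_inv A : A \in unitmx -> pgl (invmx A) = (pgl A)^-1%g.
Proof.
move=> Au; apply: (mulgI (pgl A)).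
by rewrite mulgV pglM ?unitmx_inv // mulmxV // pgl1.
Qed.

Lemma PGU_unitary A : unitary A -> PGU (pgl A).
Proof.
move=> uA; rewrite /PGU /=; apply/seteqP; split=> [_ [p Gp <-]|p Gp].
  exact: Gamma_unitary.
exists (pt_act p (pgl (invmx A))); first exact: Gamma_unitary (unitary_inv uA) Gp.
by rewrite -pt_actM pgl_inv ?unitary_unit // mulVg pt_act1.
Qed.

Lemma sqrt2_exists : exists w : k, w ^+ 2 = 2%:R.
Proof. exact: nth_root. Qed.

Lemma natr5 : 5%:R = 0 :> k.
Proof. exact: pcharf0 k_char5. Qed.

(* The points e_i + a e_j with a^6 = -1 suffice, for a = 2, -2, 1 + w and - (1 + w). *)
Lemma hermitian_form_scalar (H : 'M[k]_3) :
  (forall v, v != 0 -> (v *m (bar v)^T) 0 0 = 0 -> (v *m H *m (bar v)^T) 0 0 = 0) ->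
  H = (H 0 0)%:M.
Proof.
move=> HH; have [w w2] := sqrt2_exists.
(* The value of the form [H] at the isotropic vector [e_i + a e_j]. *)
have key (i j : 'I_3) (a : k) : i != j -> a ^+ 6 = - 1 ->
    H i i + a ^+ 5 * H i j + a * H j i - H j j = 0.
  move=> ij a6.
  pose v : 'rV[k]_3 := delta_mx 0 i + a *: delta_mx 0 j.
  have vE s : v 0 s = (s == i)%:R + a * (s == j)%:R by rewrite !mxE !eqxx /=.
  have bvE : (bar v)^T = delta_mx i 0 + a ^+ 5 *: delta_mx j 0.
    rewrite /v /bar map_mxD map_mxZ !map_delta_mx linearD linearZ /= !trmx_delta.
    by rewrite pFrobenius_autE.
  have := HH v; rewrite bvE.
  have dE (M : 'M[k]_3) s t : (delta_mx 0 s : 'rV[k]_3) *m M *m (delta_mx t 0 : 'cV[k]_3)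
      = (M s t)%:M.
    apply/rowP => z; rewrite !ord1 -rowE mxE (bigD1 t) //= !mxE !eqxx mulr1 big1 ?addr0 //.
    by move=> y yt; rewrite !mxE (negPf yt) mulr0.
  have ev (M : 'M[k]_3) : (v *m M *m (delta_mx i 0 + a ^+ 5 *: delta_mx j 0 : 'cV[k]_3)) 0 0
      = M i i + a ^+ 5 * M i j + a * M j i + a ^+ 6 * M j j.
    rewrite /v !mulmxDl !mulmxDr -!scalemxAl -!scalemxAr !dE !mxE eqxx /= !mulr1n.
    by rewrite exprS; ring.
  have e1 := ev 1%:M; rewrite mulmx1 in e1; rewrite e1 ev a6.
  have -> : (1%:M : 'M[k]_3) i i = 1 by rewrite mxE eqxx.
  have -> : (1%:M : 'M[k]_3) j j = 1 by rewrite mxE eqxx.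
  have -> : (1%:M : 'M[k]_3) i j = 0 by rewrite mxE (negPf ij).
  have -> : (1%:M : 'M[k]_3) j i = 0 by rewrite mxE eq_sym (negPf ij).
  rewrite !mulr0 !addr0 mulr1 subrr mulN1r; apply=> //.
  apply/rV0Pn; exists i; rewrite vE eqxx (negPf ij) mulr0 addr0; exact: oner_neq0.
have e2 : (2%:R : k) ^+ 6 = - 1.
  transitivity (- 1 + 5%:R * 13%:R : k); first by ring.
  by rewrite natr5 mul0r addr0.
have ew : (1 + w) ^+ 6 = - 1.
  have w5 : (1 + w) ^+ 5 = 1 + 4%:R * w.
    rewrite -(pFrobenius_autE k_char5) rmorphD rmorph1 /= pFrobenius_autE; congr (_ + _).
    have -> : w ^+ 5 = w ^+ 2 * w ^+ 2 * w by ring.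
    by rewrite w2; ring.
  rewrite exprS w5; transitivity (1 + 4%:R * w ^+ 2 + 5%:R * w); first by ring.
  rewrite w2 natr5 mul0r addr0; transitivity (- 1 + 5%:R * 2%:R : k); first by ring.
  by rewrite natr5 mul0r addr0.
have off (i j : 'I_3) : i != j -> H i i = H j j /\ H j i = 0.
  move=> ij.
  have h a : a ^+ 6 = -1 -> a * (H i i - H j j) - H i j + a ^+ 2 * H j i = 0.
    move=> a6; transitivity (a * (H i i + a ^+ 5 * H i j + a * H j i - H j j)
       - (a ^+ 6 + 1) * H i j); first by ring.
    by rewrite key // a6 addNr mul0r mulr0 subr0.
  (* Both [a] and [- a] qualify; the difference and the sum of their relations separate the diagonal
     from the off-diagonal entries. *)
  have hN a : a ^+ 6 = -1 -> (H i i = H j j) /\ H i j = a ^+ 2 * H j i.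
    move=> a6; have a0 : a != 0.
      by apply: contra_eq_neq a6 => ->; rewrite expr0n /= eq_sym oppr_eq0 oner_eq0.
    have h1 := h a a6; have h2 : (- a) * (H i i - H j j) - H i j + a ^+ 2 * H j i = 0.
      by rewrite -[a ^+ 2]sqrrN; apply: h; rewrite -a6; ring.
    split; apply/eqP; rewrite -subr_eq0; apply/eqP.
      apply: (mulfI (two_neq0 k_char5)); apply: (mulfI a0).
      transitivity ((a * (H i i - H j j) - H i j + a ^+ 2 * H j i)
         - ((- a) * (H i i - H j j) - H i j + a ^+ 2 * H j i)); first by ring.
      by rewrite h1 h2 subr0 !mulr0.
    apply: (mulfI (two_neq0 k_char5)).
    transitivity (- ((a * (H i i - H j j) - H i j + a ^+ 2 * H j i)
         + ((- a) * (H i i - H j j) - H i j + a ^+ 2 * H j i))); first by ring.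
    by rewrite h1 h2 addr0 oppr0 mulr0.
  have [-> h2] := hN _ e2; have [_ hw] := hN _ ew; split=> //.
  (* The squares of [1 + w] and 2 differ by [2 w - 1], which is nonzero because
     [(2 w + 1) (2 w - 1) = 7], that is 2 in [k]. *)
  have : (2%:R * w - 1) * H j i = 0.
    transitivity (((1 + w) ^+ 2 - 2%:R ^+ 2) * H j i - (w ^+ 2 - 2%:R) * H j i); first by ring.
    by rewrite w2 subrr mul0r subr0 mulrBl -hw -h2 subrr.
  move/eqP; rewrite mulf_eq0 => /orP[/eqP e|/eqP->//]; exfalso.
  have : 2%:R = 0 :> k.
    transitivity ((2%:R * w + 1) * (2%:R * w - 1) - 4%:R * (w ^+ 2 - 2%:R) - 5%:R : k).
      by ring.
    by rewrite e w2 subrr natr5 !mulr0 !subr0.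
  by move/eqP; rewrite (negPf (two_neq0 k_char5)).
apply/matrixP => i j; rewrite [RHS]mxE.
have [->|ij] := eqVneq i j; last first.
  by rewrite mulr0n; rewrite eq_sym in ij; have [_ ->] := off j i ij.
rewrite mulr1n; have [->//|j0] := eqVneq j 0.
by have [-> _] := off j 0 j0.
Qed.

(** An automorphism of Gamma pulls the standard Hermitian form back to one that vanishes on Gamma,
    hence to a multiple [c] of itself. Scaling [A] by [t] multiplies [A (bar A)^T] by [t ^+ 6], so a
    sixth root of [c^-1] makes it unitary. *)
Lemma PGUP g : PGU g <-> exists2 A, unitary A & g = pgl A.
Proof.
split=> [Gg|[A uA ->]]; last exact: PGU_unitary.
have [A Au eg] := pglP g.
have HH : A *m (bar A)^T = ((A *m (bar A)^T) 0 0)%:M.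
  apply: hermitian_form_scalar => v v0 /(Gamma_bar k_char5 v0) Gv.
  have : Gamma (pt_act (pt v) g) by rewrite -[X in X _]Gg; exists (pt v).
  rewrite eg pt_act_pgl // (Gamma_bar k_char5) ?mulmx_neq0 //.
  by rewrite barM trmx_mul !mulmxA.
set c := (_ *m _) 0 0 in HH.
have c0 : c != 0.
  apply/eqP => c0; have : A *m (bar A)^T \in unitmx.
    by rewrite unitmx_mul Au unitmx_tr bar_unit.
  by rewrite HH c0 unitmxE det_scalar expr0n unitr0.
have [t t0 tc] := @nth_root_neq0 c^-1 6 (invr_neq0 c0) isT.
exists (t *: A); last by rewrite pgl_scale.
rewrite /unitary barZ linearZ /= -scalemxAr -scalemxAl scalerA HH -exprSr tc.
by rewrite scale_scalar_mx mulVf.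
Qed.

End Unitary.

(** * Action of PGU on conics and rational points *)

Section Equivariance.
Local Open Scope ring_scope.
Local Open Scope card_scope.
Local Open Scope classical_set_scope.
Variable k : closedFieldType.
Hypothesis k_char5 : 5%N \in [pchar k].
Implicit Types (u v n : 'rV[k]_3) (A B : 'M[k]_3) (g h : PGL3 k) (Q : set (ppoint k)).
Local Notation bar := (bar k_char5).
Local Notation unitary := (unitary k_char5).

(** The generic vector: forms are matrix products in it, and substitution is multiplication by
    [A]. *)
Let vars : 'rV[{mpoly k[3]}]_3 := \row_i 'X_i.
Local Notation C := (map_mx (@mpolyC 3 k)).

Lemma map_subst_vars A : map_mx (subst A) vars = vars *m C A.
Proof.
apply/rowP => i; rewrite !mxE substX; apply: eq_bigr => j _.
by rewrite !mxE mulrC mul_mpolyC.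
Qed.

Lemma map_substC A (m r : nat) (M : 'M[k]_(m, r)) : map_mx (subst A) (C M) = C M.
Proof. by apply/matrixP => i j; rewrite !mxE substC. Qed.

Lemma quad_poly_mx B : quad_poly B = (vars *m C B *m vars^T) 0 0.
Proof.
rewrite mxE /quad_poly exchange_big; apply: eq_bigr => j _.
rewrite !mxE mulr_suml; apply: eq_bigr => i _.
by rewrite !mxE -mul_mpolyC mulrA [_%:MP * _]mulrC.
Qed.

Lemma subst_quad_poly A B : subst A (quad_poly B) = quad_poly (A *m B *m A^T).
Proof.
rewrite !quad_poly_mx.
transitivity (map_mx (subst A) (vars *m C B *m vars^T) 0 0); first by rewrite !mxE.
by rewrite !map_mxM -map_trmx map_subst_vars map_substC trmx_mul -map_trmx !mulmxA.
Qed.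

Lemma mpoly_char5 : 5%N \in [pchar {mpoly k[3]}].
Proof.
rewrite !inE /=; have -> : 5%:R = (5%:R)%:MP :> {mpoly k[3]} by rewrite mpolyC_nat.
by rewrite (pcharf0 k_char5) mpolyC0 eqxx.
Qed.

Lemma fermat_mx :
  fermat k = (vars *m (map_mx (pFrobenius_aut mpoly_char5) vars)^T) 0 0.
Proof.
rewrite mxE; apply: eq_bigr => i _.
by rewrite !mxE pFrobenius_autE -exprS.
Qed.

Lemma subst_fermat A : unitary A -> subst A (fermat k) = fermat k.
Proof.
move=> uA; rewrite !fermat_mx; set F := pFrobenius_aut _.
have FC (m r : nat) (M : 'M[k]_(m, r)) : map_mx F (C M) = C (bar M).
  by apply/matrixP => i j; rewrite !mxE !pFrobenius_autE rmorphXn.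
have SF : map_mx (subst A) (map_mx F vars) = map_mx F (map_mx (subst A) vars).
  by apply/matrixP => i j; rewrite !mxE /F !pFrobenius_autE rmorphXn.
transitivity (map_mx (subst A) (vars *m (map_mx F vars)^T) 0 0); first by rewrite [RHS]mxE.
rewrite map_mxM -map_trmx SF map_subst_vars map_mxM FC trmx_mul mulmxA.
have e : C A *m (C (bar A))^T = 1%:M.
  transitivity (C (A *m (bar A)^T)); first by rewrite map_mxM map_trmx.
  by rewrite uA map_mx1.
by rewrite -(mulmxA vars) e mulmx1.
Qed.

Lemma totally_tangentP Q : totally_tangent_conics Q <-> exists B,
  [/\ B^T = B, B \in unitmx, Q = conic B, Q `&` Gamma #= `I_6 &
      forall p, (Q `&` Gamma) p ->
        intersection_multiplicity p (quad_poly B) (fermat k) 2].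
Proof.
split=> [[q [/(quad_polyP k_char5)[B sB ->] ns -> c6 hm]]|[B [sB Bu -> c6 hm]]].
  exists B; split=> //; first exact/(nonsingular_quad_poly k_char5 sB).
  by rewrite zero_locus_quad_poly.
exists (quad_poly B); split=> //.
- exact: quad_poly_homog.
- exact/(nonsingular_quad_poly k_char5 sB).
by rewrite zero_locus_quad_poly.
Qed.

(** Substituting by [invmx A] gives the equation of the image conic and fixes the Fermat form, so
    [mult_subst] transports the multiplicities. *)
Lemma totally_tangent_act Q g : PGU g ->
  totally_tangent_conics Q -> totally_tangent_conics (set_act Q g).
Proof.
move=> Gg /totally_tangentP[B [sB Bu -> c6 hm]].
have /(PGUP k_char5)[A uA eg] := Gg; have Au := unitary_unit uA.
have eQ : set_act (conic B) g = conic (invmx A *m B *m (invmx A)^T).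
  rewrite eg -[RHS](conic_act _ Au); congr (set_act (conic _) _).
  by rewrite trmx_inv !mulmxA mulmxV // mul1mx mulmxKV // unitmx_tr.
have eI : set_act (conic B) g `&` Gamma = set_act (conic B `&` Gamma) g.
  by rewrite set_actI [in RHS]Gg.
apply/totally_tangentP; exists (invmx A *m B *m (invmx A)^T); split=> //.
- by rewrite !trmx_mul trmxK sB mulmxA.
- by rewrite !unitmx_mul unitmx_tr unitmx_inv Au Bu.
- by rewrite eI; apply: card_set_act.
rewrite eI => _ [p /hm + <-]; have [v v0 ->] := ptP p.
rewrite eg pt_act_pgl // => hp.
rewrite -subst_quad_poly -(subst_fermat (unitary_inv uA)).
have f0 := quad_poly_neq0 k_char5 Bu sB.
apply: (mult_subst _ _ f0 (quad_poly_homog B) (fermat_neq0 k) (fermat_homog k)).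
- by rewrite unitmx_inv.
- exact: mulmx_neq0.
by rewrite mulmxK.
Qed.

Lemma PGU1 : PGU (1%g : PGL3 k).
Proof. by rewrite /PGU /= set_act1. Qed.
Lemma PGUM g h : PGU g -> PGU h -> PGU (g * h)%g.
Proof. by rewrite /PGU /= set_actM => -> ->. Qed.
Lemma PGUV g : PGU g -> PGU g^-1%g.
Proof. by rewrite /PGU /= => e; rewrite -{1}e set_actK. Qed.

(** A unitary matrix has entries in F_25: conjugating and transposing [A (bar A)^T = 1] shows that
    [bar (bar A)] is, like [A], inverse to [(bar A)^T]. *)
Lemma rational_points_act g p : PGU g ->
  rational_points p -> rational_points (pt_act p g).
Proof.
move=> Gg [Gp [v [pv v0 v25]]]; split; first by rewrite -[Gamma]Gg; exists p.
have /(PGUP k_char5)[A uA eg] := Gg; have Au := unitary_unit uA.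
have ep : p = pt v.
  have [u u0 eu] := ptP p; move: pv; rewrite eu val_pt // => /vlineP[c ec].
  rewrite ec pt_scale //; apply: contraNneq v0 => c0; by rewrite ec c0 scale0r.
exists (v *m A); split; last 2 first.
- exact: mulmx_neq0.
- have barbar (m r : nat) (M : 'M[k]_(m, r)) i j : bar (bar M) i j = M i j ^+ 25.
    by rewrite !barE -exprM.
  have A25 : bar (bar A) = A.
    have e1 : bar (bar A) *m (bar A)^T = 1%:M.
      by rewrite -trmx1 -(bar1 k_char5) -uA barM bar_tr trmx_mul trmxK.
    by rewrite -[LHS]mulmx1 -(unitaryV uA) mulmxA e1 mul1mx.
  have v25' : bar (bar v) = v by apply/matrixP => i j; rewrite barbar ord1 v25.
  by move=> i; rewrite -barbar !barM A25 v25'.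
rewrite eg ep pt_act_pgl // val_pt ?mulmx_neq0 //; exact: memv_line.
Qed.

End Equivariance.

(** * Lines and secants *)

Section Lines.
Local Open Scope ring_scope.
Local Open Scope card_scope.
Local Open Scope classical_set_scope.
Variable k : closedFieldType.
Hypothesis k_char5 : 5%N \in [pchar k].
Implicit Types (u v n : 'rV[k]_3) (A B : 'M[k]_3) (g h : PGL3 k) (Q : set (ppoint k)).
Implicit Types (l : pline k) (p : ppoint k).

Definition row3 (a b c : k) : 'rV[k]_3 :=
  \row_i (if i == 0 then a else if i == 1 then b else c).

Lemma row3E a b c : (row3 a b c 0 0 = a) * (row3 a b c 0 1 = b) * (row3 a b c 0 2%:R = c).
Proof. by rewrite !mxE. Qed.

Lemma ord3_ind (P : 'I_3 -> Prop) : P 0 -> P 1 -> P 2%:R -> forall i, P i.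
Proof.
move=> p0 p1 p2 [] [|[|[|//]]] lti.
- by rewrite (_ : Ordinal lti = 0) //; apply: val_inj.
- by rewrite (_ : Ordinal lti = 1) //; apply: val_inj.
by rewrite (_ : Ordinal lti = 2%:R) //; apply: val_inj.
Qed.

Lemma row3_eta v : v = row3 (v 0 0) (v 0 1) (v 0 2%:R).
Proof. by apply/rowP; elim/ord3_ind; rewrite row3E. Qed.

Definition dot u v : k := (u *m v^T) 0 0.

Lemma dotE u v : dot u v = u 0 0 * v 0 0 + u 0 1 * v 0 1 + u 0 2%:R * v 0 2%:R.
Proof. by rewrite /dot mxE big_ord3 !mxE. Qed.

Lemma dotC u v : dot u v = dot v u.
Proof. by rewrite !dotE; ring. Qed.
Lemma dotZl c u v : dot (c *: u) v = c * dot u v.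
Proof. by rewrite /dot -scalemxAl mxE. Qed.
Lemma dotZr c u v : dot u (c *: v) = c * dot u v.
Proof. by rewrite dotC dotZl dotC. Qed.
Lemma dotDl u v n : dot (u + v) n = dot u n + dot v n.
Proof. by rewrite /dot mulmxDl mxE. Qed.
Lemma dot0l v : dot 0 v = 0.
Proof. by rewrite /dot mul0mx mxE. Qed.

Definition cross u v : 'rV[k]_3 :=
  row3 (u 0 1 * v 0 2%:R - u 0 2%:R * v 0 1)
       (u 0 2%:R * v 0 0 - u 0 0 * v 0 2%:R)
       (u 0 0 * v 0 1 - u 0 1 * v 0 0).

Lemma dot_crossl u v : dot u (cross u v) = 0.
Proof. by rewrite dotE !row3E; ring. Qed.
Lemma dot_crossr u v : dot v (cross u v) = 0.
Proof. by rewrite dotE !row3E; ring. Qed.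

Lemma cross_eq0 u v : u != 0 -> v != 0 -> cross u v = 0 -> exists2 c, c != 0 & u = c *: v.
Proof.
move=> u0 v0 /rowP e; apply: minors_proportional => // i j.
move: (e 0) (e 1) (e 2%:R); rewrite !row3E !mxE => e0 e1 e2.
by elim/ord3_ind: i; elim/ord3_ind: j => //; apply/eqP; rewrite -subr_eq0;
  rewrite ?e0 ?e1 ?e2 // -oppr_eq0 opprB ?e0 ?e1 ?e2.
Qed.

(** The triple product of [n] with [cross u v] expands to [(v . n) u - (u . n) v] and hence
    vanishes. *)
Lemma perp_cross u v n : cross u v != 0 -> n != 0 -> dot u n = 0 -> dot v n = 0 ->
  exists2 c, c != 0 & n = c *: cross u v.
Proof.
move=> c0 n0; rewrite !dotE => un vn; apply: cross_eq0 => //.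
apply/rowP; elim/ord3_ind; rewrite !row3E !mxE.
- transitivity (u 0 0 * (v 0 0 * n 0 0 + v 0 1 * n 0 1 + v 0 2%:R * n 0 2%:R)
    - v 0 0 * (u 0 0 * n 0 0 + u 0 1 * n 0 1 + u 0 2%:R * n 0 2%:R)); first by ring.
  by rewrite un vn; ring.
- transitivity (u 0 1 * (v 0 0 * n 0 0 + v 0 1 * n 0 1 + v 0 2%:R * n 0 2%:R)
    - v 0 1 * (u 0 0 * n 0 0 + u 0 1 * n 0 1 + u 0 2%:R * n 0 2%:R)); first by ring.
  by rewrite un vn; ring.
transitivity (u 0 2%:R * (v 0 0 * n 0 0 + v 0 1 * n 0 1 + v 0 2%:R * n 0 2%:R)
    - v 0 2%:R * (u 0 0 * n 0 0 + u 0 1 * n 0 1 + u 0 2%:R * n 0 2%:R)); first by ring.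
by rewrite un vn; ring.
Qed.

Lemma pt_neq_cross u v : u != 0 -> v != 0 -> pt u <> pt v -> cross u v != 0.
Proof.
move=> u0 v0 uv; apply/eqP => /(cross_eq0 u0 v0)[c c0 e].
by apply: uv; rewrite e pt_scale.
Qed.

Definition perp n : {vspace 'rV[k]_3} := lker (linfun (mulmxr n^T : 'rV[k]_3 -> 'rV[k]_1)).

Lemma mem_perp n v : (v \in perp n) = (dot v n == 0).
Proof.
rewrite memv_ker lfunE /= /dot; apply/eqP/eqP => [->|e]; first by rewrite mxE.
by apply/rowP => i; rewrite !ord1 e mxE.
Qed.

Lemma dim_perp n : n != 0 -> \dim (perp n) == 2%N.
Proof.
move=> n0; rewrite /perp; set f := linfun _.
have := limg_ker_dim f fullv; rewrite capfv dimvf /dim /= => e.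
have : \dim (f @: fullv)%VS = 1%N.
  apply/eqP; rewrite eqn_leq; apply/andP; split.
    by have := dimvS (subvf (f @: fullv)%VS); rewrite dimvf /dim /=.
  rewrite lt0n dimv_eq0; have /rV0Pn[i ni] := n0.
  apply: contraNneq ni => e0.
  have : f (delta_mx 0 i) \in (f @: fullv)%VS by rewrite memv_img ?memvf.
  rewrite e0 memv0 lfunE /= -rowE => /eqP/rowP/(_ 0).
  by rewrite !mxE => /eqP.
by move=> d1; move: e; rewrite d1 addn1 => -[->].
Qed.

Lemma row100_neq0 : row3 1 0 0 != 0.
Proof. by apply/rV0Pn; exists 0; rewrite row3E oner_neq0. Qed.

(** Lines are handled through a normal vector; [n = 0] gives the line [x = 0]. *)
Definition mkline n : pline k :=
  insubd (Sub (perp (row3 1 0 0)) (dim_perp row100_neq0) : pline k) (perp n).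

Lemma val_mkline n : n != 0 -> val (mkline n) = perp n.
Proof. by move=> n0; rewrite val_insubd dim_perp. Qed.

Lemma on_line_pt v l : v != 0 -> on_line (pt v) l <-> v \in val l.
Proof. by move=> v0; rewrite /on_line val_pt. Qed.

Lemma on_mkline v n : v != 0 -> n != 0 -> on_line (pt v) (mkline n) <-> dot v n = 0.
Proof.
move=> v0 n0; rewrite on_line_pt // val_mkline // mem_perp.
by split=> [/eqP|->].
Qed.

Lemma pline_eq l l' : (forall p, on_line p l <-> on_line p l') -> l = l'.
Proof.
move=> H; apply: val_inj; apply/eqP; rewrite eqEsubv; apply/andP; split;
  apply/subvP => v vl; have [->|v0] := eqVneq v 0; rewrite ?mem0v //;
  by apply/(on_line_pt _ v0)/H/(on_line_pt _ v0).
Qed.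

Lemma mkline_scale c n : c != 0 -> n != 0 -> mkline (c *: n) = mkline n.
Proof.
move=> c0 n0; apply: pline_eq => p; have [v v0 ->] := ptP p.
have cn0 : c *: n != 0 by rewrite scaler_eq0 negb_or c0.
rewrite !on_mkline // dotZr; split=> [/eqP|->]; last by rewrite mulr0.
by rewrite mulf_eq0 (negPf c0) => /eqP.
Qed.

Lemma line_cross l : exists u v, [/\ cross u v != 0, u \in val l & v \in val l].
Proof.
have /eqP dl := valP l.
have : basis_of (val l) (vbasis (val l)) := vbasisP _.
set X := vbasis _; rewrite /basis_of => /andP[/eqP sX fX].
have szX : size X = 2%N by rewrite size_tuple dl.
case: X sX fX szX => -[|u [|v [|]]] //= _ sX fX _.
have u0 : u != 0 by apply: (free_not0 fX); rewrite mem_head.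
have v0 : v != 0 by apply: (free_not0 fX); rewrite !inE eqxx orbT.
exists u, v; split.
- apply/eqP => /(cross_eq0 u0 v0)[c c0 e].
  move: fX; rewrite free_cons span_seq1 => /andP[/negP[]].
  by rewrite e memvZ ?memv_line.
- have : u \in <<[:: u; v]>>%VS by rewrite memv_span ?mem_head.
  by rewrite sX.
have : v \in <<[:: u; v]>>%VS by rewrite memv_span // !inE eqxx orbT.
by rewrite sX.
Qed.

Lemma lineP l : exists2 n, n != 0 & l = mkline n.
Proof.
have [u [v [c0 uL vL]]] := line_cross l; exists (cross u v) => //.
apply: pline_eq => p; have [x x0 ->] := ptP p.
rewrite on_mkline // on_line_pt //.
have /eqP dl := valP l.
have sub : (<<[:: u; v]>> <= val l)%VS.
  by apply/span_subvP => y; rewrite !inE => /orP[]/eqP->.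
have sub' : (<<[:: u; v]>> <= perp (cross u v))%VS.
  apply/span_subvP => y; rewrite !inE mem_perp => /orP[]/eqP->.
    by rewrite dot_crossl.
  by rewrite dot_crossr.
have d2 : \dim <<[:: u; v]>>%VS = 2%N.
  have : free [:: u; v]; last by rewrite /free => /eqP.
  rewrite free_cons span_seq1 seq1_free; apply/andP; split.
    apply/negP => /vlineP[c e]; case/negP: c0; rewrite e.
    by apply/eqP/rowP; elim/ord3_ind; rewrite !row3E !mxE; ring.
  by apply: contraNneq c0 => ->; apply/eqP/rowP; elim/ord3_ind; rewrite !row3E !mxE; ring.
have e1 : <<[:: u; v]>>%VS = val l by apply/eqP; rewrite eqEdim sub d2 dl.
have e2 : <<[:: u; v]>>%VS = perp (cross u v).
  by apply/eqP; rewrite eqEdim sub' d2 (eqP (dim_perp c0)).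
by rewrite -e1 e2 mem_perp; split=> [/eqP|->].
Qed.

Lemma mkline_inj n m : n != 0 -> m != 0 -> mkline n = mkline m ->
  exists2 c, c != 0 & n = c *: m.
Proof.
move=> n0 m0 e; have [u [v [c0 uL vL]]] := line_cross (mkline n).
have [a a0 ea] : exists2 a, a != 0 & n = a *: cross u v.
  by apply: (perp_cross c0 n0); apply/eqP; rewrite -mem_perp -(val_mkline n0).
have [b b0 eb] : exists2 b, b != 0 & m = b *: cross u v.
  by apply: (perp_cross c0 m0); apply/eqP; rewrite -mem_perp -(val_mkline m0) -e.
exists (a / b); first by rewrite mulf_neq0 ?invr_eq0.
by rewrite ea eb scalerA divfK.
Qed.

Lemma line_act_exists l g : exists l', forall p, on_line (pt_act p g) l' <-> on_line p l.
Proof.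
have [A Au ->] := pglP g; have [n n0 ->] := lineP l.
have n'0 : n *m (invmx A)^T != 0 by rewrite mulmx_neq0 // unitmx_tr unitmx_inv.
exists (mkline (n *m (invmx A)^T)) => p; have [v v0 ->] := ptP p.
rewrite pt_act_pgl // (on_mkline (mulmx_neq0 Au v0) n'0) (on_mkline v0 n0).
by rewrite /dot trmx_mul trmxK -mulmxA mulKVmx.
Qed.

(** A line is determined by its points, so an arbitrary choice with the right incidences is the
    image line. *)
Definition line_act l g : pline k := projT1 (cid (line_act_exists l g)).

Lemma line_actP l g p : on_line (pt_act p g) (line_act l g) <-> on_line p l.
Proof. exact: (projT2 (cid (line_act_exists l g)) p). Qed.

Lemma line_actK g : cancel (fun l => line_act l g) (fun l => line_act l g^-1%g).
Proof.
move=> l; apply: pline_eq => p.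
rewrite -[p in X in X <-> _]pt_act1 -(mulgV g) pt_actM.
by split=> [/line_actP/line_actP//|H]; apply/line_actP/line_actP.
Qed.

Lemma line_actVK g : cancel (fun l => line_act l g^-1%g) (fun l => line_act l g).
Proof. by move=> l; have := line_actK g^-1%g l; rewrite invgK. Qed.

Lemma special_secant_act l g : PGU g -> special_secant l -> special_secant (line_act l g).
Proof.
move=> Gg [p [p' [rp rp' pp' pl pl']]]; exists (pt_act p g), (pt_act p' g); split.
- exact: rational_points_act.
- exact: rational_points_act.
- by move/pt_act_inj.
- exact/line_actP.
exact/line_actP.
Qed.

Lemma secants_line_act Q l g : PGU g -> secants Q l -> secants (set_act Q g) (line_act l g).
Proof.
move=> Gg [sl [p [p' [hp hp' pp' pl pl']]]]; split; first exact: special_secant_act.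
have im x : (Q `&` Gamma) x -> (set_act Q g `&` Gamma) (pt_act x g).
  by move=> [Qx Gx]; split; [exists x | rewrite -[Gamma]Gg; exists x].
exists (pt_act p g), (pt_act p' g); split; try exact: im; try exact/line_actP.
by move/pt_act_inj.
Qed.

Lemma secants_act Q g : PGU g ->
  secants (set_act Q g) = [set line_act l g | l in secants Q].
Proof.
move=> Gg; apply/seteqP; split=> [l hl|_ [l hl <-]]; last exact: secants_line_act.
exists (line_act l g^-1%g); last exact: line_actVK.
by rewrite -[Q](set_actK _ g); apply: secants_line_act; first exact: PGUV.
Qed.

Lemma adjacent_act Q Q' g : PGU g -> adjacent Q Q' -> adjacent (set_act Q g) (set_act Q' g).
Proof.
move=> Gg [tQ tQ' QQ' c4 c3]; split.
- exact: totally_tangent_act.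
- exact: totally_tangent_act.
- by move/set_act_inj.
- by rewrite -set_actI; apply: card_set_act.
rewrite !secants_act //.
have -> : [set line_act l g | l in secants Q] `&` [set line_act l g | l in secants Q']
    = [set line_act l g | l in secants Q `&` secants Q'].
  apply/seteqP; split=> [_ [[l hl <-] [l' hl' /(can_inj (line_actK g)) e]]|].
    by exists l => //; split=> //; rewrite -e.
  by move=> _ [l [hl hl'] <-]; split; exists l.
apply: card_eq_trans c3; apply: inj_card_eq => x y _ _.
by move=> e; exact: (can_inj (line_actK g) e).
Qed.

Lemma adjacent_actE Q Q' g : PGU g ->
  adjacent (set_act Q g) (set_act Q' g) <-> adjacent Q Q'.
Proof.
move=> Gg; split=> [H|]; last exact: adjacent_act.
by have := adjacent_act (PGUV Gg) H; rewrite !set_actK.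
Qed.

End Lines.

(** * Classification of the totally tangent conics *)

Lemma uniq5 (T : eqType) (a b c d e : T) : uniq [:: a; b; c; d; e] ->
  a <> b /\ a <> c /\ a <> d /\ a <> e /\ b <> c /\ b <> d /\ b <> e /\
  c <> d /\ c <> e /\ d <> e.
Proof.
rewrite /= !inE !negb_or => /and5P[/and4P[/eqP ? /eqP ? /eqP ? /eqP ?]
  /and3P[/eqP ? /eqP ? /eqP ?] /andP[/eqP ? /eqP ?] /eqP ? _].
by do 9 split=> //.
Qed.

Section Classification.
Local Open Scope ring_scope.
Local Open Scope card_scope.
Local Open Scope classical_set_scope.
Variable k : closedFieldType.
Hypothesis k_char5 : 5%N \in [pchar k].
Implicit Types (u v w x y : 'rV[k]_3) (A B C : 'M[k]_3) (Q : set (ppoint k)).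
Local Notation bar := (bar k_char5).

Definition rows3 u v w : 'M[k]_3 :=
  \matrix_(i, j) (if i == 0 then u 0 j else if i == 1 then v 0 j else w 0 j).

Lemma rows3E u v w :
  (row 0 (rows3 u v w) = u) * (row 1 (rows3 u v w) = v) * (row 2%:R (rows3 u v w) = w).
Proof. by split; [split|]; apply/rowP => j; rewrite !mxE. Qed.

Lemma mul_rows3 x u v w : x *m rows3 u v w = x 0 0 *: u + x 0 1 *: v + x 0 2%:R *: w.
Proof. by rewrite mulmx_sum_row big_ord3 !rows3E. Qed.

Lemma mul_rows3_row u v w A : rows3 u v w *m A = rows3 (u *m A) (v *m A) (w *m A).
Proof.
apply/row_matrixP; elim/ord3_ind; by rewrite row_mul !rows3E.
Qed.

Lemma bar_rows3 u v w : bar (rows3 u v w) = rows3 (bar u) (bar v) (bar w).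
Proof.
apply/row_matrixP; elim/ord3_ind; rewrite -map_row !rows3E //.
Qed.

Lemma scale_rowE c x i : (c *: x) 0 i = c * x 0 i.
Proof. by rewrite mxE. Qed.

Lemma gram_entry A B i j : (A *m B *m A^T) i j = bil B (row i A) (row j A).
Proof.
by rewrite /bil -row_mul !mxE; apply: eq_bigr => s _; rewrite !mxE.
Qed.

Lemma bil0l B v : bil B 0 v = 0.
Proof. by rewrite /bil !mul0mx mxE. Qed.

Section Isotropic.
Variable B : 'M[k]_3.
Hypotheses (sB : B^T = B) (Bu : B \in unitmx).

(** If two points of the conic were conjugate, [u B] and [v B] would both be normals of the line
    joining them, hence proportional, against the invertibility of [B]. *)
Lemma isotropic_bil_neq0 u v : u != 0 -> v != 0 -> pt u <> pt v ->
  bil B u u = 0 -> bil B v v = 0 -> bil B u v != 0.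
Proof.
move=> u0 v0 uv Bu0 Bv0; apply/eqP => Buv.
have c0 := pt_neq_cross u0 v0 uv.
have dB x y : dot y (x *m B) = bil B x y by rewrite dotC.
have [a a0 ea] : exists2 a, a != 0 & u *m B = a *: cross u v.
  by apply: (perp_cross c0 (mulmx_neq0 Bu u0)); rewrite dB.
have [b b0 eb] : exists2 b, b != 0 & v *m B = b *: cross u v.
  by apply: (perp_cross c0 (mulmx_neq0 Bu v0)); rewrite dB // bil_sym.
apply: uv; rewrite -(mulmxK Bu u) -(mulmxK Bu v) ea eb -!scalemxAl !pt_scale //.
Qed.

(** The Gram matrix of the three vectors has zero diagonal, so its determinant is twice the product
    of the three mutual values of [bil B], all nonzero. *)
Lemma isotropic_rows3_unit u v w : u != 0 -> v != 0 -> w != 0 ->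
  pt u <> pt v -> pt u <> pt w -> pt v <> pt w ->
  bil B u u = 0 -> bil B v v = 0 -> bil B w w = 0 -> rows3 u v w \in unitmx.
Proof.
move=> u0 v0 w0 uv uw vw Buu Bvv Bww.
have buv := isotropic_bil_neq0 u0 v0 uv Buu Bvv.
have buw := isotropic_bil_neq0 u0 w0 uw Buu Bww.
have bvw := isotropic_bil_neq0 v0 w0 vw Bvv Bww.
rewrite unitmxE unitfE; apply/negP => /det0P[x x0]; rewrite mul_rows3 => e.
set a := x 0 0 in e; set b := x 0 1 in e; set c := x 0 2%:R in e.
have E y : a * bil B u y + b * bil B v y + c * bil B w y = 0.
  by rewrite -!bilZl -!bilDl e bil0l.
have := E u; have := E v; have := E w.
rewrite Buu Bvv Bww (bil_sym v u sB) (bil_sym w u sB) (bil_sym w v sB) !mulr0 !add0r !addr0.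
move=> h1 h2 h3.
have two0 := two_neq0 k_char5.
have a0 : a = 0.
  apply: (mulfI two0); apply: (mulfI buv); apply: (mulfI buw).
  transitivity (bil B u v * (a * bil B u w + b * bil B v w)
     + bil B u w * (a * bil B u v + c * bil B v w)
     - bil B v w * (b * bil B u v + c * bil B u w)); first by ring.
  by rewrite h1 h2 h3; ring.
move: h1 h2; rewrite a0 !mul0r !add0r => /eqP; rewrite mulf_eq0 (negPf bvw) orbF => /eqP b0.
move=> /eqP; rewrite mulf_eq0 (negPf bvw) orbF => /eqP c0.
by case/eqP: x0; apply/rowP; elim/ord3_ind; rewrite mxE.
Qed.

(** For a conic through the three coordinate points the equation is linear in the standard Cremona
    transform of [x]: such conics become lines. *)
Lemma zero_diag_bil x : B 0 0 = 0 -> B 1 1 = 0 -> B 2%:R 2%:R = 0 ->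
  bil B x x = 2%:R * dot (row3 (B 1 2%:R) (B 0 2%:R) (B 0 1))
    (row3 (x 0 1 * x 0 2%:R) (x 0 0 * x 0 2%:R) (x 0 0 * x 0 1)).
Proof.
move=> e0 e1 e2; rewrite bilE !big_ord3 dotE !row3E e0 e1 e2.
have s i j : B i j = B j i by rewrite -{1}sB mxE.
by rewrite (s 1 0) (s 2%:R 0) (s 2%:R 1); ring.
Qed.

End Isotropic.

(** Three of the points are taken as frame. After the Cremona transformation both conics become
    lines through the images of the other two points, and these images are distinct. *)
Lemma conic5_unique B C v1 v2 v3 v4 v5 : B^T = B -> C^T = C -> B \in unitmx ->
  uniq [:: pt v1; pt v2; pt v3; pt v4; pt v5] ->
  (forall v, v \in [:: v1; v2; v3; v4; v5] -> [/\ v != 0, bil B v v = 0 & bil C v v = 0]) ->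
  exists c, C = c *: B.
Proof.
move=> sB sC Bu uq H.
have [n1 b1 c1] : [/\ v1 != 0, bil B v1 v1 = 0 & bil C v1 v1 = 0]
  by apply: H; rewrite !inE eqxx.
have [n2 b2 c2] : [/\ v2 != 0, bil B v2 v2 = 0 & bil C v2 v2 = 0]
  by apply: H; rewrite !inE eqxx !orbT.
have [n3 b3 c3] : [/\ v3 != 0, bil B v3 v3 = 0 & bil C v3 v3 = 0]
  by apply: H; rewrite !inE eqxx !orbT.
have [n4 b4 c4] : [/\ v4 != 0, bil B v4 v4 = 0 & bil C v4 v4 = 0]
  by apply: H; rewrite !inE eqxx !orbT.
have [n5 b5 c5] : [/\ v5 != 0, bil B v5 v5 = 0 & bil C v5 v5 = 0]
  by apply: H; rewrite !inE eqxx !orbT.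
have [u12 [u13 [u14 [u15 [u23 [u24 [u25 [u34 [u35 u45]]]]]]]]] := uniq5 uq.
pose P := rows3 v1 v2 v3.
have Pu : P \in unitmx by apply: (isotropic_rows3_unit sB Bu).
have gram M i j : (P *m M *m P^T) i j = bil M (row i P) (row j P) by rewrite gram_entry.
set B' := P *m B *m P^T; set C' := P *m C *m P^T.
have sB' : B'^T = B' by rewrite /B' !trmx_mul trmxK sB mulmxA.
have sC' : C'^T = C' by rewrite /C' !trmx_mul trmxK sC mulmxA.
have [B0 B1 B2] : [/\ B' 0 0 = 0, B' 1 1 = 0 & B' 2%:R 2%:R = 0].
  by rewrite !gram !rows3E.
have [C0 C1 C2] : [/\ C' 0 0 = 0, C' 1 1 = 0 & C' 2%:R 2%:R = 0].
  by rewrite !gram !rows3E.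
have two0 := two_neq0 k_char5.
pose inv (x : 'rV[k]_3) := row3 (x 0 1 * x 0 2%:R) (x 0 0 * x 0 2%:R) (x 0 0 * x 0 1).
pose off (M : 'M[k]_3) : 'rV[k]_3 := row3 (M 1 2%:R) (M 0 2%:R) (M 0 1).
have perp M v : M^T = M -> (P *m M *m P^T) 0 0 = 0 -> (P *m M *m P^T) 1 1 = 0 ->
    (P *m M *m P^T) 2%:R 2%:R = 0 ->
    bil M v v = 0 -> dot (inv (v *m invmx P)) (off (P *m M *m P^T)) = 0.
  move=> sM e0 e1 e2 Mv; apply: (mulfI two0); rewrite mulr0 dotC -zero_diag_bil //.
    by rewrite bil_conj mulmxKV.
  by rewrite !trmx_mul trmxK sM mulmxA.
have B01 : B' 0 1 != 0 by rewrite gram !rows3E; apply: isotropic_bil_neq0.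
have B02 : B' 0 2%:R != 0 by rewrite gram !rows3E; apply: isotropic_bil_neq0.
have B12 : B' 1 2%:R != 0 by rewrite gram !rows3E; apply: isotropic_bil_neq0.
have offB : off B' != 0 by apply/rV0Pn; exists 0; rewrite row3E.
(* A further point of the conic lies off the sides of the triangle: one zero coordinate forces a
   second one, and the point would be a vertex. *)
have coord v : v != 0 -> bil B v v = 0 -> pt v1 <> pt v -> pt v2 <> pt v -> pt v3 <> pt v ->
   [/\ (v *m invmx P) 0 0 != 0, (v *m invmx P) 0 1 != 0 & (v *m invmx P) 0 2%:R != 0].
  move=> v0 bv p1 p2 p3.
  set z := v *m invmx P.
  have ev : v = z 0 0 *: v1 + z 0 1 *: v2 + z 0 2%:R *: v3.
    by rewrite -mul_rows3 mulmxKV.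
  have := perp B v sB B0 B1 B2 bv; rewrite dotE !row3E -/z => hz.
  have nz (a : k) vi : v = a *: vi -> pt vi <> pt v -> False.
    move=> e; apply; rewrite e pt_scale //.
    by apply: contraNneq v0 => a0; rewrite e a0 scale0r.
  split; apply/eqP => z0; move: hz ev; rewrite z0 ?(mul0r, mulr0, add0r, addr0, scale0r) => /eqP;
    rewrite !mulf_eq0 ?(negPf B12) ?(negPf B01) ?(negPf B02) orbF => /orP[]/eqP ->;
    rewrite scale0r ?add0r ?addr0 => /nz; by apply.
have [x0 x1 x2] := coord v4 n4 b4 u14 u24 u34.
have [y0 y1 y2] := coord v5 n5 b5 u15 u25 u35.
have px := perp B v4 sB B0 B1 B2 b4; have py := perp B v5 sB B0 B1 B2 b5.
have qx := perp C v4 sC C0 C1 C2 c4; have qy := perp C v5 sC C0 C1 C2 c5.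
rewrite -/B' -/C' in px py qx qy.
set x := v4 *m invmx P in px qx x0 x1 x2; set y := v5 *m invmx P in py qy y0 y1 y2.
have ix : inv x != 0 by apply/rV0Pn; exists 0; rewrite row3E mulf_neq0.
have iy : inv y != 0 by apply/rV0Pn; exists 0; rewrite row3E mulf_neq0.
(* Off the sides of the triangle the Cremona transformation is injective. *)
have cxy : cross (inv x) (inv y) != 0.
  apply/eqP => /(cross_eq0 ix iy)[c c0 /rowP e].
  move: (e 0) (e 1) (e 2%:R); rewrite !scale_rowE /inv !row3E => e0 e1 e2.
  apply: u45; have -> : v4 = x *m P by rewrite mulmxKV.
  have -> : v5 = y *m P by rewrite mulmxKV.
  have [d d0 ->] : exists2 d, d != 0 & x = d *: y; last by rewrite -scalemxAl pt_scale.
  have xn : x != 0 by apply/rV0Pn; exists 0.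
  have yn : y != 0 by apply/rV0Pn; exists 0.
  have z01 : x 0 0 * y 0 1 = x 0 1 * y 0 0.
    apply: (mulfI (mulf_neq0 c0 y2)).
    transitivity (x 0 0 * (c * (y 0 1 * y 0 2%:R))); first by ring.
    rewrite -e0; transitivity (x 0 1 * (x 0 0 * x 0 2%:R)); first by ring.
    by rewrite e1; ring.
  have z02 : x 0 0 * y 0 2%:R = x 0 2%:R * y 0 0.
    apply: (mulfI (mulf_neq0 c0 y1)).
    transitivity (x 0 0 * (c * (y 0 1 * y 0 2%:R))); first by ring.
    rewrite -e0; transitivity (x 0 2%:R * (x 0 0 * x 0 1)); first by ring.
    by rewrite e2; ring.
  have z12 : x 0 1 * y 0 2%:R = x 0 2%:R * y 0 1.
    apply: (mulfI (mulf_neq0 c0 y0)).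
    transitivity (x 0 1 * (c * (y 0 0 * y 0 2%:R))); first by ring.
    rewrite -e1; transitivity (x 0 2%:R * (x 0 0 * x 0 1)); first by ring.
    by rewrite e2; ring.
  apply: minors_proportional => // i j.
  by elim/ord3_ind: i; elim/ord3_ind: j.
have [b b0 eb] := perp_cross cxy offB px py.
have [d ed] : exists d, off C' = d *: off B'.
  have [->|offC] := eqVneq (off C') 0; first by exists 0; rewrite scale0r.
  have [c c0 ec] := perp_cross cxy offC qx qy.
  by exists (c / b); rewrite ec eb scalerA divfK.
exists d; have eC' : C' = d *: B'.
  move/rowP: ed => ed; move: (ed 0) (ed 1) (ed 2%:R); rewrite !scale_rowE /off !row3E.
  move=> d0 d1 d2.
  have tB i j : B' i j = B' j i by rewrite -{1}sB' mxE.
  have tC i j : C' i j = C' j i by rewrite -{1}sC' mxE.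
  apply/matrixP => i j; rewrite [RHS]mxE.
  elim/ord3_ind: i; elim/ord3_ind: j => //; rewrite ?B0 ?B1 ?B2 ?C0 ?C1 ?C2 ?mulr0 //;
    by rewrite tC tB.
have : invmx P *m C' *m (invmx P)^T = d *: (invmx P *m B' *m (invmx P)^T).
  by rewrite eC' -scalemxAr -scalemxAl.
have inv_conj M : invmx P *m (P *m M *m P^T) *m (invmx P)^T = M.
  by rewrite trmx_inv !mulmxA mulVmx // mul1mx mulmxK // unitmx_tr.
by rewrite !inv_conj.
Qed.

End Classification.

(** * Transitivity of PGU on the totally tangent conics *)

Section Transitivity.
Local Open Scope ring_scope.
Local Open Scope card_scope.
Local Open Scope classical_set_scope.
Variable k : closedFieldType.
Hypothesis k_char5 : 5%N \in [pchar k].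
Implicit Types (u v w x y : 'rV[k]_3) (A B C : 'M[k]_3) (Q : set (ppoint k)).
Local Notation bar := (bar k_char5).
Local Notation unitary := (unitary k_char5).

Lemma bar_bil B u v : bil (bar B) (bar u) (bar v) = bil B u v ^+ 5.
Proof. by rewrite /bil -barM -bar_tr -barM barE. Qed.

(* For a contact point [v] the tangent lines of the conic and of Gamma agree, so
   [bar v] is proportional to [v B]; hence [B (bar B) B] vanishes at all six
   contact points and is proportional to [B]. *)
Lemma totally_tangent_hermitian Q : totally_tangent_conics Q -> exists B,
  [/\ B^T = B, B *m bar B = 1%:M, Q = conic B &
      forall p, (Q `&` Gamma) p -> exists v, [/\ v != 0, p = pt v & bar v = v *m B]].
Proof.
move=> /(totally_tangentP k_char5)[B [sB Bu -> c6 hm]].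
have tan p : (conic B `&` Gamma) p -> exists v c,
    [/\ v != 0, p = pt v, bil B v v = 0, c != 0 & bar v = c *: (v *m B)].
  move=> hp; have [Qp Gp] := hp; have [v v0 ep] := ptP p.
  have := hm p hp; rewrite ep in Qp Gp * => m2.
  have [c c0 e] := mult2_tangent k_char5 sB Bu v0 Qp Gp m2.
  by exists v, c; split=> //; apply/conic_pt.
have /card_seqP[s [us ss hs]] := c6.
have tan' p : p \in s -> exists v, [/\ v != 0, p = pt v, bil B v v = 0 &
    bil (B *m bar B *m B) v v = 0].
  move/hs/tan => [v [c [v0 ep Bv c0 e]]]; exists v; split=> //.
  have : bil (bar B) (bar v) (bar v) = 0 by rewrite bar_bil Bv expr0n.
  rewrite e bilZl bilZr => /eqP; rewrite !mulf_eq0 (negPf c0) /= => /eqP <-.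
  by rewrite /bil trmx_mul sB !mulmxA.
case: s us ss hs tan' => [|p1 [|p2 [|p3 [|p4 [|p5 [|p6 [|]]]]]]] // us _ hs tan'.
have [v1 [n1 e1 b1 c1]] : _ := tan' p1 (mem_nth p1 (isT : 0 < size [:: p1; p2; p3; p4; p5; p6])%N).
have [v2 [n2 e2 b2 c2]] : _ := tan' p2 (mem_nth p1 (isT : 1 < size [:: p1; p2; p3; p4; p5; p6])%N).
have [v3 [n3 e3 b3 c3]] : _ := tan' p3 (mem_nth p1 (isT : 2 < size [:: p1; p2; p3; p4; p5; p6])%N).
have [v4 [n4 e4 b4 c4]] : _ := tan' p4 (mem_nth p1 (isT : 3 < size [:: p1; p2; p3; p4; p5; p6])%N).
have [v5 [n5 e5 b5 c5]] : _ := tan' p5 (mem_nth p1 (isT : 4 < size [:: p1; p2; p3; p4; p5; p6])%N).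
have u5 : uniq [:: pt v1; pt v2; pt v3; pt v4; pt v5].
  by have := take_uniq 5 us; rewrite e1 e2 e3 e4 e5.
have sC : (B *m bar B *m B)^T = B *m bar B *m B.
  by rewrite !trmx_mul sB -bar_tr sB mulmxA.
have [l el] : exists l, B *m bar B *m B = l *: B.
  apply: (conic5_unique k_char5 sB sC Bu u5) => v.
  by rewrite !in_cons in_nil orbF => /or4P[||| /orP[]] /eqP ->.
have eBB : B *m bar B = l%:M.
  by rewrite -(mulmxK Bu (B *m bar B)) el -scalemxAl mulmxV // scalemx1.
have l0 : l != 0.
  apply/eqP => l0; have : B *m bar B \in unitmx by rewrite unitmx_mul bar_unit Bu.
  by rewrite eBB l0 unitmxE det_scalar expr0n unitr0.
(* Scaling [B] by [m] multiplies [B (bar B)] by [m ^+ 6]. *)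
have [m m0 em] := nth_root_neq0 (n := 6) (invr_neq0 l0) isT.
exists (m *: B); split.
- by rewrite linearZ /= sB.
- rewrite barZ -scalemxAl -scalemxAr scalerA -exprS em eBB scale_scalar_mx.
  by rewrite mulVf.
- by rewrite conic_scale.
move=> p hp; have [v [c [v0 -> Bv c0 e]]] := tan p hp.
(* Scaling [v] by [t] multiplies [bar v] by [t ^+ 5] and [v B] by [t], so a fourth root absorbs the
   remaining factor. *)
have [t t0 et] := nth_root_neq0 (n := 4) (mulf_neq0 m0 (invr_neq0 c0)) isT.
exists (t *: v); split; rewrite ?scaler_eq0 ?negb_or ?t0 ?pt_scale //.
rewrite barZ e -scalemxAl -scalemxAr !scalerA exprSr et.
by congr (_ *: _); rewrite mulrAC divfK // mulrC.
Qed.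

Definition Q0 : set (ppoint k) := conic 1%:M.

Lemma totally_tangent_Q0 Q : totally_tangent_conics Q ->
  exists2 g, PGU g & Q = set_act Q0 g.
Proof.
move=> tQ; have [B [sB BB eQ hB]] := totally_tangent_hermitian tQ.
have Bu : B \in unitmx by case/mulmx1_unit: BB.
have [_ [_ _ _ c6 _]] := tQ; have /card_seqP[s [us ss hs]] := c6.
have hv p : p \in s -> exists v, [/\ v != 0, p = pt v, bil B v v = 0 & bar v = v *m B].
  move=> ps; have hp := (hs p).2 ps; have [v [v0 ep bv]] := hB p hp.
  by exists v; split=> //; apply/(conic_pt _ v0); rewrite -eQ -ep; case: hp.
case: s us ss hs hv => [|p1 [|p2 [|p3 [|p4 [|p5 [|p6 [|]]]]]]] // us _ hs hv.
have [v1 [n1 e1 i1 h1]] : _ := hv p1 (mem_nth p1 (isT : 0 < size [:: p1; p2; p3; p4; p5; p6])%N).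
have [v2 [n2 e2 i2 h2]] : _ := hv p2 (mem_nth p1 (isT : 1 < size [:: p1; p2; p3; p4; p5; p6])%N).
have [v3 [n3 e3 i3 h3]] : _ := hv p3 (mem_nth p1 (isT : 2 < size [:: p1; p2; p3; p4; p5; p6])%N).
have [u12 [u13 [_ [_ [u23 _]]]]] := uniq5 (take_uniq 5 us).
rewrite e1 e2 e3 in u12 u13 u23.
(* On contact vectors the form takes values in F_5: its conjugate is [u B (bar B) B v^T], where
   [B (bar B) = 1]. *)
have real u v : bar u = u *m B -> bar v = v *m B -> bil B u v ^+ 5 = bil B u v.
  move=> hu hv'; rewrite -bar_bil hu hv' /bil trmx_mul sB -!mulmxA (mulmxA B) BB mul1mx.
  by rewrite !mulmxA.
have a0 := isotropic_bil_neq0 sB Bu n1 n2 u12 i1 i2.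
have b0 := isotropic_bil_neq0 sB Bu n1 n3 u13 i1 i3.
have c0 := isotropic_bil_neq0 sB Bu n2 n3 u23 i2 i3.
have aR := real _ _ h1 h2; have bR := real _ _ h1 h3; have cR := real _ _ h2 h3.
set a := bil B v1 v2 in a0 aR; set b := bil B v1 v3 in b0 bR; set c := bil B v2 v3 in c0 cR.
(* After scaling, the Gram matrix of the three vectors is [m] times that of the
   form 2(xy + xz + yz), which is diagonalised over F_5. *)
pose m := a * b * c.
pose y1 : 'rV[k]_3 := c *: v1; pose y2 : 'rV[k]_3 := b *: v2.
pose y3 : 'rV[k]_3 := a *: v3.
have barD u v : bar (u + v) = bar u + bar v by rewrite /bar map_mxD.
have barN u : bar (- u) = - bar u by rewrite /bar map_mxN.
have hy1 : bar y1 = y1 *m B by rewrite barZ cR h1 scalemxAl.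
have hy2 : bar y2 = y2 *m B by rewrite barZ bR h2 scalemxAl.
have hy3 : bar y3 = y3 *m B by rewrite barZ aR h3 scalemxAl.
have g12 : bil B y1 y2 = m by rewrite bilZl bilZr -/a /m; ring.
have g13 : bil B y1 y3 = m by rewrite bilZl bilZr -/b /m; ring.
have g23 : bil B y2 y3 = m by rewrite bilZl bilZr -/c /m; ring.
have g21 : bil B y2 y1 = m by rewrite bil_sym.
have g31 : bil B y3 y1 = m by rewrite bil_sym.
have g32 : bil B y3 y2 = m by rewrite bil_sym.
have g11 : bil B y1 y1 = 0 by rewrite bilZl bilZr i1 !mulr0.
have g22 : bil B y2 y2 = 0 by rewrite bilZl bilZr i2 !mulr0.
have g33 : bil B y3 y3 = 0 by rewrite bilZl bilZr i3 !mulr0.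
have m0 : 3%:R * m != 0 by rewrite !mulf_neq0 // natr_neq0.
clearbody y1 y2 y3 m.
(* An orthogonal basis whose norms [8 m], [- 2 m] and [- 2 m] coincide in characteristic 5. *)
pose r1 := (- 2%:R) *: y1 + (- 2%:R) *: y2.
pose r2 := y3 - y1 - y2.
pose r3 := y2 - y1.
pose G := rows3 r1 r2 r3.
have two5 : (- 2%:R : k) ^+ 5 = - 2%:R.
  by rewrite -(pFrobenius_autE k_char5) rmorphN rmorph_nat.
have hG : bar G = G *m B.
  rewrite bar_rows3 mul_rows3_row; congr rows3.
  - by rewrite /r1 barD !(barZ _ (- 2%:R)) hy1 hy2 two5 mulmxDl -!(scalemxAl (- 2%:R)).
  - by rewrite !barD !barN hy1 hy2 hy3 !mulmxBl.
  by rewrite barD barN hy1 hy2 mulmxBl.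
have bilN u v : bil B (- u) v = - bil B u v by rewrite -scaleN1r bilZl mulN1r.
have bilNr u v : bil B u (- v) = - bil B u v by rewrite -scaleN1r bilZr mulN1r.
have five := natr5 k_char5.
have GBG : G *m B *m G^T = (3%:R * m)%:M.
  have E := (bilDl, bilDr, bilN, bilNr, bilZl, bilZr, g11, g12, g13, g21, g22, g23, g31, g32, g33).
  apply/matrixP => i j; rewrite gram_entry mxE.
  have five0 (z : k) : 5%:R * z = 0 by rewrite five mul0r.
  elim/ord3_ind: i; elim/ord3_ind: j; rewrite !rows3E /= ?mulr1n ?mulr0n /r1 /r2 /r3 !E;
    apply/eqP; rewrite -subr_eq0; apply/eqP.
  - by rewrite -[RHS](five0 m); ring.
  - by ring.
  - by ring.
  - by ring.
  - by rewrite -[RHS](five0 (- m)); ring.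
  - by ring.
  - by ring.
  - by ring.
  by rewrite -[RHS](five0 (- m)); ring.
have [t t0 et] := nth_root_neq0 (n := 6) (invr_neq0 m0) isT.
(* Since the rows of [G] have coefficients in F_5, [bar G = G B], and [G (bar G)^T] is their Gram
   matrix, a scalar. *)
have uG : unitary (t *: G).
  suff : t *: G *m (bar (t *: G))^T = 1%:M by [].
  rewrite barZ hG linearZ /= -scalemxAl -scalemxAr scalerA -exprS et.
  by rewrite trmx_mul sB mulmxA GBG scale_scalar_mx mulVf.
have tGu := unitary_unit uG.
have Gu : G \in unitmx by move: tGu; rewrite unitmxZ // unitfE.
exists (pgl (t *: G)); first exact: (PGU_unitary uG).
rewrite pgl_scale // eQ -(conic_act B Gu) GBG -scalemx1 conic_scale //.
Qed.

End Transitivity.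

(** * Neighbours of a conic *)

Section Neighbours.
Local Open Scope ring_scope.
Local Open Scope card_scope.
Local Open Scope classical_set_scope.
Variable k : closedFieldType.
Hypothesis k_char5 : 5%N \in [pchar k].
Implicit Types (u v w x y n : 'rV[k]_3) (A B C : 'M[k]_3) (Q : set (ppoint k)).
Local Notation bar := (bar k_char5).

(** Both [v B] and [bar v] lie on the conic of [bar B], and they are conjugate for it because
    [v B (bar B) (bar v)^T = v (bar v)^T = 0]. By [isotropic_bil_neq0] they are the same point. *)
Lemma hermitian_point B p : B^T = B -> B *m bar B = 1%:M ->
  conic B p -> Gamma p -> exists v, [/\ v != 0, p = pt v, bil B v v = 0 & bar v = v *m B].
Proof.
move=> sB BB; have [v v0 ->] := ptP p => /(conic_pt _ v0) Bv /(Gamma_bar k_char5 v0) Gv.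
have Bu : B \in unitmx by case/mulmx1_unit: BB.
have sbB : (bar B)^T = bar B by rewrite -bar_tr sB.
have bv0 : bar v != 0 by rewrite bar_eq0.
have vB0 := mulmx_neq0 Bu v0.
have [c c0 e] : exists2 c, c != 0 & bar v = c *: (v *m B).
  apply: pt_eqP => //; apply: contrapT => ne.
  have := isotropic_bil_neq0 sbB _ vB0 bv0 (nesym ne).
  rewrite bar_unit bar_bil Bv expr0n => /(_ Bu); rewrite /bil.
  rewrite trmx_mul sB -!mulmxA (mulmxA B (bar B) (bar v)^T) BB mul1mx.
  rewrite [B *m (bar B *m (B *m v^T))]mulmxA BB mul1mx mulmxA -/(bil B v v) Gv eqxx.
  by move=> /(_ Bv erefl).
have [t t0 et] := nth_root_neq0 (n := 4) (invr_neq0 c0) isT.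
exists (t *: v); split; rewrite ?scaler_eq0 ?negb_or ?t0 ?pt_scale //.
  by rewrite bilZl bilZr Bv !mulr0.
by rewrite barZ e -scalemxAl scalerA exprSr et mulrAC mulVf // mul1r.
Qed.

Lemma conic_inj B C : B^T = B -> C^T = C -> B \in unitmx ->
  totally_tangent_conics (conic B) -> conic B = conic C -> exists c, C = c *: B.
Proof.
move=> sB sC Bu [_ [_ _ _ c6 _]] e; have /card_seqP[s [us ss hs]] := c6.
have hv p : p \in s -> exists v, [/\ v != 0, p = pt v, bil B v v = 0 & bil C v v = 0].
  move=> /hs[Bp _]; have Cp : conic C p by rewrite -e.
  by have [v v0 ep] := ptP p; exists v; split; rewrite // -?conic_pt // -ep.
case: s us ss hs hv => [|p1 [|p2 [|p3 [|p4 [|p5 [|p6 [|]]]]]]] // us _ hs hv.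
have [v1 [n1 e1 b1 c1]] : _ := hv p1 (mem_nth p1 (isT : 0 < size [:: p1; p2; p3; p4; p5; p6])%N).
have [v2 [n2 e2 b2 c2]] : _ := hv p2 (mem_nth p1 (isT : 1 < size [:: p1; p2; p3; p4; p5; p6])%N).
have [v3 [n3 e3 b3 c3]] : _ := hv p3 (mem_nth p1 (isT : 2 < size [:: p1; p2; p3; p4; p5; p6])%N).
have [v4 [n4 e4 b4 c4]] : _ := hv p4 (mem_nth p1 (isT : 3 < size [:: p1; p2; p3; p4; p5; p6])%N).
have [v5 [n5 e5 b5 c5]] : _ := hv p5 (mem_nth p1 (isT : 4 < size [:: p1; p2; p3; p4; p5; p6])%N).
have u5 : uniq [:: pt v1; pt v2; pt v3; pt v4; pt v5].
  by have := take_uniq 5 us; rewrite e1 e2 e3 e4 e5.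
apply: (conic5_unique k_char5 sB sC Bu u5) => v.
by rewrite !in_cons in_nil orbF => /or4P[||| /orP[]] /eqP ->.
Qed.

Lemma dot_cross u v x y :
  dot (cross u v) (cross x y) = dot u x * dot v y - dot u y * dot v x.
Proof. by rewrite !dotE !row3E; ring. Qed.

(** The determinant, written out so that [ring] proves [cross_mulmx]. *)
Definition det3 (M : 'M[k]_3) : k :=
  M 0 0 * (M 1 1 * M 2%:R 2%:R - M 1 2%:R * M 2%:R 1)
  - M 0 1 * (M 1 0 * M 2%:R 2%:R - M 1 2%:R * M 2%:R 0)
  + M 0 2%:R * (M 1 0 * M 2%:R 1 - M 1 1 * M 2%:R 0).

Lemma mulmx3E u (M : 'M[k]_3) i :
  (u *m M) 0 i = u 0 0 * M 0 i + u 0 1 * M 1 i + u 0 2%:R * M 2%:R i.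
Proof. by rewrite mxE big_ord3. Qed.

Lemma cross_mulmx u v (M : 'M[k]_3) :
  cross (u *m M) (v *m M) *m M^T = det3 M *: cross u v.
Proof.
apply/rowP; elim/ord3_ind; rewrite mulmx3E scale_rowE !row3E !mulmx3E !mxE /det3; ring.
Qed.

Lemma bar_row3 a b c : bar (row3 a b c) = row3 (a ^+ 5) (b ^+ 5) (c ^+ 5).
Proof. by apply/rowP; elim/ord3_ind; rewrite barE !row3E. Qed.

Lemma bar_cross u v : bar (cross u v) = cross (bar u) (bar v).
Proof.
rewrite /cross bar_row3; congr row3;
  by rewrite -(pFrobenius_autE k_char5) rmorphB !rmorphM /= !pFrobenius_autE !barE.
Qed.

Lemma secant_hermitian B l : B^T = B -> B *m bar B = 1%:M -> secants (conic B) l ->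
  exists u v, [/\ cross u v != 0, l = mkline (cross u v), bar u = u *m B & bar v = v *m B]
   /\ [/\ bil B u u = 0, bil B v v = 0, bil B u v != 0 & bil B u v ^+ 5 = bil B u v].
Proof.
move=> sB BB [_ [p [p' [[Bp Gp] [Bp' Gp'] pp' pl pl']]]].
have Bu : B \in unitmx by case/mulmx1_unit: BB.
have [u [u0 eu Buu hu]] := hermitian_point sB BB Bp Gp.
have [v [v0 ev Bvv hv]] := hermitian_point sB BB Bp' Gp'.
rewrite eu ev in pp' pl pl'.
have c0 := pt_neq_cross u0 v0 pp'.
exists u, v; split; split=> //.
- have [n n0 el] := lineP l; rewrite el in pl pl' *.
  move/(on_mkline u0 n0): pl => un; move/(on_mkline v0 n0): pl' => vn.
  have [c c_0 ->] := perp_cross c0 n0 un vn.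
  by rewrite mkline_scale.
- exact: isotropic_bil_neq0.
rewrite -(bar_bil k_char5) hu hv /bil trmx_mul sB -!mulmxA (mulmxA B (bar B)) BB mul1mx.
by rewrite !mulmxA.
Qed.

Lemma pow4_1 (x : k) : x != 0 -> x ^+ 5 = x -> x ^+ 4 = 1.
Proof. by move=> x0 e; apply: (mulfI x0); rewrite -exprS e mulr1. Qed.

Lemma bil1 u v : bil 1%:M u v = dot u v.
Proof. by rewrite /bil mulmx1. Qed.

(* Contact points satisfy [bar u = u B], so the secant [n = cross u v] satisfies
   [(bar n) B = (det B) n]; a secant of [Q0] is real up to a scalar, hence a common
   secant is an eigenvector of [B]. *)
Lemma common_secant B l : B^T = B -> B *m bar B = 1%:M ->
  secants (@Q0 k) l -> secants (conic B) l ->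
  exists n b, [/\ n != 0, l = mkline n, bar n = n & dot n n = 1]
    /\ [/\ n *m B = b *: n, b != 0 & b ^+ 3 = det3 B ^+ 3].
Proof.
move=> sB BB s0 sl.
have [u [v [[uv0 el hu hv] [uu vv duv dR]]]] : _ :=
  secant_hermitian (trmx1 _ _) (etrans (congr1 (mulmx _) (bar1 k_char5 3)) (mulmx1 _)) s0.
rewrite mulmx1 in hu; rewrite mulmx1 in hv; rewrite !bil1 in uu vv duv dR.
have [r [r' [[rr0 el' hr hr'] [rr r'r' drr drR]]]] := secant_hermitian sB BB sl.
have five := natr5 k_char5.
have two0 := two_neq0 k_char5.
set d := dot u v in duv dR.
have d4 := pow4_1 duv dR.
(* The square of [cross u v] is [- d ^+ 2], which is [(2 d) ^+ 2] in characteristic 5. This scaling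
   makes [n] a unit vector, still real because [d] lies in F_5. *)
pose e := (2%:R * d)^-1.
have e0 : e != 0 by rewrite invr_eq0 mulf_neq0.
pose n := e *: cross u v.
have n0 : n != 0 by rewrite scaler_eq0 negb_or e0.
have ln : l = mkline n by rewrite mkline_scale.
have two5 : 2%:R ^+ 5 = 2%:R :> k by rewrite -(pFrobenius_autE k_char5) rmorph_nat.
have bn : bar n = n.
  by rewrite barZ bar_cross hu hv; congr (_ *: _); rewrite exprVn exprMn dR two5.
have nn : dot n n = 1.
  rewrite dotZl dotZr dot_cross uu vv (dotC v u) -/d.
  transitivity (e * e * ((2%:R * d) ^+ 2 - 5%:R * d ^+ 2)); first by ring.
  by rewrite five mul0r subr0 /e expr2 mulrACA mulVf ?mulf_neq0 // mulr1.
have [c c0 ec] := mkline_inj rr0 n0 (etrans (esym el') ln).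
have Bu : B \in unitmx by case/mulmx1_unit: BB.
have c5 : bar (cross r r') = c ^+ 5 *: n by rewrite ec barZ bn.
have rc : bar (cross r r') *m B = det3 B *: cross r r'.
  by rewrite bar_cross hr hr' -[X in _ *m X]sB cross_mulmx.
have c50 : c ^+ 5 != 0 by rewrite expf_neq0.
exists n, (det3 B / c ^+ 4); split; split=> //.
- apply: (scalerI c50); rewrite scalemxAl -c5 rc ec !scalerA; congr (_ *: _).
  by field.
- apply/eqP => b0; have : n *m B != 0 by apply: mulmx_neq0.
  have -> : n *m B = 0; last by rewrite eqxx.
  apply: (scalerI c50); rewrite scalemxAl -c5 rc scaler0.
  move/eqP: b0; rewrite mulf_eq0 invr_eq0 (negPf (expf_neq0 _ c0)) orbF => /eqP ->.
  by rewrite scale0r.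
(* As [c ^+ 6] is minus the square of an element of F_5, the eigenvalues [det3 B / c ^+ 4] of all
   common secants have the same cube. *)
have c12 : c ^+ 12 = 1.
  have c6 : c ^+ 6 = - bil B r r' ^+ 2.
    transitivity (dot (cross r r') (bar (cross r r'))).
      by rewrite c5 ec dotZl dotZr nn mulr1 exprS.
    rewrite bar_cross hr hr' dot_cross.
    have dB x y : dot x (y *m B) = bil B x y by rewrite /dot trmx_mul sB mulmxA.
    by rewrite !dB rr mul0r sub0r (bil_sym r' r sB) expr2.
  rewrite (_ : 12 = 6 * 2)%N // exprM c6 sqrrN -exprM.
  exact: pow4_1.
by rewrite expr_div_n -exprM c12 divr1.
Qed.

End Neighbours.

(** * Normal form of the neighbours *)

Section NeighbourForm.
Local Open Scope ring_scope.
Local Open Scope card_scope.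
Local Open Scope classical_set_scope.
Variable k : closedFieldType.
Hypothesis k_char5 : 5%N \in [pchar k].
Implicit Types (u v w x y n : 'rV[k]_3) (A B C N : 'M[k]_3) (Q : set (ppoint k)).
Local Notation bar := (bar k_char5).
Local Notation Q0 := (@Q0 k).

Lemma dotBl u v n : dot (u - v) n = dot u n - dot v n.
Proof. by rewrite dotDl -scaleN1r dotZl mulN1r. Qed.

(** The matrix [B - b] kills [n1] and [n2], so it is symmetric of rank one and its form is a
    multiple of the square of [dot v (cross n1 n2)]: the pencil of the two conics contains a double
    line. *)
Lemma two_eigenvectors B n1 n2 b : B^T = B -> cross n1 n2 != 0 -> B != b%:M ->
  n1 *m B = b *: n1 -> n2 *m B = b *: n2 ->
  forall v, bil B v v = 0 -> dot v v = 0 -> dot v (cross n1 n2) = 0.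
Proof.
move=> sB c0 Bb e1 e2 v Bv vv.
pose C := B - b%:M.
have sC : C^T = C by rewrite linearB /= tr_scalar_mx sB.
have C1 : n1 *m C = 0 by rewrite mulmxBr e1 mul_mx_scalar subrr.
have C2 : n2 *m C = 0 by rewrite mulmxBr e2 mul_mx_scalar subrr.
have perpC x : exists c, x *m C = c *: cross n1 n2.
  have [->|xC0] := eqVneq (x *m C) 0; first by exists 0; rewrite scale0r.
  have [||c _ ec] := perp_cross c0 xC0.
  - by rewrite dotC /dot -mulmxA -[C]trmxK -trmx_mul sC C1 trmx0 mulmx0 mxE.
  - by rewrite dotC /dot -mulmxA -[C]trmxK -trmx_mul sC C2 trmx0 mulmx0 mxE.
  by exists c.
have [x xC0] : exists x, x *m C != 0.
  apply: contrapT => H; case/eqP: Bb; apply/eqP; rewrite -subr_eq0; apply/eqP.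
  apply/row_matrixP => i; rewrite rowE row0; apply: contrapT => /eqP xi.
  by apply: H; exists (delta_mx 0 i).
have [c ec] := perpC x; have [d ed] := perpC v.
have c_0 : c != 0 by apply: contraNneq xC0 => c_0; rewrite ec c_0 scale0r.
have bilC x1 x2 : dot x2 (x1 *m C) = bil C x1 x2 by rewrite dotC.
have vCv : bil C v v = 0.
  rewrite -bilC mulmxBr mul_mx_scalar dotC dotBl dotC.
  by rewrite dotZl vv mulr0 subr0 dotC.
have : d * dot v (cross n1 n2) = 0 by rewrite -vCv -bilC ed dotZr.
move/eqP; rewrite mulf_eq0 => /orP[/eqP d0|/eqP//].
apply: (mulfI c_0); rewrite mulr0 -dotZr -ec bilC bil_sym // -bilC ed d0 scale0r.
by rewrite dotC dot0l.
Qed.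

(** Three points of Q0 are independent by [isotropic_rows3_unit]. With [two_eigenvectors], the four
    common points of adjacent conics thus exclude a double eigenvalue. *)
Lemma three_points_line n (s : seq (ppoint k)) : n != 0 -> (3 <= size s)%N -> uniq s ->
  (forall p, p \in s -> exists v, [/\ v != 0, p = pt v, dot v v = 0 & dot v n = 0]) -> False.
Proof.
case: s => [|p1 [|p2 [|p3 s]]] // n0 _ us H.
have [v1 [a1 e1 i1 d1]] : _ := H p1 (mem_nth p1 (isT : 0 < size [:: p1, p2, p3 & s])%N).
have [v2 [a2 e2 i2 d2]] : _ := H p2 (mem_nth p1 (isT : 1 < size [:: p1, p2, p3 & s])%N).
have [v3 [a3 e3 i3 d3]] : _ := H p3 (mem_nth p1 (isT : 2 < size [:: p1, p2, p3 & s])%N).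
have [u12 [u13 u23]] : p1 <> p2 /\ p1 <> p3 /\ p2 <> p3.
  move: (take_uniq 3 us) => {H} /=; rewrite take0 !inE negb_or.
  by case/and3P => /andP[/eqP ? /eqP ?] /eqP ? _.
rewrite e1 e2 e3 in u12 u13 u23.
have Pu : rows3 v1 v2 v3 \in unitmx.
  by apply: (isotropic_rows3_unit k_char5 (trmx1 _ _) (unitmx1 _ _)); rewrite ?bil1.
have Pn : rows3 v1 v2 v3 *m n^T = 0.
  apply/row_matrixP => i; rewrite row_mul row0.
  by elim/ord3_ind: i; rewrite rows3E; apply/rowP => i; rewrite ord1 [RHS]mxE -/(dot _ _).
case/eqP: n0; apply: trmx_inj; rewrite trmx0 -(mulKmx Pu n^T) Pn mulmx0 //.
Qed.

Definition diag3 (a b c : k) : 'M[k]_3 := diag_mx (row3 a b c).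

Lemma mul_diag3 v a b c : v *m diag3 a b c = row3 (v 0 0 * a) (v 0 1 * b) (v 0 2%:R * c).
Proof. by apply/rowP => j; rewrite mul_mx_diag; elim/ord3_ind: j; rewrite !mxE. Qed.

Lemma diag3_mul_rows a b c u v w :
  diag3 a b c *m rows3 u v w = rows3 (a *: u) (b *: v) (c *: w).
Proof.
by apply/matrixP => i j; rewrite mul_diag_mx; elim/ord3_ind: i; rewrite !mxE.
Qed.

Lemma diag3_sym a b c : (diag3 a b c)^T = diag3 a b c.
Proof. exact: tr_diag_mx. Qed.

Section Omega.
Variables (z : k).
Hypothesis z_root : z ^+ 2 + z + 1 = 0.

Lemma omega3 : z ^+ 3 = 1.
Proof.
apply/eqP; rewrite -subr_eq0; apply/eqP.
transitivity ((z - 1) * (z ^+ 2 + z + 1)); first by ring.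
by rewrite z_root mulr0.
Qed.

Lemma cube_roots (x : k) : x ^+ 3 = 1 -> x != 1 -> x = z \/ x = z ^+ 2.
Proof.
move=> x3 x1; suff /eqP : (x - z) * (x - z ^+ 2) = 0.
  by rewrite mulf_eq0 !subr_eq0 => /orP[]/eqP; [left|right].
have e : x ^+ 2 + x + 1 = 0.
  have : (x - 1) * (x ^+ 2 + x + 1) = 0.
    by transitivity (x ^+ 3 - 1); [ring | rewrite x3 subrr].
  by move/eqP; rewrite mulf_eq0 subr_eq0 (negPf x1) => /eqP.
transitivity ((x ^+ 2 + x + 1) + (z ^+ 3 - 1) - x * (z ^+ 2 + z + 1)); first by ring.
by rewrite e z_root omega3; ring.
Qed.

(** The common secants give eigenvectors with distinct eigenvalues, hence orthogonal because [B] is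
    symmetric. Having equal cubes, the eigenvalues are [b1], [b1 z], [b1 z ^+ 2]; the rows of [N]
    are the eigenvectors in this order. *)
Lemma neighbour_form B : B^T = B -> B *m bar B = 1%:M -> adjacent Q0 (conic B) ->
  exists N c, [/\ bar N = N, N *m N^T = 1%:M, c != 0 &
    B = c *: (N^T *m diag3 1 z (z ^+ 2) *m N)].
Proof.
move=> sB BB [tQ tB neq c4 c3].
have /card_seqP[s [us ss hs]] := c3.
case: s us ss hs => [|l1 [|l2 [|l3 [|]]]] // us _ hs.
have [l12 [l13 l23]] : l1 <> l2 /\ l1 <> l3 /\ l2 <> l3.
  move: us => /=; rewrite !inE negb_or.
  by case/and3P => /andP[/eqP ? /eqP ?] /eqP ? _.
have cs l : l \in [:: l1; l2; l3] -> _ := fun h =>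
  let: conj a b := (hs l).2 h in common_secant sB BB a b.
have [n1 [b1 [[n10 e1 r1 u1] [m1 b10 q1]]]] : _ :=
  cs l1 (mem_nth l1 (isT : 0 < size [:: l1; l2; l3])%N).
have [n2 [b2 [[n20 e2 r2 u2] [m2 b20 q2]]]] : _ :=
  cs l2 (mem_nth l1 (isT : 1 < size [:: l1; l2; l3])%N).
have [n3 [b3 [[n30 e3 r3 u3] [m3 b30 q3]]]] : _ :=
  cs l3 (mem_nth l1 (isT : 2 < size [:: l1; l2; l3])%N).
rewrite {}e1 {}e2 {}e3 in l12 l13 l23.
have Bscal b : B != b%:M.
  apply/eqP => eB; apply: neq; rewrite eB -scalemx1 conic_scale //.
  apply/eqP => b0; have : B \in unitmx by case/mulmx1_unit: BB.
  by rewrite eB b0 unitmxE det_scalar expr0n unitr0.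
have crossn n m : n != 0 -> m != 0 -> mkline n <> mkline m -> cross n m != 0.
  move=> n0 m0 nm; apply/eqP => /(cross_eq0 n0 m0)[c c0 e].
  by apply: nm; rewrite e mkline_scale.
have dist n m b b' : n != 0 -> m != 0 -> mkline n <> mkline m ->
    n *m B = b *: n -> m *m B = b' *: m -> b != b'.
  move=> n0 m0 nm eb eb'; apply/eqP => ebb; rewrite -ebb in eb'.
  have c0 := crossn _ _ n0 m0 nm.
  have /card_seqP[s [us' ss hs']] := c4.
  apply: (three_points_line c0 _ us'); first by rewrite ss.
  move=> p /hs'[Qp Bp]; have [v v0 ep] := ptP p; exists v.
  rewrite ep in Qp Bp; move/(conic_pt _ v0): Qp; rewrite bil1 => vv.
  move/(conic_pt _ v0): Bp => Bv; split=> //.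
  exact: (two_eigenvectors sB c0 (Bscal b) eb eb').
have orth n m b b' : n *m B = b *: n -> m *m B = b' *: m -> b != b' -> dot n m = 0.
  move=> eb eb' bb; have : b * dot n m = b' * dot n m.
    by rewrite -dotZl -eb -dotZr -eb' /dot trmx_mul sB mulmxA.
  move/eqP; rewrite -subr_eq0 -mulrBl mulf_eq0 subr_eq0 (negPf bb) => /eqP //.
have d12 := dist _ _ _ _ n10 n20 l12 m1 m2.
have d13 := dist _ _ _ _ n10 n30 l13 m1 m3.
have d23 := dist _ _ _ _ n20 n30 l23 m2 m3.
have o12 := orth _ _ _ _ m1 m2 d12.
have o13 := orth _ _ _ _ m1 m3 d13.
have o23 := orth _ _ _ _ m2 m3 d23.
have form x y : bar x = x -> bar y = y -> dot x x = 1 -> dot y y = 1 ->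
    dot n1 x = 0 -> dot n1 y = 0 -> dot x y = 0 ->
    x *m B = (b1 * z) *: x -> y *m B = (b1 * z ^+ 2) *: y ->
    exists N c, [/\ bar N = N, N *m N^T = 1%:M, c != 0 &
      B = c *: (N^T *m diag3 1 z (z ^+ 2) *m N)].
  move=> rx ry ux uy nx ny xy mx my; pose N := rows3 n1 x y.
  have NN : N *m N^T = 1%:M.
    rewrite -[N in N *m _]mulmx1; apply/matrixP => i j; rewrite gram_entry bil1 mxE.
    by elim/ord3_ind: i; elim/ord3_ind: j; rewrite !rows3E /= ?mulr1n ?mulr0n // dotC.
  exists N, b1; split=> //; first by rewrite bar_rows3 r1 rx ry.
  have NB : N *m B = b1 *: (diag3 1 z (z ^+ 2) *m N).
    rewrite mul_rows3_row diag3_mul_rows m1 mx my.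
    apply/row_matrixP => i; rewrite linearZ /=.
    by elim/ord3_ind: i; rewrite !rows3E ?scale1r // scalerA.
  by rewrite -mulmxA scalemxAr -NB mulmxA (mulmx1C NN) mul1mx.
have rat b : b ^+ 3 = det3 B ^+ 3 -> b1 != b -> b = b1 * z \/ b = b1 * z ^+ 2.
  move=> qb db; have : (b / b1) ^+ 3 = 1.
    by rewrite expr_div_n qb -q1 divff // expf_neq0.
  move/cube_roots => []; first by rewrite -(inj_eq (mulIf b10)) divfK // mul1r eq_sym.
    by move=> e; left; rewrite -e mulrC divfK.
  by move=> e; right; rewrite -e mulrC divfK.
case: (rat b2 q2 d12) (rat b3 q3 d13) => e2 [] e3.
- by case/eqP: d23; rewrite e2 e3.
- by apply: (form n2 n3) => //; rewrite -?e2 -?e3.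
- by apply: (form n3 n2) => //; rewrite -?e2 -?e3 // dotC.
by case/eqP: d23; rewrite e2 e3.
Qed.

End Omega.

End NeighbourForm.

Lemma in_seq3 (T : eqType) (x a b c : T) :
  (x \in [:: a; b; c]) <-> x = a \/ x = b \/ x = c.
Proof.
rewrite !inE; split=> [/or3P[]/eqP->|[|[]] ->]; rewrite ?eqxx ?orbT //.
- by left.
- by right; left.
by right; right.
Qed.

(** * Secants along the coordinate axes *)

Section BaseAdjacency.
Local Open Scope ring_scope.
Local Open Scope card_scope.
Local Open Scope classical_set_scope.
Variable k : closedFieldType.
Hypothesis k_char5 : 5%N \in [pchar k].
Implicit Types (u v w x y n : 'rV[k]_3) (A B C N : 'M[k]_3) (Q : set (ppoint k)).
Local Notation bar := (bar k_char5).

Lemma secantsI B u v : cross u v != 0 -> bar (bar u) = u -> bar (bar v) = v ->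
  dot u (bar u) = 0 -> dot v (bar v) = 0 -> bil B u u = 0 -> bil B v v = 0 ->
  secants (conic B) (mkline (cross u v)).
Proof.
move=> c0 uR vR uG vG uB vB.
have cl0 : cross 0 v = 0 by apply/rowP; elim/ord3_ind; rewrite !row3E !mxE; ring.
have cr0 : cross u 0 = 0 by apply/rowP; elim/ord3_ind; rewrite !row3E !mxE; ring.
have u0 : u != 0 by apply: contraNneq c0 => u0; rewrite u0 cl0.
have v0 : v != 0 by apply: contraNneq c0 => v0; rewrite v0 cr0.
have rat x : x != 0 -> bar (bar x) = x -> dot x (bar x) = 0 -> rational_points (pt x).
  move=> x0 xR xG; split; first exact/(Gamma_bar k_char5 x0).
  exists x; split=> //; first by rewrite val_pt // memv_line.
  by move=> i; rewrite -{2}xR !barE -exprM.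
have uv : pt u <> pt v.
  move=> /(pt_eqP u0 v0)[c _ e]; case/eqP: c0.
  by rewrite e; apply/rowP; elim/ord3_ind; rewrite !row3E !mxE; ring.
have lu : on_line (pt u) (mkline (cross u v)) by apply/(on_mkline u0 c0); rewrite dot_crossl.
have lv : on_line (pt v) (mkline (cross u v)) by apply/(on_mkline v0 c0); rewrite dot_crossr.
split; exists (pt u), (pt v); split=> //; try exact: rat; split;
  by [apply/conic_pt | apply/(Gamma_bar k_char5)].
Qed.

Local Notation e0 := (row3 (1 : k) 0 0).
Local Notation e1 := (row3 (0 : k) 1 0).
Local Notation e2 := (row3 (0 : k) 0 1).

Lemma four_eqN1 : 4%:R = - 1 :> k.
Proof. by apply/eqP; rewrite -addr_eq0 natr1 natr5. Qed.

Lemma diag3_bil a b c v :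
  bil (diag3 a b c) v v = a * v 0 0 ^+ 2 + b * v 0 1 ^+ 2 + c * v 0 2%:R ^+ 2.
Proof. by rewrite /bil mul_diag3 -/(dot _ _) dotE !row3E; ring. Qed.

Section Omega.
Variables (z : k).
Hypothesis z3 : z ^+ 3 = 1.
Local Notation B := (diag3 1 z (z ^+ 2)).

Lemma omega_neq0 : z != 0.
Proof. by apply: contra_eq_neq z3 => ->; rewrite expr0n /= eq_sym oner_eq0. Qed.

Lemma omega_pow (n : nat) : z ^+ n = z ^+ (n %% 3).
Proof. by rewrite {1}(divn_eq n 3) exprD mulnC exprM z3 expr1n mul1r. Qed.

(** As [2 ^+ 2 = - 1] in F_5, the restriction of the form to a coordinate line splits, and its two
    zeros are written down. Stated for any [z] with [z ^+ 3 = 1] so that [z = 1] covers Q0. *)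
Lemma coordinate_secants l : l \in [:: mkline e0; mkline e1; mkline e2] ->
  secants (conic B) l.
Proof.
have five (x : k) : 5%:R * x = 0 by rewrite natr5 // mul0r.
have z0 := omega_neq0.
have two5 : 2%:R ^+ 5 = 2%:R :> k by rewrite -(pFrobenius_autE k_char5) rmorph_nat.
have z4 : z ^+ 4 = z by rewrite omega_pow.
have z6 : z ^+ 6 = 1 by rewrite omega_pow.
have nN (x : k) : (- x) ^+ 5 = - x ^+ 5 by rewrite -!(pFrobenius_autE k_char5) rmorphN.
have n1 (n : nat) : (1 : k) ^+ n.+1 = 1 by rewrite expr1n.
have n0 (n : nat) : (0 : k) ^+ n.+1 = 0 by rewrite expr0n.
have four0 (x : k) : x != 0 -> 4%:R * x != 0.
  by move=> x0; rewrite four_eqN1 mulN1r oppr_eq0.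
have tz : ((2%:R * z) ^+ 5) ^+ 5 = 2%:R * z.
  by rewrite -exprM exprMn (exprM 2%:R) !two5 omega_pow.
have tz2 : ((2%:R * z ^+ 2) ^+ 5) ^+ 5 = 2%:R * z ^+ 2.
  by rewrite -exprM exprMn (exprM 2%:R) !two5 -(exprM z) omega_pow.
case/in_seq3 => [|[]] ->.
- pose u := row3 0 (2%:R * z ^+ 2) 1; pose v := row3 0 (- (2%:R * z ^+ 2)) 1.
  have cuv : cross u v = (4%:R * z ^+ 2) *: e0.
    by apply/rowP; elim/ord3_ind; rewrite scale_rowE !row3E; ring.
  have c0 : 4%:R * z ^+ 2 != 0 by rewrite four0 // expf_neq0.
  have e00 : e0 != 0 by exact: row100_neq0.
  rewrite -(mkline_scale c0 e00) -cuv; apply: secantsI.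
  + by rewrite cuv scaler_eq0 negb_or c0.
  + by rewrite !bar_row3 !n0 !n1 ?tz ?tz2.
  + by rewrite !bar_row3 !nN !n0 !n1 ?tz ?tz2.
  + rewrite bar_row3 dotE !row3E n0 n1 !exprMn two5.
    transitivity (5%:R + 4%:R * (z ^+ 12 - 1)); first by ring.
    by rewrite omega_pow natr5 // subrr mulr0 addr0.
  + rewrite bar_row3 dotE !row3E n0 n1 nN !exprMn two5.
    transitivity (5%:R + 4%:R * (z ^+ 12 - 1)); first by ring.
    by rewrite omega_pow natr5 // subrr mulr0 addr0.
  + rewrite diag3_bil !row3E.
    transitivity (5%:R * z ^+ 2 + 4%:R * z ^+ 2 * (z ^+ 3 - 1)); first by ring.
    by rewrite five z3 subrr mulr0 addr0.
  + rewrite diag3_bil !row3E.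
    transitivity (5%:R * z ^+ 2 + 4%:R * z ^+ 2 * (z ^+ 3 - 1)); first by ring.
    by rewrite five z3 subrr mulr0 addr0.
- pose u := row3 (2%:R * z) 0 1; pose v := row3 (- (2%:R * z)) 0 1.
  have cuv : cross u v = (- (4%:R * z)) *: e1.
    by apply/rowP; elim/ord3_ind; rewrite scale_rowE !row3E; ring.
  have c0 : - (4%:R * z) != 0 by rewrite oppr_eq0 four0.
  have e00 : e1 != 0 by apply/rV0Pn; exists 1; rewrite row3E oner_neq0.
  rewrite -(mkline_scale c0 e00) -cuv; apply: secantsI.
  + by rewrite cuv scaler_eq0 negb_or c0.
  + by rewrite !bar_row3 !n0 !n1 ?tz ?tz2.
  + by rewrite !bar_row3 !nN !n0 !n1 ?tz ?tz2.
  + rewrite bar_row3 dotE !row3E n0 n1 !exprMn two5.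
    transitivity (5%:R + 4%:R * (z ^+ 6 - 1)); first by ring.
    by rewrite z6 natr5 // subrr mulr0 addr0.
  + rewrite bar_row3 dotE !row3E n0 n1 nN !exprMn two5.
    transitivity (5%:R + 4%:R * (z ^+ 6 - 1)); first by ring.
    by rewrite z6 natr5 // subrr mulr0 addr0.
  + by rewrite diag3_bil !row3E -[RHS](five (z ^+ 2)); ring.
  + by rewrite diag3_bil !row3E -[RHS](five (z ^+ 2)); ring.
pose u := row3 (2%:R * z ^+ 2) 1 0; pose v := row3 (- (2%:R * z ^+ 2)) 1 0.
have cuv : cross u v = (4%:R * z ^+ 2) *: e2.
  by apply/rowP; elim/ord3_ind; rewrite scale_rowE !row3E; ring.
have c0 : 4%:R * z ^+ 2 != 0 by rewrite four0 // expf_neq0.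
have e00 : e2 != 0 by apply/rV0Pn; exists 2%:R; rewrite row3E oner_neq0.
rewrite -(mkline_scale c0 e00) -cuv; apply: secantsI.
- by rewrite cuv scaler_eq0 negb_or c0.
- by rewrite !bar_row3 !n0 !n1 ?tz ?tz2.
- by rewrite !bar_row3 !nN !n0 !n1 ?tz ?tz2.
- rewrite bar_row3 dotE !row3E n0 n1 !exprMn two5.
  transitivity (5%:R + 4%:R * (z ^+ 12 - 1)); first by ring.
  by rewrite omega_pow natr5 // subrr mulr0 addr0.
- rewrite bar_row3 dotE !row3E n0 n1 nN !exprMn two5.
  transitivity (5%:R + 4%:R * (z ^+ 12 - 1)); first by ring.
  by rewrite omega_pow natr5 // subrr mulr0 addr0.
- rewrite diag3_bil !row3E; transitivity (5%:R * z + 4%:R * z * (z ^+ 3 - 1)); first by ring.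
  by rewrite five z3 subrr mulr0 addr0.
rewrite diag3_bil !row3E; transitivity (5%:R * z + 4%:R * z * (z ^+ 3 - 1)); first by ring.
by rewrite five z3 subrr mulr0 addr0.
Qed.

End Omega.
End BaseAdjacency.

Lemma in_seq4 (T : eqType) (x a b c d : T) :
  (x \in [:: a; b; c; d]) <-> x = a \/ x = b \/ x = c \/ x = d.
Proof.
rewrite !inE; split=> [/or4P[]/eqP->|[|[|[]]] ->]; rewrite ?eqxx ?orbT //.
- by left.
- by right; left.
- by right; right; left.
by right; right; right.
Qed.

Lemma uniq3 (T : eqType) (a b c : T) :
  a <> b -> a <> c -> b <> c -> uniq [:: a; b; c].
Proof. by move=> /eqP ab /eqP ac /eqP bc; rewrite /= !inE !negb_or ab ac bc. Qed.

Lemma uniq4 (T : eqType) (a b c d : T) :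
  a <> b -> a <> c -> a <> d -> b <> c -> b <> d -> c <> d -> uniq [:: a; b; c; d].
Proof.
move=> /eqP ab /eqP ac /eqP ad /eqP bc /eqP bd /eqP cd.
by rewrite /= !inE !negb_or ab ac ad bc bd cd.
Qed.

(** * The conic diag(1, z, z^2) as a neighbour of Q0 *)

Section BaseAdjacent.
Local Open Scope ring_scope.
Local Open Scope card_scope.
Local Open Scope classical_set_scope.
Variable k : closedFieldType.
Hypothesis k_char5 : 5%N \in [pchar k].
Implicit Types (u v w x y n : 'rV[k]_3) (A B C N : 'M[k]_3) (Q : set (ppoint k)).
Local Notation bar := (bar k_char5).
Local Notation unitary := (unitary k_char5).
Local Notation Q0 := (@Q0 k).
Variable z : k.
Hypothesis z_root : z ^+ 2 + z + 1 = 0.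
Local Notation B := (diag3 1 z (z ^+ 2)).
Local Notation e0 := (row3 (1 : k) 0 0).
Local Notation e1 := (row3 (0 : k) 1 0).
Local Notation e2 := (row3 (0 : k) 0 1).

Let z3 : z ^+ 3 = 1 := omega3 z_root.

Lemma bar_diag3 a b c : bar (diag3 a b c) = diag3 (a ^+ 5) (b ^+ 5) (c ^+ 5).
Proof.
apply/matrixP => i j; rewrite barE !mxE.
by elim/ord3_ind: i; elim/ord3_ind: j; rewrite /= ?mulr1n ?mulr0n // expr0n.
Qed.

Lemma diag3M (a b c a' b' c' : k) :
  diag3 a b c *m diag3 a' b' c' = diag3 (a * a') (b * b') (c * c').
Proof.
rewrite /diag3 mulmx_diag; congr diag_mx.
by apply/rowP; elim/ord3_ind; rewrite !mxE.
Qed.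

Lemma diag3_1 : diag3 1 1 1 = 1%:M :> 'M[k]_3.
Proof.
apply/matrixP => i j; rewrite !mxE.
by elim/ord3_ind: i; elim/ord3_ind: j.
Qed.

Lemma diag_omega_unitary : unitary B.
Proof.
suff : B *m (bar B)^T = 1%:M by [].
have e1 : z * z ^+ 5 = 1 by rewrite -exprS (omega_pow z3 6).
have e2 : z ^+ 2 * (z ^+ 2) ^+ 5 = 1 by rewrite -exprM -exprD (omega_pow z3 12).
by rewrite bar_diag3 diag3_sym diag3M e1 e2 expr1n mulr1 diag3_1.
Qed.

(** The matrix [B] is diagonal with cube 1, so pulling it back by itself gives the identity. Total
    tangency of [conic B] follows from that of Q0. *)
Lemma omega_conic : set_act Q0 (pgl B) = conic B.
Proof.
rewrite -[RHS](conic_act B (unitary_unit diag_omega_unitary)); congr (set_act (conic _) _).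
have e1 : z * z * z = 1 by rewrite -[RHS]z3; ring.
have e2 : z ^+ 2 * z ^+ 2 * z ^+ 2 = 1 by rewrite -!exprD (omega_pow z3 6).
by rewrite diag3_sym !diag3M e1 e2 !mulr1 diag3_1.
Qed.

Lemma omega_neq1 : z != 1.
Proof.
apply/eqP => z1; have := natr_neq0 k_char5 (isT : (3 %% 5 != 0)%N).
have -> : 3%:R = z ^+ 2 + z + 1 by rewrite z1; ring.
by rewrite z_root eqxx.
Qed.

(** Both equations are linear in the squares of the coordinates and fix them up to a factor, which
    leaves four points. Common secants have eigenvectors of [B] as normals, by [common_secant]; the
    diagonal entries being distinct, these are the coordinate vectors. *)
Lemma adjacent_base : totally_tangent_conics Q0 -> adjacent Q0 (conic B).
Proof.
move=> tQ; have uB := diag_omega_unitary; have z0 := omega_neq0 z3.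
have one0 : (1 : k) != 0 by exact: oner_neq0.
have two0 := two_neq0 k_char5.
have sB : B^T = B by exact: diag3_sym.
have BB : B *m bar B = 1%:M.
  by have : B *m (bar B)^T = 1%:M := uB; rewrite bar_diag3 diag3_sym.
have e00 : e0 != 0 by exact: row100_neq0.
have e10 : e1 != 0 by apply/rV0Pn; exists 1; rewrite row3E.
have e20 : e2 != 0 by apply/rV0Pn; exists 2%:R; rewrite row3E.
have pt_neq u v : u != 0 -> v != 0 -> (exists i j, u 0 i * v 0 j != u 0 j * v 0 i) -> pt u <> pt v.
  move=> u0 v0 [i [j uv]] /(pt_eqP u0 v0)[c _ e]; case/eqP: uv.
  by rewrite e !scale_rowE mulrAC.
have line_neq u v : u != 0 -> v != 0 -> (exists i j, u 0 i * v 0 j != u 0 j * v 0 i) ->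
    mkline u <> mkline v.
  move=> u0 v0 [i [j uv]] /(mkline_inj u0 v0)[c _ e]; case/eqP: uv.
  by rewrite e !scale_rowE mulrAC.
split=> //.
- by rewrite -omega_conic; apply: totally_tangent_act => //; apply: PGU_unitary.
- move=> e; have u0 : row3 (1 : k) 2%:R 0 != 0 by apply/rV0Pn; exists 0; rewrite row3E.
  (* This point lies on Q0 because [1 + 4 = 5], but on [conic B] only if [1 + 4 z = 0], that is
     [z = 1]. *)
  have : Q0 (pt (row3 (1 : k) 2%:R 0)).
    apply/(conic_pt _ u0); rewrite -diag3_1 diag3_bil !row3E.
    by transitivity (5%:R : k); [ring | exact: natr5].
  rewrite e => /(conic_pt _ u0); rewrite diag3_bil !row3E => h.
  case/eqP: omega_neq1; apply: (mulfI (natr_neq0 k_char5 (isT : (4 %% 5 != 0)%N))).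
  transitivity ((1 * 1 ^+ 2 + z * 2%:R ^+ 2 + z ^+ 2 * 0 ^+ 2) - 5%:R + 4%:R : k); first by ring.
  by rewrite h natr5 // subr0 add0r mulr1.
- apply/card_seqP.
  (* The squares [z], [z ^+ 2], 1 sum to 0, and so do their products with the diagonal entries 1,
     [z], [z ^+ 2]; [s] and [t] are the free signs. *)
  pose r s t := row3 (s * z ^+ 2) (t * z) 1.
  have r0 s t : r s t != 0 by apply/rV0Pn; exists 2%:R; rewrite row3E.
  exists [:: pt (r 1 1); pt (r 1 (- 1)); pt (r (- 1) 1); pt (r (- 1) (- 1))].
  have sgn (a : k) : a != 0 -> a != - a.
    move=> a0; rewrite -subr_eq0 opprK -mulr2n -mulr_natl mulf_neq0 //.
  have z20 : z ^+ 2 != 0 by rewrite expf_neq0.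
  split=> // [|p].
    apply: uniq4.
    + by apply: pt_neq => //; exists 1, 2%:R; rewrite !row3E !mulr1 !mul1r mulN1r sgn.
    + by apply: pt_neq => //; exists 0, 2%:R; rewrite !row3E !mulr1 !mul1r mulN1r sgn.
    + by apply: pt_neq => //; exists 0, 2%:R; rewrite !row3E !mulr1 !mul1r mulN1r sgn.
    + by apply: pt_neq => //; exists 0, 2%:R; rewrite !row3E !mulr1 !mul1r mulN1r sgn.
    + by apply: pt_neq => //; exists 0, 2%:R; rewrite !row3E !mulr1 !mul1r mulN1r sgn.
    by apply: pt_neq => //; exists 1, 2%:R; rewrite !row3E !mulr1 !mul1r mulN1r sgn.
  have rQ s t : s ^+ 2 = 1 -> t ^+ 2 = 1 -> (Q0 `&` conic B) (pt (r s t)).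
    move=> s2 t2; split; apply/(conic_pt _ (r0 s t)).
      rewrite -diag3_1 diag3_bil !row3E !exprMn s2 t2.
      transitivity (z * (z ^+ 3 - 1) + (z ^+ 2 + z + 1)); first by ring.
      by rewrite z3 z_root subrr mulr0 addr0.
    rewrite diag3_bil !row3E !exprMn s2 t2.
    transitivity ((z + 1) * (z ^+ 3 - 1) + (z ^+ 2 + z + 1)); first by ring.
    by rewrite z3 z_root subrr mulr0 addr0.
  split=> [[Qp Bp]|]; last first.
    have N1 : (- 1) ^+ 2 = 1 :> k by rewrite sqrrN expr1n.
    have O1 : 1 ^+ 2 = 1 :> k by rewrite expr1n.
    by case/in_seq4 => [|[|[]]] ->; apply: rQ.
  have [v v0 ep] := ptP p; rewrite ep in Qp Bp *.
  move/(conic_pt _ v0): Qp; rewrite -diag3_1 diag3_bil !mul1r => q1.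
  move/(conic_pt _ v0): Bp; rewrite diag3_bil mul1r => q2.
  set a := v 0 0 in q1 q2; set b := v 0 1 in q1 q2; set c := v 0 2%:R in q1 q2.
  have z10 : z - 1 != 0 by rewrite subr_eq0 omega_neq1.
  have ea : a ^+ 2 = (z ^+ 2 * c) ^+ 2.
    apply/eqP; rewrite -subr_eq0; apply/eqP/(mulfI z10).
    transitivity (z * (a ^+ 2 + b ^+ 2 + c ^+ 2) - (a ^+ 2 + z * b ^+ 2 + z ^+ 2 * c ^+ 2)
      - (z ^+ 2 - z) * c ^+ 2 * (z ^+ 3 - 1)); first by ring.
    by rewrite q1 q2 z3 subrr; ring.
  have eb : b ^+ 2 = (z * c) ^+ 2.
    apply/eqP; rewrite -subr_eq0; apply/eqP/(mulfI z10).
    transitivity ((a ^+ 2 + z * b ^+ 2 + z ^+ 2 * c ^+ 2) - (a ^+ 2 + b ^+ 2 + c ^+ 2)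
      - c ^+ 2 * (z ^+ 3 - 1)); first by ring.
    by rewrite q1 q2 z3 subrr; ring.
  have c0 : c != 0.
    apply: contraNneq v0 => c0; apply/eqP/rowP.
    move: ea eb; rewrite c0 !mulr0 expr0n /= => /eqP; rewrite expf_eq0 /= => /eqP a0.
    move/eqP; rewrite expf_eq0 /= => /eqP b0.
    by elim/ord3_ind; rewrite [RHS]mxE.
  have [s [ea' hs]] : exists s, a = s * (z ^+ 2 * c) /\ (s = 1 \/ s = - 1).
    move/eqP: ea; rewrite eqf_sqr => /orP[]/eqP->; [exists 1|exists (- 1)].
      by rewrite mul1r; split=> //; left.
    by rewrite mulN1r; split=> //; right.
  have [t [eb' ht]] : exists t, b = t * (z * c) /\ (t = 1 \/ t = - 1).
    move/eqP: eb; rewrite eqf_sqr => /orP[]/eqP->; [exists 1|exists (- 1)].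
      by rewrite mul1r; split=> //; left.
    by rewrite mulN1r; split=> //; right.
  have -> : v = c *: r s t.
    apply/rowP; elim/ord3_ind; rewrite scale_rowE !row3E.
    - by rewrite -/a ea'; ring.
    - by rewrite -/b eb'; ring.
    by rewrite mulr1.
  rewrite pt_scale //; apply/in_seq4.
  by case: hs => ->; case: ht => ->; [left|right; left|right; right; left|right; right; right].
apply/card_seqP; exists [:: mkline e0; mkline e1; mkline e2]; split=> //.
  apply: uniq3.
  - by apply: line_neq => //; exists 0, 1; rewrite !row3E mulr1 mulr0.
  - by apply: line_neq => //; exists 0, 2%:R; rewrite !row3E mulr1 mulr0.
  by apply: line_neq => //; exists 1, 2%:R; rewrite !row3E mulr1 mulr0.
move=> l; split=> [[s0 sl]|ls]; last first.
  split; last exact: coordinate_secants.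
  have := coordinate_secants k_char5 (expr1n _ 3 : (1 : k) ^+ 3 = 1) ls.
  by rewrite expr1n diag3_1.
have [n [b [[n0 -> nR nn] [nB b0 _]]]] := common_secant sB BB s0 sl.
move/rowP: nB => nB; move: (nB 0) (nB 1) (nB 2%:R).
rewrite !mul_diag3 !scale_rowE !row3E mulr1 => h0 h1 h2.
have nE := row3_eta n.
have ax (i : 'I_3) (e : 'rV[k]_3) : e != 0 -> n = n 0 i *: e -> mkline n = mkline e.
  move=> en0 e'; rewrite e' mkline_scale //.
  by apply: contraNneq n0 => ni; rewrite e' ni scale0r.
have eig (i j : 'I_3) (p q : k) : n 0 i * p = b * n 0 i -> n 0 j * q = b * n 0 j -> p != q ->
    n 0 i = 0 \/ n 0 j = 0.
  move=> hi hj pq; have [->|ni] := eqVneq (n 0 i) 0; first by left.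
  have [->|nj] := eqVneq (n 0 j) 0; first by right.
  case/eqP: pq; rewrite mulrC in hi; rewrite mulrC in hj.
  by rewrite (mulIf ni hi) (mulIf nj hj).
have p01 : 1 != z by rewrite eq_sym omega_neq1.
have p02 : 1 != z ^+ 2.
  apply/eqP => e; move/eqP: omega_neq1; apply.
  by rewrite -[RHS]z3 exprS -e mulr1.
have p12 : z != z ^+ 2.
  by rewrite expr2 -{1}(mulr1 z) (inj_eq (mulfI z0)).
have h0' : n 0 0 * 1 = b * n 0 0 by rewrite mulr1.
have [na|na] := eqVneq (n 0 0) 0; last first.
  have [/eqP|nb] := eig 0 1 _ _ h0' h1 p01; first by rewrite (negPf na).
  have [/eqP|nc] := eig 0 2%:R _ _ h0' h2 p02; first by rewrite (negPf na).
  apply/in_seq3; left; apply: (ax 0) => //.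
  by apply/rowP; elim/ord3_ind; rewrite scale_rowE !row3E ?mulr0 ?mulr1.
have [nb|nb] := eqVneq (n 0 1) 0; last first.
  have [/eqP|nc] := eig 1 2%:R _ _ h1 h2 p12; first by rewrite (negPf nb).
  apply/in_seq3; right; left; apply: (ax 1) => //.
  by apply/rowP; elim/ord3_ind; rewrite scale_rowE !row3E ?mulr0 ?mulr1.
apply/in_seq3; right; right; apply: (ax 2%:R) => //.
by apply/rowP; elim/ord3_ind; rewrite scale_rowE !row3E ?mulr0 ?mulr1.
Qed.

End BaseAdjacent.

(** * Finite verifications over F_25 *)

(* A computable copy of F_25 = F_5(w), w^2 = 2, used for the finite verifications. *)
Inductive f5 := f5_0 | f5_1 | f5_2 | f5_3 | f5_4.

Definition f5n (a : f5) : nat :=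
  match a with f5_0 => 0 | f5_1 => 1 | f5_2 => 2 | f5_3 => 3 | f5_4 => 4 end.
Definition f5S (a : f5) : f5 :=
  match a with f5_0 => f5_1 | f5_1 => f5_2 | f5_2 => f5_3 | f5_3 => f5_4 | f5_4 => f5_0 end.
Definition f5add (a b : f5) : f5 := iter (f5n a) f5S b.
Definition f5mul (a b : f5) : f5 := iter (f5n a) (f5add b) f5_0.

Definition f25 : Type := f5 * f5.
Definition f25_0 : f25 := (f5_0, f5_0).
Definition f25_1 : f25 := (f5_1, f5_0).
Definition f25add (x y : f25) : f25 := (f5add x.1 y.1, f5add x.2 y.2).
Definition f25mul (x y : f25) : f25 :=
  (f5add (f5mul x.1 y.1) (f5mul f5_2 (f5mul x.2 y.2)),
   f5add (f5mul x.1 y.2) (f5mul x.2 y.1)).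
Definition f25conj (x : f25) : f25 := (x.1, f5mul f5_4 x.2).
Definition f25eq (x y : f25) : bool :=
  eqn (f5n x.1) (f5n y.1) && eqn (f5n x.2) (f5n y.2).

(* A 3 x 3 matrix is the list of its nine entries, row by row. *)
Definition entry (s : seq f25) (i j : nat) : f25 := nth f25_0 s (3 * i + j).
Definition dot25 (s t : seq f25) (i j : nat) : f25 :=
  f25add (f25mul (entry s i 0) (entry t j 0))
    (f25add (f25mul (entry s i 1) (entry t j 1)) (f25mul (entry s i 2) (entry t j 2))).
(** The product [s t^T], which serves Gram matrices and congruences alike. *)
Definition mulT (s t : seq f25) : seq f25 :=
  let d := dot25 s t in
  [:: d 0 0; d 0 1; d 0 2; d 1 0; d 1 1; d 1 2; d 2 0; d 2 1; d 2 2].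
(** Equal to [s t s^T] for a symmetric [t] only, since [mulT] transposes [t]. *)
Definition congruent (s t : seq f25) : seq f25 := mulT (mulT s t) s.
(** All 2 x 2 minors vanish. A zero matrix passes this test, so [prop25P] asks for nonzero ones. *)
Definition prop25 (s t : seq f25) : bool :=
  let z := zip s t in
  all (fun p => all (fun q => f25eq (f25mul p.1 q.2) (f25mul q.1 p.2)) z) z.
Definition nonzero25 (s : seq f25) : bool := has (fun x => ~~ f25eq x f25_0) s.

(* The two-digit code 10 a + b stands for a + b w. *)
Definition decode (s : seq nat) : seq f25 :=
  [seq (iter (n %/ 10) f5S f5_0, iter (n %% 10) f5S f5_0) | n <- s].

Definition id25 : seq f25 := decode [:: 10; 0; 0; 0; 10; 0; 0; 0; 10].

(* Equations of the 21 conics of the component of x^2 + y^2 + z^2 = 0, labelled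
   by the pairs {i, j} so that adjacent conics have intersecting labels; the label i
   is one of the seven cliques of size 6. *)
Definition conic_table (i j : nat) : seq nat :=
  match i, j with
  | 0, 1 => [:: 10; 0; 0; 0; 10; 0; 0; 0; 10]
  | 0, 2 => [:: 10; 0; 0; 0; 23; 0; 0; 0; 22]
  | 0, 3 => [:: 10; 14; 11; 14; 22; 30; 11; 30; 23]
  | 0, 4 => [:: 10; 14; 44; 14; 22; 20; 44; 20; 23]
  | 0, 5 => [:: 10; 41; 11; 41; 22; 20; 11; 20; 23]
  | 0, 6 => [:: 10; 41; 44; 41; 22; 30; 44; 30; 23]
  | 1, 2 => [:: 10; 0; 0; 0; 22; 0; 0; 0; 23]
  | 1, 3 => [:: 10; 11; 14; 11; 23; 30; 14; 30; 22]
  | 1, 4 => [:: 10; 11; 41; 11; 23; 20; 41; 20; 22]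
  | 1, 5 => [:: 10; 44; 14; 44; 23; 20; 14; 20; 22]
  | 1, 6 => [:: 10; 44; 41; 44; 23; 30; 41; 30; 22]
  | 2, 3 => [:: 10; 30; 30; 30; 10; 30; 30; 30; 10]
  | 2, 4 => [:: 10; 30; 20; 30; 10; 20; 20; 20; 10]
  | 2, 5 => [:: 10; 20; 30; 20; 10; 20; 30; 20; 10]
  | 2, 6 => [:: 10; 20; 20; 20; 10; 30; 20; 30; 10]
  | 3, 4 => [:: 0; 10; 0; 10; 0; 0; 0; 0; 40]
  | 3, 5 => [:: 0; 0; 10; 0; 40; 0; 10; 0; 0]
  | 3, 6 => [:: 10; 0; 0; 0; 0; 40; 0; 40; 0]
  | 4, 5 => [:: 10; 0; 0; 0; 0; 10; 0; 10; 0]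
  | 4, 6 => [:: 0; 0; 10; 0; 10; 0; 10; 0; 0]
  | 5, 6 => [:: 0; 10; 0; 10; 0; 0; 0; 0; 10]
  | _, _ => [::]
  end.
Definition conic25 (i j : nat) : seq f25 := decode (conic_table (minn i j) (maxn i j)).

(* Unitary matrices inducing the 3-cycles (0 1 b) on the labels. *)
Definition cycle_table (b : nat) : seq nat :=
  match b with
  | 2 => [:: 10; 0; 0; 0; 22; 0; 0; 0; 23]
  | 3 => [:: 30; 33; 32; 33; 14; 40; 32; 40; 11]
  | 4 => [:: 14; 40; 22; 40; 11; 23; 22; 23; 30]
  | 5 => [:: 11; 23; 40; 23; 30; 22; 40; 22; 14]
  | 6 => [:: 11; 23; 10; 23; 30; 33; 10; 33; 14]
  | _ => [::]
  end.
Definition cycle25 (b : nat) : seq f25 := decode (cycle_table b).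
Definition cycle_nat (b i : nat) : nat :=
  if i == 0 then 1 else if i == 1 then b else if i == b then 0 else i.

Definition f5_enum : seq f5 := [:: f5_0; f5_1; f5_2; f5_3; f5_4].
Definition all_rows (P : seq f25 -> bool) : bool :=
  all (fun a => all (fun b => all (fun c =>
    P [:: (a, f5_0); (b, f5_0); (c, f5_0)]) f5_enum) f5_enum) f5_enum.

(* [if] instead of [&&] keeps the evaluation by [vm_compute] from visiting all 5^9 matrices. *)
Definition forall_orthogonal (P : seq f25 -> bool) : bool :=
  all_rows (fun u => if ~~ f25eq (dot25 u u 0 0) f25_1 then true else
    all_rows (fun v => if ~~ (f25eq (dot25 v v 0 0) f25_1 && f25eq (dot25 u v 0 0) f25_0)
                       then true else
      all_rows (fun w => if ~~ [&& f25eq (dot25 w w 0 0) f25_1, f25eq (dot25 u w 0 0) f25_0 &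
                                   f25eq (dot25 v w 0 0) f25_0]
                         then true else P (u ++ v ++ w)))).

Definition labels : seq (nat * nat) := [seq (i, j) | i <- iota 0 7, j <- iota 0 7].

(** Unitary up to a scalar, which [nonzero25] keeps from being 0. *)
Definition unitary25 (s : seq f25) : bool :=
  let t := mulT s (map f25conj s) in [&& size s == 9, nonzero25 t & prop25 t id25].
Definition symmetric25 (s : seq f25) : bool :=
  [&& f25eq (entry s 0 1) (entry s 1 0), f25eq (entry s 0 2) (entry s 2 0) &
      f25eq (entry s 1 2) (entry s 2 1)].

Lemma check_conics : all (fun e => (e.1 == e.2) ||
  unitary25 (conic25 e.1 e.2) && symmetric25 (conic25 e.1 e.2)) labels.
Proof. by vm_compute. Qed.

Lemma check_distinct :
  all (fun e => all (fun f => [|| e.1 == e.2, f.1 == f.2, (e.1 == f.1) && (e.2 == f.2),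
    (e.1 == f.2) && (e.2 == f.1) | ~~ prop25 (conic25 e.1 e.2) (conic25 f.1 f.2)]) labels) labels.
Proof. by vm_compute. Qed.

(** In the direction of [conic_act]: the equation with the permuted labels, pulled back by the
    matrix, is the one with the original labels. *)
Lemma check_cycles :
  all (fun b => unitary25 (cycle25 b) && all (fun e => (e.1 == e.2) ||
    prop25 (congruent (cycle25 b) (conic25 (cycle_nat b e.1) (cycle_nat b e.2)))
      (conic25 e.1 e.2)) labels) (iota 2 5).
Proof. by vm_compute. Qed.

(** By [neighbour_form] the neighbours of Q0 are images of the conic {0, 2} under real orthogonal
    matrices. The labels tried are the ten pairs adjacent to {0, 1}. *)
Lemma check_neighbours :
  forall_orthogonal (fun s => let t := congruent s (conic25 0 2) in
    has (fun j => prop25 t (conic25 0 j) || prop25 t (conic25 1 j)) (iota 2 5)).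
Proof. by vm_compute. Qed.

(** Orthogonality already means that {0, 1} is fixed, so three more labels are tested. *)
Lemma check_fixed :
  forall_orthogonal (fun s =>
    let fixes j := prop25 (congruent s (conic25 0 j)) (conic25 0 j) in
    if [&& fixes 2, fixes 3 & fixes 4] then prop25 s id25 else true).
Proof. by vm_compute. Qed.

(** * Embedding of the computable field into k *)

Section Embedding.
Local Open Scope ring_scope.
Variable k : closedFieldType.
Hypothesis k_char5 : 5%N \in [pchar k].
Variable w : k.
Hypothesis w2 : w ^+ 2 = 2%:R.
Implicit Types (s t : seq f25) (N : 'M[k]_3).
Local Notation bar := (bar k_char5).

Definition iota5 (a : f5) : k := (f5n a)%:R.
Definition iota25 (x : f25) : k := iota5 x.1 + iota5 x.2 * w.

Lemma iota5D a b : iota5 (f5add a b) = iota5 a + iota5 b.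
Proof. by rewrite /iota5 -natrD (natr_char5 k_char5 (_ + _)); case: a; case: b. Qed.

Lemma iota5M a b : iota5 (f5mul a b) = iota5 a * iota5 b.
Proof. by rewrite /iota5 -natrM (natr_char5 k_char5 (_ * _)); case: a; case: b. Qed.

Lemma iota5_neq0 a : a <> f5_0 -> iota5 a != 0.
Proof. by case: a => // _; apply: natr_neq0. Qed.

Lemma iota25D x y : iota25 (f25add x y) = iota25 x + iota25 y.
Proof. by rewrite /iota25 /= !iota5D; ring. Qed.

Lemma iota25M x y : iota25 (f25mul x y) = iota25 x * iota25 y.
Proof.
have e2 : iota5 f5_2 = w ^+ 2 by rewrite w2.
by rewrite /iota25 /= !(iota5D, iota5M) e2; ring.
Qed.

Lemma iota25_0 : iota25 f25_0 = 0.
Proof. by rewrite /iota25 /iota5 /=; ring. Qed.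
Lemma iota25_1 : iota25 f25_1 = 1.
Proof. by rewrite /iota25 /iota5 /=; ring. Qed.

Lemma w5 : w ^+ 5 = 4%:R * w.
Proof. by have -> : w ^+ 5 = w ^+ 2 * w ^+ 2 * w; [ring | rewrite w2; ring]. Qed.

Lemma iota5_pow5 a : iota5 a ^+ 5 = iota5 a.
Proof. by rewrite -(pFrobenius_autE k_char5) rmorph_nat. Qed.

Lemma iota25_conj x : iota25 (f25conj x) = iota25 x ^+ 5.
Proof.
rewrite -(pFrobenius_autE k_char5) rmorphD rmorphM /= !pFrobenius_autE !iota5_pow5 w5.
have e4 : iota5 f5_4 = 4%:R by [].
by rewrite /iota25 /= iota5M e4; ring.
Qed.

Lemma f25eqP x y : reflect (x = y) (f25eq x y).
Proof.
have f5n_inj : injective f5n by case=> [] [].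
apply: (iffP andP) => [[/eqnP/f5n_inj e1 /eqnP/f5n_inj e2]|->].
  by case: x y e1 e2 => [a b] [c d] /= -> ->.
by split; apply/eqnP.
Qed.

Lemma iota5_inj : injective iota5.
Proof.
move=> a b /eqP; rewrite -subr_eq0 => e.
suff : f5add a (f5mul f5_4 b) = f5_0 by case: a b {e} => [] [].
apply: contrapT => /iota5_neq0/negP; apply.
have e4 : iota5 f5_4 = - 1 by rewrite -(four_eqN1 k_char5).
by rewrite iota5D iota5M e4 mulN1r.
Qed.

Lemma w_neq0 : w != 0.
Proof.
have := two_neq0 k_char5; rewrite -w2; apply: contraNneq => ->.
by rewrite expr0n.
Qed.

(** Frobenius fixes F_5 and sends [w] to [4 w = - w], which separates the two components. *)
Lemma iota25_inj : injective iota25.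
Proof.
move=> [a b] [c d]; rewrite /iota25 /= => e.
have e' : iota5 a - iota5 c = (iota5 d - iota5 b) * w.
  transitivity (iota5 a + iota5 b * w - iota5 c - iota5 b * w); first by ring.
  by rewrite e; ring.
have bd : iota5 d - iota5 b = 0.
  have := congr1 (pFrobenius_aut k_char5) e'.
  rewrite rmorphM !rmorphB /= !pFrobenius_autE !iota5_pow5 w5 e' => /eqP.
  rewrite -subr_eq0 => /eqP h; apply/eqP.
  have : (iota5 d - iota5 b) * (2%:R * w) = 0.
    transitivity (5%:R * ((iota5 d - iota5 b) * w)
      - ((iota5 d - iota5 b) * (4%:R * w) - (iota5 d - iota5 b) * w)); first by ring.
    rewrite natr5 // mul0r; move: h; rewrite -opprB => /eqP.
    by rewrite oppr_eq0 => /eqP ->; rewrite subrr.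
  by move/eqP; rewrite !mulf_eq0 (negPf w_neq0) (negPf (two_neq0 k_char5)) !orbF.
have hb : b = d by apply: iota5_inj; apply/eqP; rewrite eq_sym -subr_eq0 bd.
move: e'; rewrite bd mul0r => /eqP; rewrite subr_eq0 => /eqP/iota5_inj ->.
by rewrite hb.
Qed.

Definition mx25 s : 'M[k]_3 := \matrix_(i, j) iota25 (entry s i j).

Lemma iota25_dot s t (i j : 'I_3) :
  iota25 (dot25 s t i j) = \sum_l mx25 s i l * mx25 t j l.
Proof. by rewrite !(iota25D, iota25M) big_ord3 !mxE addrA. Qed.

Lemma mx25_mulT s t : mx25 (mulT s t) = mx25 s *m (mx25 t)^T.
Proof.
apply/matrixP => i j; rewrite [RHS]mxE.
transitivity (iota25 (dot25 s t i j)).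
  by rewrite mxE; elim/ord3_ind: i; elim/ord3_ind: j.
by rewrite iota25_dot; apply: eq_bigr => l _; rewrite [_^T _ _]mxE.
Qed.

Lemma mx25_congruent s t :
  (mx25 t)^T = mx25 t -> mx25 (congruent s t) = mx25 s *m mx25 t *m (mx25 s)^T.
Proof. by move=> st; rewrite !mx25_mulT st. Qed.

Lemma mx25_conj s : mx25 (map f25conj s) = bar (mx25 s).
Proof.
apply/matrixP => i j; rewrite barE !mxE -iota25_conj; congr iota25.
rewrite /entry; have [lt|ge] := ltnP (3 * i + j)%N (size s).
  by rewrite (nth_map f25_0).
by rewrite !nth_default ?size_map.
Qed.

Lemma mx25_id : mx25 id25 = 1%:M.
Proof.
by apply/matrixP => i j; rewrite !mxE; elim/ord3_ind: i; elim/ord3_ind: j;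
  rewrite ?iota25_0 ?iota25_1.
Qed.

Lemma nonzero25P s : size s = 9 -> nonzero25 s -> mx25 s != 0.
Proof.
move=> ss /(has_nthP f25_0)[n]; rewrite ss => n9 /f25eqP nz; apply/eqP => /matrixP e.
apply: nz; apply: iota25_inj; rewrite iota25_0.
have n3 : (n %/ 3 < 3)%N by rewrite ltn_divLR.
have := e (Ordinal n3) (Ordinal (ltn_pmod n (isT : (0 < 3)%N))); rewrite !mxE => <-.
by rewrite /entry /= mulnC -divn_eq.
Qed.

Lemma all_zip_entry (P : pred (f25 * f25)) s t (i j : 'I_3) : size s = 9 -> size t = 9 ->
  all P (zip s t) -> P (entry s i j, entry t i j).
Proof.
move=> ss st /(all_nthP (f25_0, f25_0)) H.
have := H (3 * i + j)%N; rewrite nth_zip ?ss // size_zip ss st minnn; apply.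
by elim/ord3_ind: i; elim/ord3_ind: j.
Qed.

Lemma all_zip_entryI (P : pred (f25 * f25)) s t : size s = 9 -> size t = 9 ->
  (forall i j : 'I_3, P (entry s i j, entry t i j)) -> all P (zip s t).
Proof.
move=> ss st H; apply/(all_nthP (f25_0, f25_0)) => n; rewrite size_zip ss st minnn => n9.
rewrite nth_zip ?ss //; have n3 : (n %/ 3 < 3)%N by rewrite ltn_divLR.
have := H (Ordinal n3) (Ordinal (ltn_pmod n (isT : (0 < 3)%N))).
by rewrite /entry /= mulnC -divn_eq.
Qed.

Lemma prop25P s t : size s = 9 -> size t = 9 -> mx25 s != 0 -> mx25 t != 0 ->
  prop25 s t -> exists2 c, c != 0 & mx25 s = c *: mx25 t.
Proof.
move=> ss st s0 t0 h.
have [||i j|c c0 e] := @minors_proportional _ _ (mxvec (mx25 s)) (mxvec (mx25 t)).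
- by rewrite mxvec_eq0.
- by rewrite mxvec_eq0.
- case/mxvec_indexP: i => i1 i2; case/mxvec_indexP: j => j1 j2.
  rewrite !mxvecE !mxE -!iota25M; congr iota25; apply/f25eqP.
  exact: (all_zip_entry j1 j2 ss st (all_zip_entry i1 i2 ss st h)).
exists c => //; apply: (can_inj mxvecK); by rewrite e linearZ.
Qed.

Lemma prop25I s t c : size s = 9 -> size t = 9 -> mx25 s = c *: mx25 t -> prop25 s t.
Proof.
move=> ss st e; apply: all_zip_entryI => // i j; apply: all_zip_entryI => // i' j'.
apply/f25eqP; apply: iota25_inj; rewrite !iota25M /=.
have E (a b : 'I_3) : iota25 (entry s a b) = c * iota25 (entry t a b).
  by move/matrixP/(_ a b): e; rewrite !mxE.
by rewrite !E; ring.
Qed.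

Lemma real_iota5 (x : k) : x ^+ 5 = x -> exists a, x = iota5 a.
Proof.
move=> x5; have [->|x0] := eqVneq x 0; first by exists f5_0.
have five := natr5 k_char5.
have x4 := pow4_1 x0 x5.
have : (x - 1) * (x - 4%:R) * ((x - 2%:R) * (x - 3%:R)) = 0.
  (* Over the integers the product differs from [x ^+ 4 - 1] by this multiple of 5. *)
  transitivity (x ^+ 4 - 1 + 5%:R * (- 2%:R * x ^+ 3 + 7%:R * x ^+ 2 - 10%:R * x + 5%:R)).
    by ring.
  by rewrite x4 five mul0r subrr addr0.
move/eqP; rewrite !mulf_eq0 !subr_eq0 => /orP[/orP[]|/orP[]] /eqP ->.
- by exists f5_1.
- by exists f5_4.
- by exists f5_2.
by exists f5_3.
Qed.

(** A real matrix has entries in the image of [f5], and the orthonormality of its rows passes the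
    filters of the enumeration one row at a time. *)
Lemma forall_orthogonalP (P : seq f25 -> bool) N : forall_orthogonal P ->
  bar N = N -> N *m N^T = 1%:M -> exists s, [/\ size s = 9, N = mx25 s & P s].
Proof.
move=> H NR NN.
have E i j : exists a, N i j = iota5 a.
  by apply: real_iota5; rewrite -(barE k_char5) NR.
pose a i j : f25 := (projT1 (cid (E i j)), f5_0).
have aE i j : N i j = iota25 (a i j).
  by rewrite /iota25 /= [iota5 f5_0]/(0) mul0r addr0 -(projT2 (cid (E i j))).
pose r i := [:: a i 0; a i 1; a i 2%:R].
have allF (Q : f5 -> bool) x : all Q f5_enum -> Q x.
  by rewrite /f5_enum /= => /and5P[? ? ? ? /andP[? _]]; case: x.
have rP (Q : seq f25 -> bool) i : all_rows Q -> Q (r i).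
  move=> /allF - /(_ (a i 0).1) /allF - /(_ (a i 1).1) /allF - /(_ (a i 2%:R).1).
  exact.
have rdot i j : dot25 (r i) (r j) 0 0 = if i == j then f25_1 else f25_0.
  apply: iota25_inj; transitivity (\sum_l N i l * N j l).
    by rewrite big_ord3 !aE -addrA -!iota25M -!iota25D.
  have := congr1 (fun M : 'M_3 => M i j) NN; rewrite !mxE.
  rewrite (eq_bigr (fun l => N i l * N j l)); last by move=> l _; rewrite mxE.
  by move=> ->; case: eqP => _; rewrite ?iota25_1 ?iota25_0.
have eqxx25 x : f25eq x x by apply/f25eqP.
exists (r 0 ++ r 1 ++ r 2%:R); split=> //.
  apply/matrixP => i j; rewrite aE mxE.
  by elim/ord3_ind: i; elim/ord3_ind: j.
move: H => /(rP _ 0); rewrite rdot eqxx25 /= => /(rP _ 1); rewrite !rdot !eqxx25 /=.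
by move=> /(rP _ 2%:R); rewrite !rdot !eqxx25.
Qed.

End Embedding.

(** * The triangular graph T(7) *)

Section Triangular.
Local Open Scope group_scope.
Implicit Types (i j x y z : 'I_7) (e : pairs 7) (s t : 'S_7).

Lemma card_pair01 : #|[set (0%R : 'I_7); 1%R]%SET| == 2%N.
Proof. by rewrite cards2. Qed.

Definition pair01 : pairs 7 := @Sub _ _ (pairs 7) _ card_pair01.
(** For [i = j] this is the dummy pair {0, 1}, whence the hypotheses [i != j] below. *)
Definition mkpair i j : pairs 7 := insubd pair01 [set i; j]%SET.

Lemma val_mkpair i j : i != j -> val (mkpair i j) = [set i; j]%SET.
Proof. by move=> ij; rewrite val_insubd cards2 ij. Qed.

Lemma mkpairC i j : mkpair i j = mkpair j i.
Proof. by rewrite /mkpair finset.setUC. Qed.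

Lemma pairP e : exists i j, i != j /\ e = mkpair i j.
Proof.
have /cards2P[i [j [ij eij]]] := valP e; exists i, j; split=> //.
by apply: val_inj; rewrite val_mkpair.
Qed.

Lemma mem_pair x e : x \in val e -> exists2 y, x != y & e = mkpair x y.
Proof.
have [i [j [ij ->]]] := pairP e; rewrite val_mkpair // !inE => /orP[]/eqP->.
  by exists j.
by exists i; [rewrite eq_sym | rewrite mkpairC].
Qed.

Lemma mem_mkpair x i j : i != j -> (x \in val (mkpair i j)) = (x == i) || (x == j).
Proof. by move=> ij; rewrite val_mkpair // !inE. Qed.

Lemma pair_eq2 e x y : x != y -> x \in val e -> y \in val e -> e = mkpair x y.
Proof.
move=> xy /mem_pair[z xz ->]; rewrite mem_mkpair // eq_sym (negPf xy) /=.
by move/eqP->.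
Qed.

Lemma mkpair_eq i j x y : i != j -> x != y -> mkpair i j = mkpair x y ->
  (i = x /\ j = y) \/ (i = y /\ j = x).
Proof.
move=> ij xy e.
have := mem_mkpair i ij; rewrite eqxx e mem_mkpair // => /orP[]/eqP ix;
  have := mem_mkpair j ij; rewrite eqxx orbT e mem_mkpair // => /orP[]/eqP jy.
- by move: ij; rewrite ix jy eqxx.
- by left.
- by right.
by move: ij; rewrite ix jy eqxx.
Qed.

Lemma tri_adjacentP e e' : tri_adjacent e e' <->
  e <> e' /\ exists2 x, x \in val e & x \in val e'.
Proof.
split=> [[ne /set0Pn[x]]|[ne [x xe xe']]].
  by rewrite inE => /andP[xe xe']; split=> //; exists x.
by split=> //; apply/set0Pn; exists x; rewrite inE xe.
Qed.

Lemma pair_act_mkpair i j s : i != j -> pair_act (mkpair i j) s = mkpair (s i) (s j).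
Proof.
move=> ij; apply: val_inj; rewrite [RHS]val_mkpair ?(inj_eq perm_inj) //.
transitivity [set s l | l in val (mkpair i j)]%SET; first by [].
by rewrite val_mkpair // imsetU1 imset_set1.
Qed.

Lemma mem_pair_act x e s : (s x \in val (pair_act e s)) = (x \in val e).
Proof. by rewrite mem_imset //; apply: perm_inj. Qed.

Lemma pair_act1 e : pair_act e 1 = e.
Proof. by have [i [j [ij ->]]] := pairP e; rewrite pair_act_mkpair // !perm1. Qed.

Lemma pair_actM e s t : pair_act e (s * t) = pair_act (pair_act e s) t.
Proof.
have [i [j [ij ->]]] := pairP e.
by rewrite !pair_act_mkpair ?(inj_eq perm_inj) // !permM.
Qed.

Lemma pair_actK s : cancel (fun e => pair_act e s) (fun e => pair_act e s^-1).
Proof. by move=> e; rewrite -pair_actM mulgV pair_act1. Qed.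

Lemma pair_act_inj s : injective (fun e => pair_act e s).
Proof. exact: can_inj (pair_actK s). Qed.

Lemma tri_adjacent_act e e' s :
  tri_adjacent (pair_act e s) (pair_act e' s) <-> tri_adjacent e e'.
Proof.
rewrite !tri_adjacentP; split=> [[ne [x xe xe']]|[ne [x xe xe']]].
  split; first by move=> h; apply: ne; rewrite h.
  by exists (s^-1 x); rewrite -(mem_pair_act _ _ s) permKV.
split; first by move/pair_act_inj.
by exists (s x); rewrite mem_pair_act.
Qed.

Lemma fresh (A : seq 'I_7) : (size A < 7)%N -> exists x, x \notin A.
Proof.
move=> sA; apply/existsP; apply: contraLR sA; rewrite negb_exists => /forallP h.
rewrite -leqNgt; apply: leq_trans (_ : size (enum 'I_7) <= _); first by rewrite size_enum_ord.
apply: uniq_leq_size; first exact: enum_uniq.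
by move=> x _; move: (h x); rewrite negbK.
Qed.

Lemma fresh2 i j : exists x y, [/\ x != y, x != i, x != j & y != i /\ y != j].
Proof.
have [x] := @fresh [:: i; j] isT; rewrite !inE negb_or => /andP[xi xj].
have [y] := @fresh [:: x; i; j] isT; rewrite !inE !negb_or => /and3P[yx yi yj].
by exists x, y; rewrite eq_sym.
Qed.

(** The image of [i] is recovered as the common element of the images of two pairs through [i]. *)
Lemma pair_act_faithful s t : (forall e, pair_act e s = pair_act e t) -> s = t.
Proof.
move=> H; apply/permP => i; have [j [l [jl ji _ [li _]]]] := fresh2 i i.
have ij : i != j by rewrite eq_sym.
have il : i != l by rewrite eq_sym.
have := H (mkpair i j); have := H (mkpair i l); rewrite !pair_act_mkpair //.
case/mkpair_eq => [||[//]|[h1 h2]]; rewrite ?(inj_eq perm_inj) //.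
case/mkpair_eq => [||[//]|[h3 h4]]; rewrite ?(inj_eq perm_inj) //.
by move: jl; rewrite -(inj_eq (@perm_inj _ t)) -h1 -h3 eqxx.
Qed.

(** Three pairwise meeting pairs may be the sides of a triangle, without a common point; but no
    fourth pair meets all three sides. *)
Lemma clique4 e1 e2 e3 e4 x : x \in val e1 -> x \in val e2 ->
  tri_adjacent e1 e2 -> tri_adjacent e1 e3 -> tri_adjacent e1 e4 ->
  tri_adjacent e2 e3 -> tri_adjacent e2 e4 -> tri_adjacent e3 e4 -> x \in val e3.
Proof.
move=> /mem_pair[y xy ->] /mem_pair[z xz ->].
move=> /tri_adjacentP[n12 _] /tri_adjacentP[n13 [a a1 a3]] /tri_adjacentP[n14 [b b1 b4]].
move=> /tri_adjacentP[n23 [c c2 c3]] /tri_adjacentP[n24 [d d2 d4]] /tri_adjacentP[n34 [f f3 f4]].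
apply: contrapT => /negP x3.
have yz : y != z by apply/eqP => h; apply: n12; rewrite h.
move: a1 b1 c2 d2; rewrite !mem_mkpair // => /orP[]/eqP ha; first by rewrite -ha a3 in x3.
move=> hb /orP[]/eqP hc; first by rewrite -hc c3 in x3.
move=> hd; rewrite {}ha {}hc in a3 c3.
have e3E := pair_eq2 yz a3 c3.
have [x4|x4] := boolP (x \in val e4).
  move: f3; rewrite e3E mem_mkpair // => /orP[]/eqP hf; rewrite hf in f4.
    by apply: n14; rewrite (pair_eq2 xy x4 f4).
  by apply: n24; rewrite (pair_eq2 xz x4 f4).
move: hb hd => /orP[]/eqP hb; first by rewrite -hb b4 in x4.
move=> /orP[]/eqP hd; first by rewrite -hd d4 in x4.
by rewrite hb in b4; rewrite hd in d4; apply: n34; rewrite e3E (pair_eq2 yz b4 d4).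
Qed.

(* The six pairs containing [i] form a clique, hence so do their images, which
   therefore have a common point [g i]. *)
Lemma triangular_aut (f : pairs 7 -> pairs 7) : injective f ->
  (forall e e', tri_adjacent (f e) (f e') <-> tri_adjacent e e') ->
  exists s : 'S_7, forall e, f e = pair_act e s.
Proof.
move=> f_inj f_adj.
have adj i j l : i != j -> i != l -> j != l -> tri_adjacent (f (mkpair i j)) (f (mkpair i l)).
  move=> ij il jl; apply/f_adj/tri_adjacentP; split.
    case/mkpair_eq => // [[_]|[h _]]; first by apply/eqP.
    by move: il; rewrite h eqxx.
  by exists i; rewrite mem_mkpair ?eqxx.
have [g gP] : exists g : 'I_7 -> 'I_7, forall i j, i != j -> g i \in val (f (mkpair i j)).
  suff /boolp.choice[g gP] : forall i, exists x, forall j, i != j -> x \in val (f (mkpair i j)).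
    by exists g.
  move=> i; have [a [b [ab ai _ [bi _]]]] := fresh2 i i.
  have ia : i != a by rewrite eq_sym.
  have ib : i != b by rewrite eq_sym.
  have /tri_adjacentP[_ [x xa xb]] := adj i a b ia ib ab.
  exists x => j ij.
  have [->//|ja] := eqVneq j a; have [->//|jb] := eqVneq j b.
  have [c] := @fresh [:: i; a; b; j] isT; rewrite !inE !negb_or => /and4P[ci ca cb cj].
  have ic : i != c by rewrite eq_sym.
  apply: (@clique4 (f (mkpair i a)) (f (mkpair i b)) _ (f (mkpair i c))) => //;
    by apply: adj; rewrite // eq_sym.
have g_inj : injective g.
  (* If [g i = g j], the images of two disjoint pairs, one through [i] and one through [j], would
     meet. *)
  move=> i j gij; apply/eqP/negPn/negP => ij.
  have [a [b [ab ai aj [bi bj]]]] := fresh2 i j.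
  have ia : i != a by rewrite eq_sym.
  have jb : j != b by rewrite eq_sym.
  have nadj : ~ tri_adjacent (mkpair i a) (mkpair j b).
    move/tri_adjacentP => [_ [x]]; rewrite !mem_mkpair // => /orP[]/eqP->.
      by rewrite (negPf ij) eq_sym (negPf bi).
    by rewrite (negPf aj) (negPf ab).
  apply: nadj; apply/f_adj/tri_adjacentP; split.
    move/f_inj/mkpair_eq => [] // [h _]; first by rewrite h eqxx in ij.
    by rewrite h eqxx in bi.
  by exists (g i); [apply: gP | rewrite gij; apply: gP].
exists (perm g_inj) => e; have [i [j [ij ->]]] := pairP e.
rewrite pair_act_mkpair // !permE; apply: pair_eq2.
- by rewrite (inj_eq g_inj).
- exact: gP.
by rewrite mkpairC; apply: gP; rewrite eq_sym.
Qed.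

(** With [x = (0 1)], every [x * tperm i j] lies in [K]. Induction on the length of a product of
    transpositions then shows that the product, or [x] times it when it is odd, lies in [K]. *)
Lemma alt_gen (K : 'S_7 -> Prop) : K 1 -> (forall s t, K s -> K t -> K (s * t)) ->
  (forall s, K s -> K s^-1) ->
  (forall b : 'I_7, b != 0%R -> b != 1%R -> K (tperm 0%R 1%R * tperm 0%R b)) ->
  forall s, ~~ odd_perm s -> K s.
Proof.
move=> K1 KM KV Kgen.
pose x : 'S_7 := tperm 0%R 1%R.
have xx : x * x = 1 by rewrite tperm2.
have Kx b : b != 0%R -> K (x * tperm 0%R b).
  by move=> b0; have [->|b1] := eqVneq b 1%R; [rewrite xx | apply: Kgen].
have Kx' b : b != 0%R -> K (tperm 0%R b * x).
  by move=> b0; rewrite -[_ * _]invgK invMg !tpermV; apply: KV; apply: Kx.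
have Kt i j : i != j -> K (x * tperm i j).
  move=> ij; have [i0|i0] := eqVneq i 0%R; first by rewrite i0 in ij *; apply: Kx; rewrite eq_sym.
  have [j0|j0] := eqVneq j 0%R; first by rewrite j0 tpermC; apply: Kx.
  have -> : tperm i j = tperm 0%R i * tperm 0%R j * tperm 0%R i.
    have := tpermJ 0%R j (tperm 0%R i); rewrite tpermL tpermD //; last by rewrite eq_sym.
    by move=> <-; rewrite conjgE tpermV mulgA.
  have -> : x * (tperm 0%R i * tperm 0%R j * tperm 0%R i)
      = (x * tperm 0%R i) * (tperm 0%R j * x) * (x * tperm 0%R i).
    by rewrite -!mulgA (mulgA x x) xx mul1g.
  exact: KM (KM _ _ (Kx i i0) (Kx' j j0)) (Kx i i0).
have Kt' i j : i != j -> K (tperm i j * x).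
  by move=> ij; rewrite -[_ * _]invgK invMg !tpermV; apply: KV; apply: Kt.
suff H (ts : seq ('I_7 * 'I_7)) : all dpair ts ->
    let s := \prod_(t <- ts) tperm t.1 t.2 in
    (odd_perm s -> K (x * s)) /\ (~~ odd_perm s -> K s).
  move=> s; have [ts -> dts] := prod_tpermP s; exact: (H ts dts).2.
elim: ts => [_|[i j] ts IH /= /andP[ij /IH[Ho He]]].
  by rewrite /= big_nil odd_perm1.
rewrite big_cons /= odd_permM odd_tperm ij; set s := \prod_(t <- ts) _ in Ho He *.
split; rewrite ?negbK => h.
  by rewrite mulgA; apply: KM; [apply: Kt | apply: He].
have -> : tperm i j * s = tperm i j * x * (x * s) by rewrite -mulgA (mulgA x x) xx mul1g.
by apply: KM; [apply: Kt' | apply: Ho].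
Qed.

(** Any permutation with the three prescribed values can be made even by first applying (5 6), which
    leaves 0, 1 and 2 alone. *)
Lemma even_perm3 (a b c : 'I_7) : a != b -> a != c -> b != c -> exists s : 'S_7,
  [/\ ~~ odd_perm s, s 0%R = a, s 1%R = b & s 2%:R%R = c].
Proof.
move=> ab ac bc.
(* The factors (2 c'), (1 b'), (0 a) act in this order; [b'] and [c'] are the preimages of [b] and
   [c] under the factors that follow theirs. *)
pose b' := tperm 0%R a b; pose c' := tperm 1%R b' (tperm 0%R a c).
pose s : 'S_7 := tperm 2%:R%R c' * tperm 1%R b' * tperm 0%R a.
have t_inj (u v : 'I_7) := inj_eq (@perm_inj _ (tperm u v)).
have b'0 : b' != 0%R by rewrite -(tpermR 0%R a) t_inj eq_sym.
have c'1 : c' != 1%R by rewrite -(tpermR 1%R b') t_inj t_inj eq_sym.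
have c'0 : c' != 0%R.
  have e0 : tperm 1%R b' 0%R = 0%R by rewrite tpermD.
  by rewrite -e0 t_inj -[X in _ != X](tpermR 0%R a) t_inj eq_sym.
have s0 : s 0%R = a.
  by rewrite !permM (@tpermD _ 2%:R%R) // 1?eq_sym // (@tpermD _ 1%R) ?tpermL // eq_sym.
have s1 : s 1%R = b.
  by rewrite !permM (@tpermD _ 2%:R%R) // 1?eq_sym // tpermL tpermK.
have s2 : s 2%:R%R = c by rewrite !permM tpermL !tpermK.
have [odd_s|even_s] := boolP (odd_perm s); last by exists s.
exists (tperm 5%:R%R 6%:R%R * s); rewrite odd_permM odd_tperm odd_s.
by split=> //; rewrite permM tpermD.
Qed.

End Triangular.

(** * The component of x^2 + y^2 + z^2 = 0 *)

Section BaseComponent.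
Local Open Scope ring_scope.
Local Open Scope card_scope.
Local Open Scope classical_set_scope.
Variable k : closedFieldType.
Hypothesis k_char5 : 5%N \in [pchar k].
Variable w : k.
Hypothesis w2 : w ^+ 2 = 2%:R.
Local Notation Q0 := (@Q0 k).
Hypothesis tQ0 : totally_tangent_conics Q0.
Implicit Types (A B C N : 'M[k]_3) (Q : set (ppoint k)) (g h : PGL3 k).
Implicit Types (i j : 'I_7) (e : pairs 7) (s t : 'S_7).
Local Notation bar := (bar k_char5).
Local Notation unitary := (unitary k_char5).
Local Notation mx25 := (mx25 w).

Lemma det_orth_square A (d : k) : A *m A^T = d%:M -> \det A ^+ 2 = d ^+ 3.
Proof. by move/(congr1 determinant); rewrite det_mulmx det_tr det_scalar expr2. Qed.

(** From [A A^T = c] and unitarity, [A = c (bar A)], so [R = t A] with [t ^+ 4 = c] is real and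
    [R R^T = d] for some [d] in F_5. In odd dimension [d] is a square up to squares of the
    determinant: [(det R) ^+ 2 = d ^+ 3], and the factor [d / det R] makes [R] orthogonal. *)
Lemma stab_Q0 g : PGU g -> set_act Q0 g = Q0 ->
  exists N, [/\ bar N = N, N *m N^T = 1%:M & g = pgl N].
Proof.
move=> /(PGUP k_char5)[A uA ->] e; have Au := unitary_unit uA.
have eA : conic 1%:M = conic (A *m A^T).
  apply: (@set_act_inj k (pgl A)); rewrite [LHS]e.
  by rewrite -[A in A *m _]mulmx1 conic_act.
have sA : (A *m A^T)^T = A *m A^T by rewrite trmx_mul trmxK.
have [c ec] := conic_inj k_char5 (trmx1 _ _) sA (unitmx1 _ _) tQ0 eA.
rewrite scalemx1 in ec.
have c0 : c != 0.
  apply/eqP => c0; have : A *m A^T \in unitmx by rewrite unitmx_mul unitmx_tr Au.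
  by rewrite ec c0 unitmxE det_scalar expr0n unitr0.
have AbA : A = c *: bar A.
  apply: trmx_inj; rewrite linearZ /= -(unitary_invE uA).
  by rewrite -(mulKmx Au A^T) ec mul_mx_scalar.
have [t t0 tc] := nth_root_neq0 c0 (isT : (0 < 4)%N).
pose R := t *: A.
have bR : bar R = R.
  rewrite barZ exprSr tc /R -scalerA.
  by rewrite [in RHS]AbA !scalerA mulrC.
pose d := t ^+ 2 * c.
have RR : R *m R^T = d%:M.
  by rewrite /R linearZ /= -scalemxAl -scalemxAr scalerA ec scale_scalar_mx -expr2.
have d0 : d != 0 by rewrite mulf_neq0 // expf_neq0.
have pR : pgl A = pgl R by rewrite pgl_scale.
have Ru : R \in unitmx by rewrite unitmxZ // unitfE.
clearbody R d.
have d5 : d ^+ 5 = d.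
  have : bar (R *m R^T) = R *m R^T by rewrite barM bar_tr bR.
  by rewrite RR => /matrixP/(_ 0 0); rewrite barE !mxE eqxx /= !mulr1n.
have D5 : \det R ^+ 5 = \det R by rewrite -(det_bar k_char5) bR.
have DD := det_orth_square RR.
have D0 : \det R != 0.
  by apply: contra_eq_neq DD => ->; rewrite expr0n eq_sym expf_neq0.
pose a := d / \det R.
have a0 : a != 0 by rewrite mulf_neq0 // invr_eq0.
exists (a *: R); split.
- by rewrite barZ bR expr_div_n d5 D5.
- rewrite linearZ /= -scalemxAl -scalemxAr scalerA RR scale_scalar_mx.
  suff -> : a * a * d = 1 by [].
  by rewrite -expr2 expr_div_n DD mulrAC -exprSr divff // expf_neq0.
by rewrite pgl_scale.
Qed.

Definition conicm (i j : 'I_7) : 'M[k]_3 := mx25 (conic25 i j).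

Lemma conicmC i j : conicm i j = conicm j i.
Proof. by rewrite /conicm /conic25 minnC maxnC. Qed.

Lemma all_labels (P : pred (nat * nat)) i j : all P labels -> P (i : nat, j : nat).
Proof.
move/allP; apply; apply/allpairsP; exists (i : nat, j : nat).
by rewrite !mem_iota /= !add0n !ltn_ord.
Qed.

Lemma scalar_unit (c : k) : c != 0 -> (c%:M : 'M[k]_3) \in unitmx.
Proof. by move=> c0; rewrite unitmxE det_scalar unitfE expf_neq0. Qed.

Lemma unit_neq0 A : A \in unitmx -> A != 0.
Proof.
apply: contraTneq => ->; rewrite unitmxE det0 unitr0 //.
Qed.

Lemma unitary25P (r : seq f25) : unitary25 r ->
  size r = 9 /\ exists2 c, c != 0 & mx25 r *m (bar (mx25 r))^T = c%:M.
Proof.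
case/and3P => /eqP ss nz h; split=> //.
have := prop25P k_char5 w2 _ _ _ _ h.
rewrite mx25_id mx25_mulT // (mx25_conj k_char5 w2) => -[] //.
- by rewrite -(mx25_conj k_char5 w2) -mx25_mulT //; apply: nonzero25P nz.
- exact/unit_neq0/unitmx1.
by move=> c c0 ->; exists c; rewrite // scalemx1.
Qed.

Lemma unitary25_unit (r : seq f25) : unitary25 r -> mx25 r \in unitmx.
Proof.
move=> /unitary25P[_ [c c0 e]].
by have := scalar_unit c0; rewrite -e unitmx_mul => /andP[].
Qed.

Lemma conic25_ok i j : i != j -> unitary25 (conic25 i j) /\ symmetric25 (conic25 i j).
Proof.
move=> ij; have : (i == j :> nat) || unitary25 (conic25 i j) && symmetric25 (conic25 i j)
  := all_labels i j check_conics.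
by rewrite (inj_eq val_inj) (negPf ij) => /andP[].
Qed.

Lemma size_conic25 i j : i != j -> size (conic25 i j) = 9.
Proof. by move=> /conic25_ok[/unitary25P[]]. Qed.

Lemma conicm_sym_unit i j : i != j -> (conicm i j)^T = conicm i j /\ conicm i j \in unitmx.
Proof.
move=> /conic25_ok[/unitary25_unit u /and3P[/f25eqP e01 /f25eqP e02 /f25eqP e12]].
split=> //; apply/matrixP => a b; rewrite !mxE.
by elim/ord3_ind: a; elim/ord3_ind: b; rewrite /= ?e01 ?e02 ?e12.
Qed.

(** Quantifying over both orders of the pair avoids a choice; the two give the same conic by
    [conicmC]. *)
Definition phi0 (e : pairs 7) : set (ppoint k) :=
  [set p | exists i j, [/\ i != j, e = mkpair i j & conic (conicm i j) p]].

Lemma phi0E i j : i != j -> phi0 (mkpair i j) = conic (conicm i j).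
Proof.
move=> ij; apply/seteqP; split=> [p [a [b [ab /(mkpair_eq ij ab) h cp]]]|p cp].
  by case: h => -[-> ->] //; rewrite conicmC.
by exists i, j.
Qed.

Lemma conicm01 : conicm 0 1 = 1%:M.
Proof. exact: mx25_id. Qed.

Lemma phi0_01 : phi0 (mkpair 0 1) = Q0.
Proof. by rewrite phi0E // conicm01. Qed.

(** The cube root of unity [2 + 3 w], with square [2 + 2 w], chosen to agree with the tabulated
    conic {0, 2}. *)
Let z : k := iota25 w (f5_2, f5_3).

Lemma z_root : z ^+ 2 + z + 1 = 0.
Proof.
rewrite /z /iota25 /iota5 /=.
transitivity (5%:R * (2%:R + 3%:R * w) + 9%:R * (w ^+ 2 - 2%:R) + 5%:R * 3%:R : k); first by ring.
by rewrite w2 subrr natr5 // !mul0r mulr0 !addr0.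
Qed.

Lemma conicm02 : conicm 0 2%:R = diag3 1 z (z ^+ 2).
Proof.
have z2 : iota25 w (f5_2, f5_2) = z ^+ 2.
  rewrite /z /iota25 /iota5 /=; apply/eqP; rewrite -subr_eq0; apply/eqP.
  transitivity (- (5%:R * (4%:R + 2%:R * w) + 9%:R * (w ^+ 2 - 2%:R)) : k); first by ring.
  by rewrite w2 subrr natr5 // !mul0r mulr0 addr0 oppr0.
apply/matrixP => a b; rewrite !mxE.
by elim/ord3_ind: a; elim/ord3_ind: b;
  rewrite /= ?mulr1n ?mulr0n -?z2 ?(iota25_0 w) ?(iota25_1 w).
Qed.

Definition realized s : Prop :=
  exists2 g, PGU g & forall e, set_act (phi0 e) g = phi0 (pair_act e s).

Lemma realized1 : realized (1%g : 'S_7).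
Proof.
exists 1%g; first exact: PGU1.
by move=> e; rewrite set_act1 pair_act1.
Qed.

Lemma realizedM s t : realized s -> realized t -> realized (s * t)%g.
Proof.
move=> [g Gg hg] [h Gh hh]; exists (g * h)%g; first exact: PGUM.
by move=> e; rewrite set_actM hg hh pair_actM.
Qed.

Lemma realizedV s : realized s -> realized s^-1%g.
Proof.
move=> [g Gg hg]; exists g^-1%g; first exact: PGUV.
move=> e; have -> : phi0 e = set_act (phi0 (pair_act e s^-1)) g.
  by rewrite hg -pair_actM mulVg pair_act1.
by rewrite set_actK.
Qed.

Lemma cycle_natE (b i : 'I_7) : b != 0 -> b != 1 ->
  ((tperm 0%R 1%R * tperm 0%R b)%g i : nat) = cycle_nat b i.
Proof.
move=> b0 b1; rewrite permM /cycle_nat !val_eqE.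
have v0 : (val i == 0)%N = (i == 0) by [].
have v1 : (val i == 1)%N = (i == 1) by [].
rewrite v0 v1; have [->|i0] := eqVneq i 0.
  by rewrite tpermL tpermD // eq_sym.
have [->|i1] := eqVneq i 1; first by rewrite tpermR tpermL.
rewrite (@tpermD _ 0 1 i) 1?eq_sym //; have [->|ib] := eqVneq i b; first by rewrite tpermR.
by rewrite tpermD // eq_sym.
Qed.

Lemma realized_cycle (b : 'I_7) : b != 0 -> b != 1 -> realized (tperm 0%R 1%R * tperm 0%R b)%g.
Proof.
move=> b0 b1.
have bI : (b : nat) \in iota 2 5.
  rewrite mem_iota /= [(b < 7)%N]ltn_ord andbT.
  by move: b0 b1; case: b => -[|[|]].
have /andP[ub hc] : unitary25 (cycle25 b) && all (fun f : nat * nat => (f.1 == f.2) ||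
    prop25 (congruent (cycle25 b) (conic25 (cycle_nat b f.1) (cycle_nat b f.2)))
      (conic25 f.1 f.2)) labels := allP check_cycles _ bI.
have [ss [c c0 AA]] := unitary25P ub; have Au := unitary25_unit ub.
set A := mx25 (cycle25 b) in AA Au.
(* The tabulated matrix is unitary up to a scalar; rescaling does not change its class. *)
have [t t0 tc] := nth_root_neq0 (invr_neq0 c0) (isT : (0 < 6)%N).
have uA : unitary (t *: A).
  suff : t *: A *m (bar (t *: A))^T = 1%:M by [].
  rewrite barZ linearZ /= -scalemxAl -scalemxAr scalerA -exprS tc AA scale_scalar_mx.
  by rewrite mulVf.
exists (pgl A); first by rewrite -(pgl_scale t0 Au); apply: PGU_unitary uA.
move=> e; have [i [j [ij ->]]] := pairP e.
set s := (_ * _)%g; have sij : s i != s j by rewrite (inj_eq perm_inj).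
rewrite pair_act_mkpair // !phi0E //.
have [sym1 u1] := conicm_sym_unit ij; have [sym2 u2] := conicm_sym_unit sij.
have : (i == j :> nat) || prop25 (congruent (cycle25 b)
    (conic25 (cycle_nat b i) (cycle_nat b j))) (conic25 i j) := all_labels i j hc.
rewrite (inj_eq val_inj) (negPf ij) -!cycle_natE // => hp.
have eC : mx25 (congruent (cycle25 b) (conic25 (s i) (s j))) = A *m conicm (s i) (s j) *m A^T.
  exact: mx25_congruent.
have [//||||d d0 ed] := prop25P k_char5 w2 _ _ _ _ hp.
- exact: size_conic25.
- by rewrite eC; apply: unit_neq0; rewrite !unitmx_mul unitmx_tr Au u2.
- exact: unit_neq0.
by rewrite -(conic_act (conicm (s i) (s j)) Au) -eC ed conic_scale.
Qed.

Lemma realized_even s : ~~ odd_perm s -> realized s.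
Proof.
move: s; apply: alt_gen; [exact: realized1 | exact: realizedM | exact: realizedV |].
exact: realized_cycle.
Qed.

Lemma pair_transitive e : exists2 s, ~~ odd_perm s & e = pair_act (mkpair 0 1) s.
Proof.
have [i [j [ij ->]]] := pairP e.
have [l] := @fresh [:: i; j] isT; rewrite !inE negb_or => /andP[li lj].
have [||s [se s0 s1 _]] := @even_perm3 i j l ij; rewrite 1?eq_sym //.
by exists s => //; rewrite pair_act_mkpair // s0 s1.
Qed.

Lemma totally_tangent_phi0 e : totally_tangent_conics (phi0 e).
Proof.
have [s se ->] := pair_transitive e; have [g Gg hg] := realized_even se.
by rewrite -hg phi0_01; apply: totally_tangent_act.
Qed.

Lemma phi0_inj : injective phi0.
Proof.
move=> e f; have [i [j [ij ->]]] := pairP e; have [a [b [ab ->]]] := pairP f.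
move=> eq; have := eq; rewrite !phi0E // => ec.
have [si ui] := conicm_sym_unit ij; have [sa ua] := conicm_sym_unit ab.
have tt : totally_tangent_conics (conic (conicm a b)).
  by rewrite -phi0E //; apply: totally_tangent_phi0.
have [c ecm] := conic_inj k_char5 sa si ua tt (esym ec).
have p := prop25I k_char5 w2 (size_conic25 ij) (size_conic25 ab) ecm.
have : [|| i == j :> nat, a == b :> nat, (i == a :> nat) && (j == b :> nat),
    (i == b :> nat) && (j == a :> nat) | ~~ prop25 (conic25 i j) (conic25 a b)]
  := all_labels a b (all_labels i j check_distinct).
rewrite p !(inj_eq val_inj).
rewrite (negPf ij) (negPf ab) /= orbF => /orP[/andP[/eqP-> /eqP->]//|/andP[/eqP-> /eqP->]].
exact: mkpairC.
Qed.

Lemma Q0_neighbours Q : adjacent Q0 Q ->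
  exists2 e, tri_adjacent (mkpair 0 1) e & Q = phi0 e.
Proof.
move=> adj; have [_ tQ _ _ _] := adj.
have [B [sB BB eB _]] := totally_tangent_hermitian k_char5 tQ.
rewrite eB in adj *.
have [N [c [bN NN c0 eBN]]] := neighbour_form z_root sB BB adj.
(* The normal form has [N^T] on the left and [congruent s] has [s] there, so the check is applied to
   [N^T]. *)
have bM : bar N^T = N^T by rewrite bar_tr bN.
have MM : N^T *m N^T^T = 1%:M by rewrite trmxK mulmx1C.
have [s [ss eM hs]] := forall_orthogonalP w2 check_neighbours bM MM.
have /hasP[n nI hp] : has (fun j : nat => prop25 (congruent s (conic25 0 2)) (conic25 0 j)
    || prop25 (congruent s (conic25 0 2)) (conic25 1 j)) (iota 2 5) := hs.
have n7 : (n < 7)%N by move: nI; rewrite mem_iota => /andP[].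
pose j : 'I_7 := Ordinal n7.
have j0 : 0 != j by apply/eqP => /(congr1 val) /= h; move: nI; rewrite -h.
have j1 : 1 != j by apply/eqP => /(congr1 val) /= h; move: nI; rewrite -h.
have [sD uD] : (conicm 0 2%:R)^T = conicm 0 2%:R /\ conicm 0 2%:R \in unitmx.
  exact: conicm_sym_unit.
have Nu : N^T \in unitmx by case/mulmx1_unit: MM.
have eC : mx25 (congruent s (conic25 0 2)) = N^T *m diag3 1 z (z ^+ 2) *m N.
  transitivity (mx25 s *m conicm 0 2%:R *m (mx25 s)^T); last by rewrite -eM conicm02 trmxK.
  exact: mx25_congruent.
have key (i : 'I_7) : i != j -> prop25 (congruent s (conic25 0 2)) (conic25 i j) ->
    conic B = phi0 (mkpair i j).
  move=> ij h; have [si ui] := conicm_sym_unit ij.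
  have [//||||d d0 ed] := prop25P k_char5 w2 _ _ _ _ h.
  - exact: size_conic25.
  - rewrite eC -conicm02; apply: unit_neq0.
    by rewrite !unitmx_mul Nu uD -unitmx_tr Nu.
  - exact: unit_neq0.
  by rewrite phi0E // eBN -eC ed !conic_scale.
case/orP: hp => hp; [exists (mkpair 0 j)|exists (mkpair 1 j)]; try exact: key.
  apply/tri_adjacentP; split; last by exists 0; rewrite mem_mkpair ?eqxx.
  by case/mkpair_eq => // -[h1 h2]; [case/eqP: j1 | case/eqP: j0].
apply/tri_adjacentP; split; last by exists 1; rewrite mem_mkpair ?eqxx ?orbT.
by case/mkpair_eq => // -[h1 h2]; case/eqP: j0.
Qed.

(** Adjacent pairs are [{x, a}] and [{x, b}]; an even permutation sends 0, 1, 2 to [x], [a], [b],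
    which reduces the claim to [adjacent_base]. *)
Lemma adjacent_phi0 e e' : tri_adjacent e e' -> adjacent (phi0 e) (phi0 e').
Proof.
move=> /tri_adjacentP[ne [x /mem_pair[a xa ee] /mem_pair[b xb ee']]].
rewrite ee ee' in ne *.
have ab : a != b by apply/eqP => h; apply: ne; rewrite h.
have [s [se s0 s1 s2]] := even_perm3 xa xb ab.
have [g Gg hg] := realized_even se.
have -> : mkpair x a = pair_act (mkpair 0 1) s by rewrite pair_act_mkpair // s0 s1.
have -> : mkpair x b = pair_act (mkpair 0 2%:R) s by rewrite pair_act_mkpair // s0 s2.
rewrite -!hg; apply: (adjacent_act k_char5 Gg).
rewrite phi0_01 phi0E // conicm02.
exact: (adjacent_base k_char5 z_root tQ0).
Qed.

Lemma phi0_neighbours e Q : adjacent (phi0 e) Q ->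
  exists2 e', tri_adjacent e e' & Q = phi0 e'.
Proof.
have [s se ->] := pair_transitive e; have [g Gg hg] := realized_even se.
rewrite -hg phi0_01 -[X in adjacent _ X](set_actVK _ g) => /(adjacent_actE k_char5 _ _ Gg).
case/Q0_neighbours => e' adj eQ; exists (pair_act e' s); first exact/tri_adjacent_act.
by rewrite -hg -eQ set_actVK.
Qed.

Lemma phi0_adjP e e' : tri_adjacent e e' <-> adjacent (phi0 e) (phi0 e').
Proof.
split=> [|/phi0_neighbours[f adj /phi0_inj ->//]].
exact: adjacent_phi0.
Qed.

Definition component Q : set (set (ppoint k)) :=
  [set Q' | Relation_Operators.clos_refl_trans _ (@adjacent k) Q Q'].

(** The labelled conics are closed under adjacency, and {i, j} is reached from {0, 1} through {0,
    i}. *)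
Lemma component_Q0 : component Q0 = range phi0.
Proof.
apply/seteqP; split=> [Q|_ [e _ <-]].
  suff H X Y : Relation_Operators.clos_refl_trans _ (@adjacent k) X Y ->
      range phi0 X -> range phi0 Y.
    by move=> h; apply: (H _ _ h); exists (mkpair 0 1); rewrite ?phi0_01.
  elim=> [{}X {}Y adj [e _ eX]|//|{}X {}Y Z _ IH1 _ IH2 h].
    by rewrite -eX in adj; have [f _ ->] := phi0_neighbours adj; exists f.
  exact/IH2/IH1.
have step f f' : tri_adjacent f f' ->
    Relation_Operators.clos_refl_trans _ (@adjacent k) (phi0 f) (phi0 f').
  by move=> h; apply: Relation_Operators.rt_step; apply: adjacent_phi0.
rewrite /component /= -phi0_01.
have [i [j [ij ->]]] := pairP e.
have [i0|i0] := eqVneq i 0.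
  rewrite i0 in ij *; have [->|j1] := eqVneq j 1; first exact: Relation_Operators.rt_refl.
  apply: step; apply/tri_adjacentP; split; last by exists 0; rewrite mem_mkpair ?eqxx.
  by case/mkpair_eq => // -[h1 h2]; [case/eqP: j1 | case/eqP: ij].
apply: (Relation_Operators.rt_trans _ _ _ (phi0 (mkpair 0 i))).
  have [->|i1] := eqVneq i 1; first exact: Relation_Operators.rt_refl.
  apply: step; apply/tri_adjacentP; split; last by exists 0; rewrite mem_mkpair ?eqxx // eq_sym.
  by case/mkpair_eq => //; rewrite 1?eq_sym // => -[h1 h2]; [case/eqP: i1 | case/eqP: i0].
have [->|j0] := eqVneq j 0; first by rewrite mkpairC; exact: Relation_Operators.rt_refl.
apply: step; apply/tri_adjacentP; split; last first.
  by exists i; rewrite mem_mkpair ?eqxx ?orbT // eq_sym.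
by case/mkpair_eq => //; rewrite 1?eq_sym // => -[h1 h2]; [case/eqP: i0 | case/eqP: j0].
Qed.

(** The case [j = 1] makes [g] real orthogonal by [stab_Q0]; the other three are the conditions of
    [check_fixed], which leave only scalar matrices. *)
Lemma fixed_conics_eq1 g : PGU g ->
  (forall j : 'I_7, (0 < j < 5)%N -> set_act (phi0 (mkpair 0 j)) g = phi0 (mkpair 0 j)) ->
  g = 1%g.
Proof.
move=> Gg H; have e01 := H 1 isT; rewrite phi0_01 in e01.
have [N [bN NN eg]] := stab_Q0 Gg e01.
have Nu : N \in unitmx by case/mulmx1_unit: NN.
have [s [ss eN hs]] := forall_orthogonalP w2 check_fixed bN NN.
pose fix_ok (j : nat) := prop25 (congruent s (conic25 0 j)) (conic25 0 j).
have {}hs : if [&& fix_ok 2, fix_ok 3 & fix_ok 4] then prop25 s id25 else true := hs.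
have fixes (j : 'I_7) : (0 < j < 5)%N -> fix_ok j.
  move=> j5; have j0 : 0 != j by apply/eqP => h; move: j5; rewrite -h.
  have [sj uj] := conicm_sym_unit j0.
  have := H j j5; rewrite phi0E // => ec.
  have tt : totally_tangent_conics (conic (conicm 0 j)).
    by rewrite -phi0E //; apply: totally_tangent_phi0.
  have eC : conic (conicm 0 j) = conic (N *m conicm 0 j *m N^T).
    by apply: (@set_act_inj k g); rewrite ec eg conic_act.
  have sC : (N *m conicm 0 j *m N^T)^T = N *m conicm 0 j *m N^T.
    by rewrite !trmx_mul trmxK sj mulmxA.
  have [c ecm] := conic_inj k_char5 sj sC uj tt eC.
  apply: (prop25I k_char5 w2 (c := c)) => //; first exact: (size_conic25 j0).
  rewrite -[mx25 (conic25 0 j)]/(conicm 0 j) -ecm eN; exact: mx25_congruent.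
have f2 : fix_ok 2 := fixes 2%:R isT.
have f3 : fix_ok 3 := fixes 3%:R isT.
have f4 : fix_ok 4 := fixes 4%:R isT.
rewrite f2 f3 f4 in hs.
have [//||||c c0 ec] := prop25P k_char5 w2 _ _ _ _ hs.
- by [].
- by rewrite -eN; apply: unit_neq0.
- by rewrite mx25_id; apply/unit_neq0/unitmx1.
by rewrite eg eN ec mx25_id pgl_scale ?unitmx1 // pgl1.
Qed.

End BaseComponent.

(** * The action of PGU_3(F_25) on a component *)

Section Component.
Local Open Scope ring_scope.
Local Open Scope card_scope.
Local Open Scope classical_set_scope.
Variable k : closedFieldType.
Hypothesis k_char5 : 5%N \in [pchar k].
Implicit Types (Q X : set (ppoint k)) (D : set (set (ppoint k))) (g h : PGL3 k).
Implicit Types (e : pairs 7) (s t : 'S_7) (phi : pairs 7 -> set (ppoint k)).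
Local Notation Q0 := (@Q0 k).

Lemma component_act Q h : PGU h ->
  component (set_act Q h) = [set set_act X h | X in component Q].
Proof.
move=> Gh.
have H g X Y : PGU g -> component X Y -> component (set_act X g) (set_act Y g).
  move=> Gg; elim=> [{}X {}Y adj|{}X|{}X {}Y Z _ IH1 _ IH2].
  - by apply: Relation_Operators.rt_step; apply: (adjacent_act k_char5).
  - exact: Relation_Operators.rt_refl.
  exact: Relation_Operators.rt_trans IH1 IH2.
apply/seteqP; split=> [X cX|_ [X cX <-]]; last exact: H.
exists (set_act X h^-1%g); last exact: set_actVK.
by rewrite -(set_actK Q h); apply: H => //; apply: PGUV.
Qed.

Lemma triangular_iso_act phi D h : PGU h -> triangular_iso phi D ->
  triangular_iso (fun e => set_act (phi e) h) [set set_act X h | X in D].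
Proof.
move=> Gh [phi_inj phiD phi_adj]; split.
- by move=> e f /set_act_inj/phi_inj.
- rewrite -phiD; apply/seteqP; split=> [_ [e _ <-]|_ [_ [e _ <-] <-]]; last by exists e.
  by exists (phi e) => //; exists e.
move=> a b; split=> [/phi_adj ab|/(adjacent_actE k_char5 _ _ Gh)/phi_adj//].
exact/(adjacent_actE k_char5 _ _ Gh).
Qed.

(** The two identifications differ by an automorphism of T(7), hence by a permutation of the
    labels. *)
Lemma triangular_iso_relabel phi psi D : triangular_iso phi D -> triangular_iso psi D ->
  exists s, forall e, psi e = phi (pair_act e s).
Proof.
move=> [phi_inj phiD phi_adj] [psi_inj psiD psi_adj].
have /boolp.choice[f fP] : forall e, exists e', psi e = phi e'.
  move=> e; have : D (psi e) by rewrite -psiD; exists e.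
  by rewrite -phiD => -[e' _ <-]; exists e'.
have [e e' eq|e e'|s sP] := @triangular_aut f.
- by apply: psi_inj; rewrite !fP eq.
- by rewrite phi_adj -!fP -psi_adj.
by exists s => e; rewrite fP sP.
Qed.

(** The content of the theorem before [rho] is chosen: the image lies in A_7, it is all of A_7, and
    the kernel is trivial. Stated element by element, it is easy to transport. *)
Definition alternating_action phi D : Prop :=
  [/\ forall g, stab D g ->
        exists2 s, ~~ odd_perm s & forall e, set_act (phi e) g = phi (pair_act e s),
      forall s, ~~ odd_perm s ->
        exists2 g, stab D g & forall e, set_act (phi e) g = phi (pair_act e s) &
      forall g, PGU g -> (forall e, set_act (phi e) g = phi e) -> g = 1%g].

Lemma alternating_action_phi0 w : w ^+ 2 = 2%:R -> totally_tangent_conics Q0 ->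
  alternating_action (phi0 w) (range (phi0 w)).
Proof.
move=> w2 tQ0; have inj0 := phi0_inj k_char5 w2 tQ0.
have tri0 : triangular_iso (phi0 w) (range (phi0 w)).
  by split=> // a b; apply: phi0_adjP.
split=> [g [Gg gD]|s /(realized_even k_char5 w2)[g Gg hg]|g Gg H].
- have [s hs] : exists s, forall e, set_act (phi0 w e) g = phi0 w (pair_act e s).
    by apply: (triangular_iso_relabel tri0); have := triangular_iso_act Gg tri0; rewrite gD.
  exists s => //; apply/negP => odd_s.
  (* Otherwise an element of PGU would induce the transposition (5 6), which fixes
     the conics {0, 1}, {0, 2}, {0, 3} and {0, 4}. *)
  pose t := tperm (5%:R : 'I_7) 6%:R.
  have [|g' Gg' hg'] := @realized_even k k_char5 w w2 (s^-1 * t)%g.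
    by rewrite odd_permM odd_permV odd_s odd_tperm.
  have hgg e : set_act (phi0 w e) (g * g')%g = phi0 w (pair_act e t).
    by rewrite set_actM hs hg' -pair_actM mulKVg.
  have gg1 : (g * g')%g = 1%g.
    apply: (fixed_conics_eq1 k_char5 w2 tQ0); first exact: PGUM.
    move=> j /andP[j0 j5]; rewrite hgg pair_act_mkpair; last first.
      by apply/eqP => h; move: j0; rewrite -h.
    by rewrite !tpermD //; apply/eqP => h; move: j5; rewrite -h.
  have := hgg (mkpair 0 5%:R); rewrite gg1 set_act1 pair_act_mkpair // tpermL tpermD //.
  by move/inj0/mkpair_eq => [] // -[].
- exists g => //; split=> //; apply/seteqP; split=> [_ [_ [e _ <-] <-]|_ [e _ <-]].
    by rewrite hg; exists (pair_act e s).
  exists (phi0 w (pair_act e s^-1%g)); first by exists (pair_act e s^-1%g).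
  by rewrite hg -pair_actM mulVg pair_act1.
by apply: (fixed_conics_eq1 k_char5 w2 tQ0).
Qed.

Lemma stab_act D g h : PGU h ->
  stab [set set_act X h | X in D] g -> stab D (h * g * h^-1)%g.
Proof.
move=> Gh [Gg gD]; split; first by apply: PGUM; [apply: PGUM | apply: PGUV].
apply/seteqP; split=> [_ [X DX <-]|X DX].
  have : [set set_act X h | X in D] (set_act (set_act X h) g).
    by rewrite -{1}gD; exists (set_act X h) => //; exists X.
  by case=> Y DY eY; rewrite !set_actM -eY set_actK.
have : [set set_act X h | X in D] (set_act X h) by exists X.
rewrite -{1}gD => -[_ [Y DY <-] eY]; exists Y => //.
by rewrite !set_actM eY set_actK.
Qed.

(** Conjugation by [h] matches the two stabilisers without changing the permutations of labels. *)
Lemma alternating_action_act phi D h : PGU h -> alternating_action phi D ->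
  alternating_action (fun e => set_act (phi e) h) [set set_act X h | X in D].
Proof.
move=> Gh [H1 H2 H3]; split=> [g /(stab_act Gh)/H1[s se hs]|s /H2[g sg hg]|g Gg H].
- exists s => // e; rewrite -hs -!set_actM; congr set_act.
  by rewrite -!mulgA mulVg mulg1.
- exists (h^-1 * g * h)%g; last by move=> e; rewrite -hg -!set_actM !mulgA mulgV mul1g.
  have ED : D = [set set_act X h^-1%g | X in [set set_act X h | X in D]].
    apply/seteqP; split=> [X DX|_ [_ [X DX <-] <-]]; last by rewrite set_actK.
    by exists (set_act X h); rewrite ?set_actK //; exists X.
  have := @stab_act [set set_act X h | X in D] g h^-1%g (PGUV Gh).
  by rewrite -ED invgK; apply.
have e1 : (h * g * h^-1)%g = 1%g.
  apply: H3 => [|e]; first by apply: PGUM; [apply: PGUM | apply: PGUV].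
  by rewrite !set_actM H set_actK.
by rewrite -[g](mulKg h) -[(h * g)%g](mulgKV h) e1 mul1g mulVg.
Qed.

(** Relabelling conjugates the induced permutations by [s], and conjugation preserves parity. *)
Lemma alternating_action_relabel phi D s : alternating_action phi D ->
  alternating_action (fun e => phi (pair_act e s)) D.
Proof.
move=> [H1 H2 H3]; split=> [g /H1[t et ht]|t et|g Gg H].
- exists (t ^ s^-1)%g; first by rewrite odd_permJ.
  by move=> e; rewrite ht -!pair_actM conjgE invgK -!mulgA mulVg mulg1.
- have [|g sg hg] := H2 (t ^ s)%g; first by rewrite odd_permJ.
  by exists g => // e; rewrite hg -!pair_actM conjgE mulKVg.
apply: H3 => // e; have := H (pair_act e s^-1%g).
by rewrite -pair_actM mulVg pair_act1.
Qed.

(** The permutation induced by an element is unique, so a pointwise choice is a homomorphism on the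
    stabiliser. It is injective there because [g * h^-1] fixes all conics when [rho g = rho h]. *)
Lemma alternating_representation phi D : injective phi -> alternating_action phi D ->
  exists rho : PGL3 k -> 'S_7,
    [/\ forall g e, stab D g -> set_act (phi e) g = phi (pair_act e (rho g)),
        forall g h, stab D g -> stab D h -> rho (g * h)%g = (rho g * rho h)%g,
        forall g h, stab D g -> stab D h -> rho g = rho h -> g = h &
        rho @` stab D = [set s | s \in ('Alt_('I_7))%g]].
Proof.
move=> phi_inj [H1 H2 H3].
have unique s t : (forall e, phi (pair_act e s) = phi (pair_act e t)) -> s = t.
  by move=> H; apply: pair_act_faithful => e; apply: phi_inj.
have /boolp.choice[rho rhoP] : forall g, exists s, stab D g ->
    ~~ odd_perm s /\ forall e, set_act (phi e) g = phi (pair_act e s).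
  move=> g; have [/H1[s se hs]|ng] := pselect (stab D g); first by exists s.
  (* A dummy value outside the stabiliser. *)
  by exists 1%g.
have rhoE g e : stab D g -> set_act (phi e) g = phi (pair_act e (rho g)).
  by move=> /rhoP[_ ->].
have stabM g h : stab D g -> stab D h -> stab D (g * h)%g.
  move=> [Gg gD] [Gh hD]; split; first exact: PGUM.
  rewrite -{2}hD -{2}gD; apply/seteqP; split=> [_ [X DX <-]|_ [_ [X DX <-] <-]].
    by exists (set_act X g); [exists X | rewrite set_actM].
  by exists X; rewrite ?set_actM.
exists rho; split=> // [g h sg sh|g h sg sh eq|].
- apply: unique => e; rewrite pair_actM -rhoE //; last exact: stabM.
  by rewrite set_actM !rhoE.
- suff e1 : (g * h^-1)%g = 1%g by rewrite -[g](mulgKV h) e1 mul1g.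
  apply: H3; first by apply: PGUM; [case: sg | apply: PGUV; case: sh].
  by move=> e; rewrite set_actM rhoE // eq -rhoE // set_actK.
apply/seteqP; split=> [_ [g sg <-]|s]; rewrite /= Alt_even; first by case: (rhoP g sg).
move=> se; have [g sg hg] := H2 s se; exists g => //.
by apply: unique => e; rewrite -rhoE.
Qed.

Lemma component_alternating D : conic_components D ->
  exists2 phi, triangular_iso phi D & alternating_action phi D.
Proof.
move=> [Q tQ ->]; rewrite -/(component Q).
have [h Gh eQ] := totally_tangent_Q0 k_char5 tQ.
have tQ0 : totally_tangent_conics Q0.
  by rewrite -(set_actK Q0 h) -eQ; apply: (totally_tangent_act k_char5) => //; apply: PGUV.
have [w w2] := sqrt2_exists k.
rewrite eQ component_act // (component_Q0 k_char5 w2 tQ0).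
exists (fun e => set_act (phi0 w e) h).
  apply: triangular_iso_act => //; split=> //; first exact: phi0_inj.
  by move=> a b; apply: phi0_adjP.
by apply: alternating_action_act => //; apply: alternating_action_phi0.
Qed.

End Component.

Local Open Scope classical_set_scope.

Theorem theorem1p15 (k : closedFieldType) (k_char5 : 5%N \in [pchar k]%R)
    (D : set (set (ppoint k))) (D_component : conic_components D) :
  (exists phi : pairs 7 -> set (ppoint k), triangular_iso phi D) /\
  (forall phi : pairs 7 -> set (ppoint k), triangular_iso phi D ->
    exists rho : PGL3 k -> 'S_7,
      [/\ forall g e, stab D g -> set_act (phi e) g = phi (pair_act e (rho g)),
          forall g h, stab D g -> stab D h ->
            rho (g * h)%g = (rho g * rho h)%g,
          forall g h, stab D g -> stab D h -> rho g = rho h -> g = h &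
          rho @` stab D = [set s | s \in ('Alt_('I_7))%g]]).
Proof.
have [phi0 tri0 alt0] := component_alternating k_char5 D_component.
split=> [|phi tri]; first by exists phi0.
have [s hs] := triangular_iso_relabel tri0 tri; have [phi_inj _ _] := tri.
apply: alternating_representation => //.
have -> : phi = fun e => phi0 (pair_act e s) by apply: funext.
exact: alternating_action_relabel.
Qed.
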